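(* Let $\gamma\in(0,1]$ and let $f\in \mathrm{D}^{1+\mathcal{Z}_{\gamma}}(\mathbb{S}^{1}\setminus\{\xi_{0}\})$ be a circle diffeomorphism with break point $\xi_0$ whose rotation number $\rho$ is irrational. Then there exist a constant $C=C(f)>0$ and a natural number $N_0=N_0(f)$ such that for all $n\geq N_0$ $$\|f_{n}-\widetilde{F}_{n}\|_{C^{1}([-1,0])}\leq \frac{C}{n^{\gamma}},\qquad \|g_{n}-\widehat{G}_{n}\|_{C^{1}([0,a_{n}])}\leq \frac{C}{n^{\gamma}}.$$
   Context: $\mathbb{S}^1=\mathbb{R}/\mathbb{Z}$. A circle diffeomorphism with a break point $\xi_0$ is an orientation-preserving circle homeomorphism $f$ such that $f\in C^1([\xi_0,\xi_0+1])$, $\inf_{\xi\neq\xi_0}f'(\xi)>0$, the one-sided derivatives $f'(\xi_0\pm0)$ exist and are positive, and $c:=\sqrt{f'(\xi_0-0)/f'(\xi_0+0)}\neq 1$. For $\gamma>0$ put $\mathcal{Z}_\gamma(x)=(\log\frac1x)^{-\gamma}$ for $x\in(0,1)$ and $\mathcal{Z}_\gamma(0)=0$. Let $\Delta^2 f'(\xi,\tau)=f'(\xi+\tau)+f'(\xi-\tau)-2f'(\xi)$. The class $\mathrm{D}^{1+\mathcal{Z}_{\gamma}}(\mathbb{S}^{1}\setminus\{\xi_{0}\})$ consists of circle diffeomorphisms $f$ with break point $\xi_0$ such that $f'$ has bounded variation and there is $C>0$ with $\|\Delta^2 f'(\cdot,\tau)\|_{L^\infty(\mathbb{S}^1)}\le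 C\tau\mathcal{Z}_\gamma(\tau)$ for all $\tau\in[0,\frac12]$. Write $\rho=[k_1,k_2,\dots]$ (continued fraction) with convergents $p_n/q_n$, where $q_{-1}=0$, $q_0=1$, $q_n=k_nq_{n-1}+q_{n-2}$. Put $\xi_i=f^i(\xi_0)$. The $n$th fundamental segment $I^n_0$ is the arc $[\xi_0,\xi_{q_n}]$ if $n$ is even and $[\xi_{q_n},\xi_0]$ if $n$ is odd; $I^n_j=f^j(I^n_0)$, so $I^{n-1}_i$ has endpoints $\xi_i,\xi_{i+q_{n-1}}$ and $I^n_j$ has endpoints $\xi_j,\xi_{j+q_n}$. $|J|$ denotes the length of an arc $J$. Values of $f'$ at a point equal to $\xi_0$ are understood via $f'$ as a function on $[\xi_0,\xi_0+1]$ with $f'(\xi_0)=f'(\xi_0+0)$, $f'(\xi_0+1)=f'(\xi_0-0)$, each partition interval being lifted into $[\xi_0,\xi_0+1]$ (i.e. the one-sided derivative from inside the interval). Renormalization: let $\mathcal{V}_n=I^{n-1}_0\cup I^n_0$ and $\pi_n:\mathcal{V}_n\to\mathcal{V}_n$, $\pi_n=f^{q_n}$ on $I^{n-1}_0$ and $\pi_n=f^{q_{n-1}}$ on $I^n_0$. Let $\mathcal{A}_n:\mathbb{R}\to\mathbb{S}^1$ be the affine covering map with $\mathcal{A}_n(0)=\xi_0$, $\mathcal{A}_n(-1)=\xi_{q_n}$ (so $\mathcal{A}_n([-1,0])=I^n_0$), and let $a_n>0$ be such that $\mathcal{A}_{n-1}(a_n)=\xi_{q_n}$; thus $\mathcal{A}_{n-1}$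 maps $[-1,0]$ onto $I^{n-1}_0$ and $[0,a_n]$ onto $I^n_0$. Define $(f_n,g_n)=\mathcal{A}^{-1}_{n-1}\circ\pi_n\circ\mathcal{A}_{n-1}$ on $[-1,a_n]$ (with the inverse branch mapping $\mathcal{V}_n$ onto $[-1,a_n]$), where $f_n$ is the restriction to $[-1,0]$ and $g_n$ to $[0,a_n]$. Parameters: $b_n=\frac{|I^{n-1}_0|-|I^n_{q_{n-1}}|}{|I^{n-1}_0|}$, $\widetilde m_n=\exp\big(\sum_{i=0}^{q_n-1}\frac{f'(\xi_i)-f'(\xi_{i+q_{n-1}})}{2f'(\xi_i)}\big)$, $\widehat m_n=\exp\big(\sum_{j=0}^{q_{n-1}-1}\frac{f'(\xi_{j+q_n})-f'(\xi_j)}{2f'(\xi_{j+q_n})}\big)$ (each $f'$ value evaluated at the endpoint of $I^{n-1}_i$, resp. $I^n_j$). Möbius maps: $\widetilde F_n(z)=\frac{a_n+(a_n+b_n\widetilde m_n)z}{1+(1-\widetilde m_n)z}$, $\widehat G_n(z)=\frac{-a_n\widehat m_n+(\widehat m_n-b_n)z}{a_n\widehat m_n+(1-\widehat m_n)z}$. The $C^1$ norm on an interval is $\max(\sup|h|,\sup|h'|)$. *)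

(* Defs.v *)
From Stdlib Require Import Reals Lra.
From Coquelicot Require Import Coquelicot.
Open Scope R_scope.

Definition frac_part (x : R) : R := x - IZR (Int_part x).

(* counterclockwise length of the circle arc from (the class of) a to b *)
Definition arclen (a b : R) : R := frac_part (b - a).

Definition is_deriv_within (a b : R) (h : R -> R) (x d : R) : Prop :=
  filterlim (fun y => (h y - h x) / (y - x))
    (within (fun y => a <= y <= b /\ y <> x) (locally x)) (locally d).

Definition continuous_on_within (a b : R) (h : R -> R) : Prop :=
  forall x, a <= x <= b ->
    filterlim h (within (fun y => a <= y <= b) (locally x)) (locally (h x)).

Definition C1_norm_le (a b : R) (h : R -> R) (M : R) : Prop :=
  exists h' : R -> R,
    (forall t, a <= t <= b -> is_deriv_within a b h t (h' t)) /\
    continuous_on_within a b h' /\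
    (forall t, a <= t <= b -> Rabs (h t) <= M /\ Rabs (h' t) <= M).

Fixpoint sum_lt (n : nat) (f : nat -> R) : R :=
  match n with O => 0 | S m => sum_lt m f + f m end.

Definition bounded_variation_on (a b : R) (g : R -> R) : Prop :=
  exists V : R, forall (n : nat) (x : nat -> R),
    (forall k, (k <= n)%nat -> a <= x k <= b) ->
    (forall k, (k < n)%nat -> x k <= x (S k)) ->
    sum_lt n (fun k => Rabs (g (x (S k)) - g (x k))) <= V.

Definition circle_homeo_lift (F : R -> R) : Prop :=
  (forall x, continuity_pt F x) /\
  (forall x y, x < y -> F x < F y) /\
  (forall x, F (x + 1) = F x + 1).

(* circle diffeomorphism with break point xi0; Df is f' on [xi0, xi0+1]
   (Df xi0 = f'(xi0+0), Df (xi0+1) = f'(xi0-0)) *)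
Definition break_diffeo (F Df : R -> R) (xi0 : R) : Prop :=
  circle_homeo_lift F /\
  (forall x, xi0 <= x <= xi0 + 1 -> is_deriv_within xi0 (xi0 + 1) F x (Df x)) /\
  continuous_on_within xi0 (xi0 + 1) Df /\
  (exists m, 0 < m /\ forall x, xi0 < x < xi0 + 1 -> m <= Df x) /\
  0 < Df xi0 /\ 0 < Df (xi0 + 1) /\
  sqrt (Df (xi0 + 1) / Df xi0) <> 1.

Definition Zg (g x : R) : R :=
  if Rlt_dec 0 x then Rpower (ln (/ x)) (- g) else 0.

(* the class D^{1+Z_gamma}(S^1 \ {xi0}) (on top of break_diffeo) *)
Definition class_DZ (g : R) (Df : R -> R) (xi0 : R) : Prop :=
  bounded_variation_on xi0 (xi0 + 1) Df /\
  exists C, 0 < C /\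
    forall tau x, 0 <= tau <= 1/2 -> xi0 <= x - tau -> x + tau <= xi0 + 1 ->
      Rabs (Df (x + tau) + Df (x - tau) - 2 * Df x) <= C * tau * Zg g tau.

Definition rotation_number (F : R -> R) (rho : R) : Prop :=
  0 <= rho < 1 /\
  exists m : Z, is_lim_seq (fun n => Nat.iter n F 0 / INR n) (rho + IZR m).

Definition irrational (x : R) : Prop :=
  forall (p : Z) (q : nat), (0 < q)%nat -> x * INR q <> IZR p.

Fixpoint gauss (rho : R) (n : nat) : R :=
  match n with
  | O => rho
  | S m => / gauss rho m - IZR (Int_part (/ gauss rho m))
  end.

(* k_n, n >= 1 *)
Definition cf_digit (rho : R) (n : nat) : nat :=
  Z.to_nat (Int_part (/ gauss rho (n - 1))).

(* (q_{n-1}, q_n) *)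
Fixpoint qpair (rho : R) (n : nat) : nat * nat :=
  match n with
  | O => (0%nat, 1%nat)
  | S m => let (a, b) := qpair rho m in (b, (cf_digit rho (S m) * b + a)%nat)
  end.

Definition q (rho : R) (n : nat) : nat := snd (qpair rho n).

Definition orb (F : R -> R) (xi0 : R) (i : nat) : R := Nat.iter i F xi0.

(* I^n_j as an oriented arc [left, right] *)
Definition seg_left F xi0 rho (n j : nat) : R :=
  if Nat.even n then orb F xi0 j else orb F xi0 (j + q rho n).
Definition seg_right F xi0 rho (n j : nat) : R :=
  if Nat.even n then orb F xi0 (j + q rho n) else orb F xi0 j.
Definition seglen F xi0 rho (n j : nat) : R :=
  arclen (seg_left F xi0 rho n j) (seg_right F xi0 rho n j).

(* lift of the arc [a,b] into [xi0, xi0+1]: positions of its endpoints *)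
Definition lpos (xi0 a : R) : R := xi0 + arclen xi0 a.
Definition rpos (xi0 a b : R) : R := lpos xi0 a + arclen a b.

(* f' at xi_j, resp. xi_{j+q_n}, as endpoints of I^n_j *)
Definition Dstart F Df xi0 rho (n j : nat) : R :=
  if Nat.even n then Df (lpos xi0 (orb F xi0 j))
  else Df (rpos xi0 (orb F xi0 (j + q rho n)) (orb F xi0 j)).
Definition Dend F Df xi0 rho (n j : nat) : R :=
  if Nat.even n then Df (rpos xi0 (orb F xi0 j) (orb F xi0 (j + q rho n)))
  else Df (lpos xi0 (orb F xi0 (j + q rho n))).

Definition b_par F xi0 rho (n : nat) : R :=
  (seglen F xi0 rho (n - 1) 0 - seglen F xi0 rho n (q rho (n - 1)))
  / seglen F xi0 rho (n - 1) 0.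

Definition mtilde F Df xi0 rho (n : nat) : R :=
  exp (sum_lt (q rho n) (fun i =>
    (Dstart F Df xi0 rho (n - 1) i - Dend F Df xi0 rho (n - 1) i)
    / (2 * Dstart F Df xi0 rho (n - 1) i))).

Definition mhat F Df xi0 rho (n : nat) : R :=
  exp (sum_lt (q rho (n - 1)) (fun j =>
    (Dend F Df xi0 rho n j - Dstart F Df xi0 rho n j)
    / (2 * Dend F Df xi0 rho n j))).

Definition sgn (n : nat) : R := if Nat.even n then -1 else 1.

(* lift of the affine covering map A_n : R -> S^1, A_n(0)=xi0,
   A_n(-1)=xi_{q_n}, A_n([-1,0]) = I^n_0 *)
Definition Amap F xi0 rho (n : nat) (t : R) : R :=
  xi0 + sgn n * seglen F xi0 rho n 0 * t.

(* a_n : A_{n-1}(a_n) = xi_{q_n} *)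
Definition a_par F xi0 rho (n : nat) : R :=
  seglen F xi0 rho n 0 / seglen F xi0 rho (n - 1) 0.

(* the inverse branch of A_{n-1} mapping V_n onto [-1, a_n] *)
Definition Ainv F xi0 rho (n : nat) (z : R) : R :=
  let lo := if Nat.even (n - 1) then - seglen F xi0 rho n 0
            else - seglen F xi0 rho (n - 1) 0 in
  (lo + arclen (xi0 + lo) z) / (sgn (n - 1) * seglen F xi0 rho (n - 1) 0).

Definition f_ren F xi0 rho (n : nat) (t : R) : R :=
  Ainv F xi0 rho n (Nat.iter (q rho n) F (Amap F xi0 rho (n - 1) t)).

Definition g_ren F xi0 rho (n : nat) (t : R) : R :=
  Ainv F xi0 rho n (Nat.iter (q rho (n - 1)) F (Amap F xi0 rho (n - 1) t)).

Definition Ftilde F Df xi0 rho (n : nat) (z : R) : R :=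
  let a := a_par F xi0 rho n in
  let b := b_par F xi0 rho n in
  let m := mtilde F Df xi0 rho n in
  (a + (a + b * m) * z) / (1 + (1 - m) * z).

Definition Ghat F Df xi0 rho (n : nat) (z : R) : R :=
  let a := a_par F xi0 rho n in
  let b := b_par F xi0 rho n in
  let m := mhat F Df xi0 rho n in
  (- a * m + (m - b) * z) / (a * m + (1 - m) * z).

(* Main.v *)
Require Import Defs.
From Stdlib Require Import Reals Lra Lia List ZArith.
From Coquelicot Require Import Coquelicot.
Open Scope R_scope.

(** Let [s], [x], [e] be the start, a point and the end of an arc on which [f] is smooth, and let
    [R], [S], [T] be the difference quotients of [f] over [[s,x]], [[x,e]], [[s,e]]. The Zygmund
    condition makes each of them equal to the mean of [f'] at its two endpoints up to
    [O(l Z(l))], where [l] is the length of the arc, and makes [f'] Hoelder of exponent 3/4. Hence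
      [ln (R/S) = (f'(s) - f'(e)) / (2 f'(s)) + O(l Z(l))]  and  [ln (f'(x) T / (R S)) = O(l Z(l))];
    the second quantity is 0 for a Moebius map. If [z] is the relative coordinate of [x] in the arc, one
    application of [f] multiplies [z/(1-z)] by [R/S] and [z] by [R/T], so along the dynamical partition
    the products of [R/S] give the composed Moebius map and the errors add up to at most
    [max Z(l) * sum l = O(n^-gamma)]: the arcs of level [n] are disjoint and exponentially short. The
    exponential decay and the bounds on the rescaling factors come from Denjoy's distortion argument,
    started at a point of maximal displacement of [f^{q_n}]. *)

(** * Iterates and order of orbits *)

(** Nothing is assumed about [f''], so [f'] is never differentiated: the only data are its values at
    endpoints of arcs and difference quotients of the lift. A single Moebius map can appear because,
    in the difference of the endpoint means over [s,x] and [x,e], the value f'(x) cancels; the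
    multiplier is then the same for every point of the arc. What remains beyond the trapezoid errors
    is quadratic in the oscillation of [f'], and for this any Hoelder exponent above 1/2 beats the
    required order. The break point is met in two ways. The arcs issuing from [xi0] never have it in
    their interior before the return time, so along them a C^1 model of the lift can be used.
    Denjoy's argument, however, concerns arcs based at arbitrary points, which may straddle the
    break; there chord slopes replace derivatives, and the one straddling arc costs a bounded term.
    The parameters a_n and b_n make each renormalized map agree with its Moebius map at both ends of
    the interval, so that only the multiplier has to be compared. *)

Lemma lift_IZR (F : R -> R) (hF : circle_homeo_lift F) (x : R) (p : Z) :
  F (x + IZR p) = F x + IZR p.
Proof.
  destruct hF as [_ [_ h1]].
  assert (hn : forall (n : nat) y, F (y + INR n) = F y + INR n).
  { induction n as [|n IH]; intros y.
    - simpl; now rewrite !Rplus_0_r.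
    - rewrite S_INR. replace (y + (INR n + 1)) with ((y + INR n) + 1) by ring.
      rewrite h1, IH; ring. }
  destruct (Z_le_gt_dec 0 p) as [hp|hp].
  - rewrite <- (Z2Nat.id p hp), <- INR_IZR_INZ. apply hn.
  - assert (e : IZR p = - INR (Z.to_nat (- p))).
    { rewrite INR_IZR_INZ, Z2Nat.id by lia. rewrite opp_IZR; ring. }
    rewrite e.
    generalize (hn (Z.to_nat (- p)) (x + - INR (Z.to_nat (- p)))).
    replace (x + - INR (Z.to_nat (- p)) + INR (Z.to_nat (- p))) with x by ring.
    lra.
Qed.

Lemma iter_IZR (F : R -> R) (hF : circle_homeo_lift F) (n : nat) (x : R) (p : Z) :
  Nat.iter n F (x + IZR p) = Nat.iter n F x + IZR p.
Proof.
  induction n as [|n IH]; simpl; [reflexivity|].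
  rewrite IH. now apply lift_IZR.
Qed.

Lemma iter_lt (F : R -> R) (hF : circle_homeo_lift F) (n : nat) (x y : R) :
  x < y -> Nat.iter n F x < Nat.iter n F y.
Proof.
  intros h; induction n as [|n IH]; simpl; [assumption|]. now apply hF.
Qed.

Lemma iter_le (F : R -> R) (hF : circle_homeo_lift F) (n : nat) (x y : R) :
  x <= y -> Nat.iter n F x <= Nat.iter n F y.
Proof.
  intros [h|h]; [left; now apply iter_lt | subst; lra].
Qed.

Lemma iter_plus (F : R -> R) (n m : nat) (x : R) :
  Nat.iter (n + m) F x = Nat.iter n F (Nat.iter m F x).
Proof.
  induction n as [|n IH]; simpl; [reflexivity|]. now rewrite IH.
Qed.

Lemma iter_comm (F : R -> R) (n m : nat) (x : R) :
  Nat.iter n F (Nat.iter m F x) = Nat.iter m F (Nat.iter n F x).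
Proof. now rewrite <- !iter_plus, Nat.add_comm. Qed.

Lemma iter_continuous (F : R -> R) (hF : circle_homeo_lift F) (n : nat) (x : R) :
  continuity_pt (Nat.iter n F) x.
Proof.
  revert x; induction n as [|n IH]; intros x; simpl.
  - apply derivable_continuous_pt, derivable_pt_id.
  - apply (continuity_pt_comp (Nat.iter n F) F); [apply IH | apply hF].
Qed.

Lemma iter_mul_le (F : R -> R) (hF : circle_homeo_lift F) (n k : nat) (x : R) (p : Z) :
  Nat.iter n F x <= x + IZR p -> Nat.iter (k * n) F x <= x + INR k * IZR p.
Proof.
  intros h; induction k as [|k IH].
  - simpl; lra.
  - rewrite S_INR. simpl Nat.mul. rewrite Nat.add_comm, iter_plus.
    apply Rle_trans with (Nat.iter (k * n) F (x + IZR p)).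
    + now apply iter_le.
    + rewrite iter_IZR by assumption. lra.
Qed.

Lemma iter_mul_ge (F : R -> R) (hF : circle_homeo_lift F) (n k : nat) (x : R) (p : Z) :
  x + IZR p <= Nat.iter n F x -> x + INR k * IZR p <= Nat.iter (k * n) F x.
Proof.
  intros h; induction k as [|k IH].
  - simpl; lra.
  - rewrite S_INR. simpl Nat.mul. rewrite Nat.add_comm, iter_plus.
    apply Rle_trans with (Nat.iter (k * n) F (x + IZR p)).
    + rewrite iter_IZR by assumption. lra.
    + now apply iter_le.
Qed.

Definition translation_number (F : R -> R) (r : R) : Prop :=
  is_lim_seq (fun n => Nat.iter n F 0 / INR n) r.

Lemma translation_subseq (F : R -> R) (r : R) (n : nat) :
  translation_number F r -> (0 < n)%nat ->
  is_lim_seq (fun k => Nat.iter (S k * n) F 0 / INR (S k * n)) r.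
Proof.
  intros h hn.
  apply (is_lim_seq_subseq (fun n => Nat.iter n F 0 / INR n) r (fun k => (S k * n)%nat)); [|exact h].
  apply eventually_subseq. intros k. nia.
Qed.

Lemma lim_const_div (c d : R) (n : nat) : (0 < n)%nat ->
  is_lim_seq (fun k => (c + INR (S k) * d) / INR (S k * n)) (d / INR n).
Proof.
  intros hn.
  assert (hn' : 0 < INR n) by now apply lt_0_INR.
  apply is_lim_seq_ext with (fun k => c / INR n * / INR (S k) + d / INR n).
  { intros k. rewrite mult_INR. assert (0 < INR (S k)) by (apply lt_0_INR; lia).
    field; lra. }
  replace (Finite (d / INR n)) with (Finite (c / INR n * 0 + d / INR n))
    by (f_equal; ring).
  apply is_lim_seq_plus'; [|apply is_lim_seq_const].
  apply (is_lim_seq_scal_l _ (c / INR n) 0).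
  apply (is_lim_seq_incr_1 (fun k => / INR k)).
  replace (Finite 0) with (Rbar_inv p_infty) by reflexivity.
  apply is_lim_seq_inv; [apply is_lim_seq_INR | discriminate].
Qed.

(** Iterating the hypothesis bounds the displacement after [k * n] steps by [k * p]; dividing by
    [k * n] and letting k grow leaves [r]. The integer part of [x] is used to pass to the base point
    0 of the definition. *)
Lemma translation_le (F : R -> R) (r x : R) (n : nat) (p : Z) :
  circle_homeo_lift F -> translation_number F r -> (0 < n)%nat ->
  Nat.iter n F x <= x + IZR p -> INR n * r <= IZR p.
Proof.
  intros hF hr hn h.
  assert (hn' : 0 < INR n) by now apply lt_0_INR.
  destruct (base_Int_part x) as [b1 b2].
  set (j := Int_part x) in *.
  assert (hk : forall k, Nat.iter (k * n) F 0 <= (x - IZR j) + INR k * IZR p).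
  { intros k. generalize (iter_mul_le F hF n k x p h). intros h1.
    assert (h2 : Nat.iter (k * n) F (IZR j) <= Nat.iter (k * n) F x) by (apply iter_le; auto; lra).
    replace (IZR j) with (0 + IZR j) in h2 by ring. rewrite iter_IZR in h2 by assumption. lra. }
  assert (H : Rbar_le r (IZR p / INR n)).
  { eapply is_lim_seq_le; [|apply (translation_subseq F r n hr hn)
                            |apply (lim_const_div (x - IZR j) (IZR p) n hn)].
    intros k. cbv beta. apply Rmult_le_compat_r; [|apply hk].
    left. apply Rinv_0_lt_compat, lt_0_INR. nia. }
  simpl in H. apply Rmult_le_reg_r with (/ INR n); [now apply Rinv_0_lt_compat|].
  replace (INR n * r * / INR n) with r by (field; lra). exact H.
Qed.

Lemma translation_ge (F : R -> R) (r x : R) (n : nat) (p : Z) :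
  circle_homeo_lift F -> translation_number F r -> (0 < n)%nat ->
  x + IZR p <= Nat.iter n F x -> IZR p <= INR n * r.
Proof.
  intros hF hr hn h.
  assert (hn' : 0 < INR n) by now apply lt_0_INR.
  destruct (base_Int_part x) as [b1 b2].
  set (j := Int_part x) in *.
  assert (hk : forall k, (x - IZR j - 1) + INR k * IZR p <= Nat.iter (k * n) F 0).
  { intros k. generalize (iter_mul_ge F hF n k x p h). intros h1.
    assert (h2 : Nat.iter (k * n) F x <= Nat.iter (k * n) F (0 + IZR (j + 1))).
    { apply iter_le; auto. rewrite plus_IZR; lra. }
    rewrite iter_IZR, plus_IZR in h2 by assumption. lra. }
  assert (H : Rbar_le (IZR p / INR n) r).
  { eapply is_lim_seq_le; [|apply (lim_const_div (x - IZR j - 1) (IZR p) n hn)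
                           |apply (translation_subseq F r n hr hn)].
    intros k. cbv beta. apply Rmult_le_compat_r; [|apply hk].
    left. apply Rinv_0_lt_compat, lt_0_INR. nia. }
  simpl in H. apply Rmult_le_reg_r with (/ INR n); [now apply Rinv_0_lt_compat|].
  replace (INR n * r * / INR n) with r by (field; lra). exact H.
Qed.

(** Orbits are ordered like those of the translation by [r], whatever the point [x]: a reversed pair
    would, after removing the common iterates, bound [r] on the wrong side through [translation_le]
    or [translation_ge]. *)
Lemma orbit_lt (F : R -> R) (r : R) (i j : nat) (a b : Z) (x : R) :
  circle_homeo_lift F -> translation_number F r ->
  INR i * r + IZR a < INR j * r + IZR b ->
  Nat.iter i F x + IZR a < Nat.iter j F x + IZR b.
Proof.
  intros hF hr h.
  apply Rnot_le_lt; intros hle.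
  destruct (Nat.lt_trichotomy i j) as [hij|[hij|hij]].
  - set (n := (j - i)%nat). assert (ej : j = (n + i)%nat) by (unfold n; lia).
    assert (hn : (0 < n)%nat) by (unfold n; lia).
    clearbody n; subst j. rewrite iter_plus in hle.
    assert (H : INR n * r <= IZR (a - b)).
    { apply (translation_le F r (Nat.iter i F x)); auto. rewrite minus_IZR; lra. }
    rewrite minus_IZR in H. rewrite plus_INR in h. lra.
  - subst j. lra.
  - set (n := (i - j)%nat). assert (ej : i = (n + j)%nat) by (unfold n; lia).
    assert (hn : (0 < n)%nat) by (unfold n; lia).
    clearbody n; subst i. rewrite iter_plus in hle.
    assert (H : IZR (b - a) <= INR n * r).
    { apply (translation_ge F r (Nat.iter j F x)); auto. rewrite minus_IZR; lra. }
    rewrite minus_IZR in H. rewrite plus_INR in h. lra.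
Qed.

Lemma irrational_comb (r : R) (i j : nat) (a b : Z) :
  irrational r -> INR i * r + IZR a = INR j * r + IZR b -> i = j /\ a = b.
Proof.
  intros hr h.
  destruct (Nat.lt_trichotomy i j) as [hij|[hij|hij]].
  - exfalso. apply (hr (a - b)%Z (j - i)%nat); [lia|].
    rewrite minus_IZR, minus_INR by lia. lra.
  - subst j; split; [reflexivity|]. apply eq_IZR; lra.
  - exfalso. apply (hr (b - a)%Z (i - j)%nat); [lia|].
    rewrite minus_IZR, minus_INR by lia. lra.
Qed.

Lemma orbit_le (F : R -> R) (r : R) (i j : nat) (a b : Z) (x : R) :
  circle_homeo_lift F -> translation_number F r -> irrational r ->
  INR i * r + IZR a <= INR j * r + IZR b ->
  Nat.iter i F x + IZR a <= Nat.iter j F x + IZR b.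
Proof.
  intros hF hr hi [h|h].
  - left; now apply (orbit_lt F r).
  - apply irrational_comb in h as [-> ->]; [lra | assumption].
Qed.

(** * Convergents *)

(* (p_{n-1}, p_n), with p_{-1} = 1 and p_0 = 0 *)
Fixpoint ppair (rho : R) (n : nat) : Z * Z :=
  match n with
  | O => (1%Z, 0%Z)
  | S m => let (a, b) := ppair rho m in (b, (Z.of_nat (cf_digit rho (S m)) * b + a)%Z)
  end.

Definition pnum (rho : R) (n : nat) : Z := snd (ppair rho n).
Definition delta (rho : R) (n : nat) : R := INR (q rho n) * rho - IZR (pnum rho n).
(** The value of [delta] one level lower, extended by -1 at level 0, so that the recursion also
    covers its first step. *)
Definition delta_prev (rho : R) (n : nat) : R :=
  INR (fst (qpair rho n)) * rho - IZR (fst (ppair rho n)).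

Lemma qpair_S (rho : R) (n : nat) :
  qpair rho (S n) = (q rho n, cf_digit rho (S n) * q rho n + fst (qpair rho n))%nat.
Proof. unfold q; simpl. now destruct (qpair rho n). Qed.

Lemma ppair_S (rho : R) (n : nat) :
  ppair rho (S n) = (pnum rho n, Z.of_nat (cf_digit rho (S n)) * pnum rho n + fst (ppair rho n))%Z.
Proof. unfold pnum; simpl. now destruct (ppair rho n). Qed.

Lemma delta_S (rho : R) (n : nat) :
  delta rho (S n) = INR (cf_digit rho (S n)) * delta rho n + delta_prev rho n.
Proof.
  unfold delta, delta_prev, q at 1, pnum at 1. rewrite qpair_S, ppair_S. cbn [fst snd].
  rewrite plus_INR, mult_INR, plus_IZR, mult_IZR, <- INR_IZR_INZ. ring.
Qed.

Lemma delta_prev_S (rho : R) (n : nat) : delta_prev rho (S n) = delta rho n.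
Proof. unfold delta_prev, delta. now rewrite qpair_S, ppair_S. Qed.

Lemma digit_ge_1 (rho : R) (n : nat) : 0 < gauss rho n < 1 ->
  (1 <= cf_digit rho (S n))%nat /\
  INR (cf_digit rho (S n)) = IZR (Int_part (/ gauss rho n)).
Proof.
  intros [h0 h1].
  assert (h : 1 < / gauss rho n) by (rewrite <- Rinv_1; apply Rinv_lt_contravar; lra).
  destruct (base_Int_part (/ gauss rho n)) as [b1 b2].
  assert (hz : (0 < Int_part (/ gauss rho n))%Z) by (apply lt_IZR; lra).
  unfold cf_digit. replace (S n - 1)%nat with n by lia. split; [lia|].
  rewrite INR_IZR_INZ, Z2Nat.id by lia. reflexivity.
Qed.

(** A vanishing Gauss iterate would make [delta] vanish at that level, hence [rho] rational. The
    identity for [delta] is the source of its alternating sign and of its decrease in absolute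
    value. *)
Lemma gauss_delta (rho : R) (n : nat) : 0 <= rho < 1 -> irrational rho ->
  0 < gauss rho n < 1 /\ delta rho n = - gauss rho n * delta_prev rho n /\ (1 <= q rho n)%nat.
Proof.
  intros hr hi. induction n as [|n [IH1 [IH2 IH3]]].
  - simpl. unfold delta, delta_prev, q, pnum; simpl. repeat split; try lra; try lia.
    destruct (Req_dec rho 0) as [h|h]; [|lra].
    exfalso; apply (hi 0%Z 1%nat); [lia|]. rewrite h; simpl; ring.
  - destruct (digit_ge_1 rho n IH1) as [k1 k2].
    assert (hq : (1 <= q rho (S n))%nat).
    { unfold q; rewrite qpair_S; cbn [snd]. nia. }
    assert (hd : delta rho (S n) = - gauss rho (S n) * delta rho n).
    { rewrite delta_S, k2. cbn [gauss]. rewrite IH2. field. lra. }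
    assert (hne : delta rho (S n) <> 0).
    { intros e. unfold delta in e. apply (hi (pnum rho (S n)) (q rho (S n))); [lia|]. lra. }
    assert (hg : 0 <= gauss rho (S n) < 1).
    { cbn [gauss]. destruct (base_Int_part (/ gauss rho n)). lra. }
    repeat split; try lra; try assumption.
    + destruct (Req_dec (gauss rho (S n)) 0) as [e|e]; [|lra].
      exfalso; apply hne. rewrite hd, e; ring.
    + now rewrite delta_prev_S.
Qed.

Lemma q_pos (rho : R) (n : nat) : 0 <= rho < 1 -> irrational rho -> (1 <= q rho n)%nat.
Proof. intros h1 h2. apply (gauss_delta rho n h1 h2). Qed.

Lemma convergents_rec (rho : R) (n : nat) : 0 <= rho < 1 -> irrational rho ->
  exists k : nat, (1 <= k)%nat /\
    q rho (S (S n)) = (k * q rho (S n) + q rho n)%nat /\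
    pnum rho (S (S n)) = (Z.of_nat k * pnum rho (S n) + pnum rho n)%Z /\
    delta rho (S (S n)) = INR k * delta rho (S n) + delta rho n.
Proof.
  intros h1 h2. exists (cf_digit rho (S (S n))). repeat split.
  - apply digit_ge_1, gauss_delta; assumption.
  - unfold q at 1. rewrite qpair_S, qpair_S. reflexivity.
  - unfold pnum at 1. rewrite ppair_S, ppair_S. reflexivity.
  - rewrite delta_S, delta_prev_S. reflexivity.
Qed.

Lemma q_le_S (rho : R) (n : nat) : 0 <= rho < 1 -> irrational rho ->
  (q rho n <= q rho (S n))%nat.
Proof.
  intros h1 h2. destruct n as [|n].
  - apply (q_pos rho 1 h1 h2).
  - destruct (convergents_rec rho n h1 h2) as [k [hk [e _]]]. rewrite e. nia.
Qed.

Lemma delta_sign (rho : R) (n : nat) : 0 <= rho < 1 -> irrational rho ->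
  (Nat.even n = true -> 0 < delta rho n) /\ (Nat.even n = false -> delta rho n < 0).
Proof.
  intros h1 h2. induction n as [|n [IH1 IH2]].
  - split; [intros _|discriminate]. destruct (gauss_delta rho 0 h1 h2) as [g [e _]].
    rewrite e. unfold delta_prev; simpl. simpl in g. lra.
  - destruct (gauss_delta rho (S n) h1 h2) as [g [e _]].
    rewrite delta_prev_S in e. rewrite Nat.even_succ, <- Nat.negb_even.
    destruct (Nat.even n); simpl; split; intros h; try discriminate.
    + specialize (IH1 eq_refl). rewrite e. nra.
    + specialize (IH2 eq_refl). rewrite e. nra.
Qed.

Lemma delta_abs_decr (rho : R) (n : nat) : 0 <= rho < 1 -> irrational rho ->
  Rabs (delta rho (S n)) < Rabs (delta rho n).
Proof.
  intros h1 h2. destruct (gauss_delta rho (S n) h1 h2) as [g [e _]].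
  rewrite delta_prev_S in e. rewrite e, Rabs_mult, Rabs_Ropp, (Rabs_pos_eq (gauss _ _)) by lra.
  assert (0 < Rabs (delta rho n)).
  { apply Rabs_pos_lt. destruct (delta_sign rho n h1 h2) as [s1 s2].
    destruct (Nat.even n); [specialize (s1 eq_refl) | specialize (s2 eq_refl)]; lra. }
  nra.
Qed.

Lemma delta_abs_lt_1 (rho : R) (n : nat) : 0 <= rho < 1 -> irrational rho ->
  Rabs (delta rho n) < 1.
Proof.
  intros h1 h2. induction n as [|n IH].
  - unfold delta, q, pnum; simpl. replace (1 * rho - 0) with rho by ring.
    rewrite Rabs_pos_eq; lra.
  - eapply Rlt_trans; [apply delta_abs_decr; assumption | exact IH].
Qed.

Lemma convergents_det (rho : R) (n : nat) :
  (Z.of_nat (q rho (S n)) * pnum rho n - Z.of_nat (q rho n) * pnum rho (S n)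
   = if Nat.even n then -1 else 1)%Z.
Proof.
  assert (H : forall n, (Z.of_nat (q rho n) * fst (ppair rho n)
     - Z.of_nat (fst (qpair rho n)) * pnum rho n = if Nat.even n then 1 else -1)%Z).
  { induction n0 as [|m IH]; [reflexivity|].
    unfold q at 1, pnum at 1. rewrite qpair_S, ppair_S. cbn [fst snd].
    rewrite Nat.even_succ, <- Nat.negb_even. destruct (Nat.even m); simpl; nia. }
  generalize (H (S n)). rewrite qpair_S, ppair_S at 1. cbn [fst].
  rewrite Nat.even_succ, <- Nat.negb_even. intros e.
  destruct (Nat.even n); simpl in e; exact e.
Qed.

Lemma best_approximation (rho : R) (n k : nat) (p : Z) : 0 <= rho < 1 -> irrational rho ->
  (0 < k < q rho (S n))%nat -> Rabs (delta rho n) <= Rabs (INR k * rho - IZR p).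
Proof.
  intros h1 h2 hk.
  (* (k, p) is an integral combination of consecutive convergents because their determinant is a unit *)
  set (d := (if Nat.even n then -1 else 1)%Z).
  set (al := (d * (Z.of_nat k * pnum rho n - p * Z.of_nat (q rho n)))%Z).
  set (be := (d * (p * Z.of_nat (q rho (S n)) - Z.of_nat k * pnum rho (S n)))%Z).
  pose proof (convergents_det rho n) as hd. fold d in hd.
  assert (dd : (d * d = 1)%Z) by (unfold d; destruct (Nat.even n); reflexivity).
  assert (ek : (Z.of_nat k = al * Z.of_nat (q rho (S n)) + be * Z.of_nat (q rho n))%Z).
  { transitivity (d * d * Z.of_nat k)%Z; [rewrite dd; ring|].
    rewrite <- hd at 2. unfold al, be. ring. }
  assert (ep : (p = al * pnum rho (S n) + be * pnum rho n)%Z).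
  { transitivity (d * d * p)%Z; [rewrite dd; ring|].
    rewrite <- hd at 2. unfold al, be. ring. }
  assert (E : INR k * rho - IZR p = IZR al * delta rho (S n) + IZR be * delta rho n).
  { unfold delta. rewrite !INR_IZR_INZ, ek, ep.
    rewrite !plus_IZR, !mult_IZR. ring. }
  clearbody al be. clear ep hd.
  assert (hq : (1 <= Z.of_nat (q rho n) <= Z.of_nat (q rho (S n)))%Z).
  { generalize (q_pos rho n h1 h2) (q_le_S rho n h1 h2). lia. }
  assert (hb : (be <> 0)%Z).
  { intros ->. destruct (Z_lt_le_dec al 1) as [h|h].
    - assert (al * Z.of_nat (q rho (S n)) <= 0)%Z by nia. lia.
    - assert (1 * Z.of_nat (q rho (S n)) <= al * Z.of_nat (q rho (S n)))%Z
        by (apply Z.mul_le_mono_nonneg_r; lia). lia. }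
  destruct (gauss_delta rho (S n) h1 h2) as [g [e _]]. rewrite delta_prev_S in e.
  rewrite e in E. set (dn := delta rho n) in *. set (gg := gauss rho (S n)) in *.
  assert (E' : INR k * rho - IZR p = (IZR be - IZR al * gg) * dn) by lra.
  rewrite E', Rabs_mult. rewrite <- (Rmult_1_l (Rabs dn)) at 1.
  apply Rmult_le_compat_r; [apply Rabs_pos|].
  (* As 0 < k < q_{n+1}, the two coefficients cannot have the same strict sign. The two deltas have
     opposite signs, so the contributions add up instead of cancelling. *)
  assert (hc : ((1 <= be /\ al <= 0) \/ (be <= -1 /\ 0 <= al))%Z).
  { destruct (Z_lt_le_dec be 0).
    - right; split; [lia|]. apply Z.nlt_ge; intros ha.
      assert (al * Z.of_nat (q rho (S n)) <= -1 * Z.of_nat (q rho (S n)))%Z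
        by (apply Z.mul_le_mono_nonneg_r; lia).
      assert (be * Z.of_nat (q rho n) <= 0)%Z by nia. lia.
    - left; split; [lia|]. apply Z.nlt_ge; intros ha.
      assert (1 * Z.of_nat (q rho (S n)) <= al * Z.of_nat (q rho (S n)))%Z
        by (apply Z.mul_le_mono_nonneg_r; lia).
      assert (0 <= be * Z.of_nat (q rho n))%Z by nia. lia. }
  destruct hc as [[c1 c2]|[c1 c2]]; apply IZR_le in c1, c2.
  - rewrite Rabs_pos_eq; nra.
  - rewrite Rabs_left1; nra.
Qed.

(** * Variation over disjoint intervals *)

Lemma sum_lt_ext (n : nat) (f g : nat -> R) :
  (forall i, (i < n)%nat -> f i = g i) -> sum_lt n f = sum_lt n g.
Proof.
  induction n as [|n IH]; intros h; simpl; [reflexivity|].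
  rewrite IH by (intros; apply h; lia). rewrite h by lia. reflexivity.
Qed.

Lemma sum_lt_le (n : nat) (f g : nat -> R) :
  (forall i, (i < n)%nat -> f i <= g i) -> sum_lt n f <= sum_lt n g.
Proof.
  induction n as [|n IH]; intros h; simpl; [lra|].
  apply Rplus_le_compat; [apply IH; intros; apply h; lia | apply h; lia].
Qed.

Lemma sum_lt_plus (n : nat) (f g : nat -> R) :
  sum_lt n (fun i => f i + g i) = sum_lt n f + sum_lt n g.
Proof. induction n as [|n IH]; simpl; [ring | rewrite IH; ring]. Qed.

Lemma sum_lt_scal (n : nat) (c : R) (f : nat -> R) :
  sum_lt n (fun i => c * f i) = c * sum_lt n f.
Proof. induction n as [|n IH]; simpl; [ring | rewrite IH; ring]. Qed.

Lemma sum_lt_opp (n : nat) (f : nat -> R) : sum_lt n (fun i => - f i) = - sum_lt n f.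
Proof. induction n as [|n IH]; simpl; [ring | rewrite IH; ring]. Qed.

Lemma sum_lt_abs (n : nat) (f : nat -> R) :
  Rabs (sum_lt n f) <= sum_lt n (fun i => Rabs (f i)).
Proof.
  induction n as [|n IH]; simpl; [rewrite Rabs_R0; lra|].
  eapply Rle_trans; [apply Rabs_triang|]. lra.
Qed.

Lemma sum_lt_S_left (n : nat) (f : nat -> R) :
  sum_lt (S n) f = f 0%nat + sum_lt n (fun i => f (S i)).
Proof. induction n as [|n IH]; [simpl; ring|]. change (sum_lt (S (S n)) f) with (sum_lt (S n) f + f (S n)). rewrite IH; simpl; ring. Qed.

(** Partitions are kept as lists, because new intervals are spliced into them; [chain_nth] leads
    back to the sequences in the definition of bounded variation. *)
Fixpoint chain (A : R) (l : list R) (B : R) : Prop :=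
  match l with nil => A <= B | y :: l' => A <= y /\ chain y l' B end.

Fixpoint var_from (g : R -> R) (A : R) (l : list R) : R :=
  match l with nil => 0 | y :: l' => Rabs (g y - g A) + var_from g y l' end.

Definition variation_le (a b : R) (g : R -> R) (V : R) : Prop :=
  forall (n : nat) (x : nat -> R),
    (forall k, (k <= n)%nat -> a <= x k <= b) ->
    (forall k, (k < n)%nat -> x k <= x (S k)) ->
    sum_lt n (fun k => Rabs (g (x (S k)) - g (x k))) <= V.

Lemma var_from_nth (g : R -> R) (A d : R) (l : list R) :
  var_from g A l =
  sum_lt (length l) (fun k => Rabs (g (nth (S k) (A :: l) d) - g (nth k (A :: l) d))).
Proof.
  revert A; induction l as [|y l IH]; intros A; [reflexivity|].
  change (length (y :: l)) with (S (length l)). rewrite sum_lt_S_left.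
  simpl var_from. rewrite IH. reflexivity.
Qed.

Lemma chain_nth (A B d : R) (l : list R) : chain A l B ->
  (forall k, (k <= length l)%nat -> A <= nth k (A :: l) d <= B) /\
  (forall k, (k < length l)%nat -> nth k (A :: l) d <= nth (S k) (A :: l) d).
Proof.
  revert A; induction l as [|y l IH]; intros A h.
  - simpl in *. split; intros k hk; [|lia]. destruct k; [simpl; lra|lia].
  - simpl in h. destruct h as [h1 h2]. destruct (IH y h2) as [i1 i2].
    assert (hB : y <= B) by (specialize (i1 0%nat ltac:(lia)); simpl in i1; lra).
    split; intros k hk; simpl in hk.
    + destruct k; [simpl; lra|]. specialize (i1 k ltac:(lia)).
      change (nth (S k) (A :: y :: l) d) with (nth k (y :: l) d). lra.
    + destruct k; [simpl; lra|]. specialize (i2 k ltac:(lia)). exact i2.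
Qed.

Lemma var_from_le (g : R -> R) (A B V : R) (l : list R) :
  variation_le A B g V -> chain A l B -> var_from g A l <= V.
Proof.
  intros hV hc. rewrite (var_from_nth g A 0). destruct (chain_nth A B 0 l hc) as [h1 h2].
  exact (hV (length l) (fun k => nth k (A :: l) 0) h1 h2).
Qed.

Lemma chain_app (A a b B : R) (l1 l2 : list R) :
  chain A l1 a -> a <= b -> chain b l2 B -> chain A (l1 ++ a :: b :: l2) B.
Proof.
  revert A; induction l1 as [|y l IH]; intros A h1 h2 h3; simpl in *.
  - auto.
  - destruct h1; auto.
Qed.

Lemma var_from_app (g : R -> R) (A a b : R) (l1 l2 : list R) :
  var_from g A l1 + Rabs (g b - g a) + var_from g b l2 <= var_from g A (l1 ++ a :: b :: l2).
Proof.
  revert A; induction l1 as [|y l IH]; intros A; simpl.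
  - generalize (Rabs_pos (g a - g A)). lra.
  - specialize (IH y). lra.
Qed.

Fixpoint pair_sum (g : R -> R) (L : list (R * R)) : R :=
  match L with nil => 0 | p :: L' => Rabs (g (snd p) - g (fst p)) + pair_sum g L' end.

Definition disjoint_pairs (p p' : R * R) : Prop := snd p <= fst p' \/ snd p' <= fst p.

Lemma pair_sum_filter (g : R -> R) (f : R * R -> bool) (L : list (R * R)) :
  pair_sum g L = pair_sum g (filter f L) + pair_sum g (filter (fun p => negb (f p)) L).
Proof.
  induction L as [|p L IH]; simpl; [ring|]. destruct (f p); simpl; rewrite IH; ring.
Qed.

Lemma FOP_filter {T : Type} (P : T -> T -> Prop) (f : T -> bool) (L : list T) :
  ForallOrdPairs P L -> ForallOrdPairs P (filter f L).
Proof.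
  induction 1 as [|p L h1 h2 IH]; simpl; [constructor|].
  destruct (f p); [|assumption]. constructor; [|assumption].
  apply Forall_forall. intros x hx. apply filter_In in hx.
  rewrite Forall_forall in h1. now apply h1.
Qed.

(** The pairs come unsorted, so this is a quicksort: the first pair is the pivot, and disjointness
    sends every other pair to its left or to its right. The bound [n] on the length carries the
    induction through [filter]. *)
Lemma disjoint_pairs_chain (g : R -> R) (n : nat) : forall (L : list (R * R)) (A B : R),
  (length L <= n)%nat -> A <= B ->
  (forall p, In p L -> A <= fst p /\ fst p <= snd p /\ snd p <= B) ->
  ForallOrdPairs disjoint_pairs L ->
  exists l, chain A l B /\ pair_sum g L <= var_from g A l.
Proof.
  induction n as [|n IH]; intros L A B hn hAB hin hd.
  - destruct L; [|simpl in hn; lia]. exists nil; simpl; split; lra.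
  - destruct L as [|[a b] L]; [exists nil; simpl; split; lra|].
    simpl in hn. inversion_clear hd as [|? ? h1 h2].
    destruct (hin (a, b) (or_introl eq_refl)) as [ha [hab hb]]. simpl in ha, hab, hb.
    set (f := fun p : R * R => if Rle_dec (snd p) a then true else false).
    destruct (IH (filter f L) A a) as [l1 [c1 s1]].
    + generalize (filter_length_le f L); lia.
    + assumption.
    + intros p hp. apply filter_In in hp as [hp1 hp2]. unfold f in hp2.
      destruct (Rle_dec (snd p) a); [|discriminate].
      destruct (hin p (or_intror hp1)) as [? [? ?]]. auto.
    + now apply FOP_filter.
    + destruct (IH (filter (fun p => negb (f p)) L) b B) as [l2 [c2 s2]].
      * generalize (filter_length_le (fun p => negb (f p)) L); lia.
      * assumption.
      * intros p hp. apply filter_In in hp as [hp1 hp2]. unfold f in hp2.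
        destruct (Rle_dec (snd p) a) as [?|hn1]; [discriminate|].
        destruct (hin p (or_intror hp1)) as [? [? ?]].
        rewrite Forall_forall in h1. destruct (h1 p hp1) as [h|h]; simpl in h; [auto|lra].
      * now apply FOP_filter.
      * exists (l1 ++ a :: b :: l2). split; [now apply chain_app|].
        simpl. rewrite (pair_sum_filter g f L).
        generalize (var_from_app g A a b l1 l2). lra.
Qed.

(** The points [x i] and [y i] may come in either order and may coincide. With [g] the derivative
    this controls distortion; with [g] the identity it shows that disjoint arcs in the fundamental
    domain have total length at most 1. *)
Lemma disjoint_sum (g : R -> R) (A B V : R) (N : nat) (lo hi x y : nat -> R) :
  variation_le A B g V -> A <= B ->
  (forall i, (i < N)%nat -> A <= lo i /\ hi i <= B) ->
  (forall i j, (i < j < N)%nat -> hi i <= lo j \/ hi j <= lo i) ->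
  (forall i, (i < N)%nat -> lo i <= x i <= hi i /\ lo i <= y i <= hi i) ->
  sum_lt N (fun i => Rabs (g (x i) - g (y i))) <= V.
Proof.
  intros hV hAB hin hd hxy.
  set (pr := fun i => (Rmin (x i) (y i), Rmax (x i) (y i))).
  set (lst := fix lst n := match n with O => nil | S m => pr m :: lst m end).
  assert (hlst : forall n p, In p (lst n) -> exists i, (i < n)%nat /\ p = pr i).
  { induction n as [|n IH]; intros p; simpl; [tauto|]. intros [e|h].
    - exists n; split; [lia|now symmetry].
    - destruct (IH p h) as [i [hi1 hi2]]. exists i; split; [lia|assumption]. }
  assert (hpr : forall i, (i < N)%nat -> lo i <= fst (pr i) /\ fst (pr i) <= snd (pr i) /\ snd (pr i) <= hi i).
  { intros i hi'. destruct (hxy i hi') as [h1 h2]. unfold pr; simpl.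
    unfold Rmin, Rmax; destruct (Rle_dec (x i) (y i)); lra. }
  destruct (disjoint_pairs_chain g (length (lst N)) (lst N) A B) as [l [c s]].
  - lia.
  - assumption.
  - intros p hp. destruct (hlst N p hp) as [i [i1 ->]].
    generalize (hpr i i1) (hin i i1). lra.
  - assert (H : forall n, (n <= N)%nat -> ForallOrdPairs disjoint_pairs (lst n)).
    { induction n as [|n IH]; intros hn; simpl; [constructor|].
      constructor; [|apply IH; lia]. apply Forall_forall. intros p hp.
      destruct (hlst n p hp) as [i [i1 ->]]. unfold disjoint_pairs.
      generalize (hpr i ltac:(lia)) (hpr n ltac:(lia)) (hd i n ltac:(lia)). lra. }
    apply H; lia.
  - apply Rle_trans with (pair_sum g (lst N)).
    + clear c s hlst hpr hin hd hxy. right. induction N as [|n IH]; simpl; [reflexivity|].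
      rewrite IH. rewrite Rplus_comm. f_equal.
      unfold Rmin, Rmax; destruct (Rle_dec (x n) (y n)); [apply Rabs_minus_sym|reflexivity].
    + eapply Rle_trans; [exact s|]. eapply var_from_le; eassumption.
Qed.

Lemma variation_id (a b : R) : a <= b -> variation_le a b (fun x => x) (b - a).
Proof.
  intros hab n x h1 h2.
  assert (e : sum_lt n (fun k => Rabs (x (S k) - x k)) = x n - x 0%nat).
  { clear h1. induction n as [|n IH]; simpl; [ring|].
    rewrite IH by (intros; apply h2; lia).
    rewrite Rabs_pos_eq; [ring|]. generalize (h2 n ltac:(lia)); lra. }
  rewrite e. generalize (h1 n ltac:(lia)) (h1 0%nat ltac:(lia)). lra.
Qed.

(** * Slopes of a lift with a break *)

Definition clamp (a b x : R) : R := Rmax a (Rmin x b).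

Lemma clamp_in (a b x : R) : a <= b -> a <= clamp a b x <= b.
Proof. intros h. unfold clamp, Rmax, Rmin. destruct (Rle_dec x b); destruct (Rle_dec a _); lra. Qed.

Lemma clamp_id (a b x : R) : a <= x <= b -> clamp a b x = x.
Proof. intros h. unfold clamp, Rmax, Rmin. destruct (Rle_dec x b); destruct (Rle_dec a _); lra. Qed.

Lemma clamp_lip (a b x y : R) : a <= b -> Rabs (clamp a b y - clamp a b x) <= Rabs (y - x).
Proof.
  intros h. unfold clamp, Rmax, Rmin.
  destruct (Rle_dec x b), (Rle_dec y b); repeat destruct (Rle_dec a _);
    unfold Rabs; repeat destruct (Rcase_abs _); lra.
Qed.

(* A C^1 map of the whole line that agrees with the lift on one fundamental domain: it replaces
   one-sided derivatives at the break point by ordinary ones. *)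
Record smooth_model (F Df : R -> R) (xi0 : R) (E D : R -> R) (m M : R) : Prop := {
  sm_derive : forall x, is_derive E x (D x);
  sm_cont : forall x, continuous D x;
  sm_E : forall x, xi0 <= x <= xi0 + 1 -> E x = F x;
  sm_D : forall x, xi0 <= x <= xi0 + 1 -> D x = Df x;
  sm_m : 0 < m;
  sm_bd : forall x, m <= D x <= M }.

Lemma is_deriv_within_interior (a b : R) (h : R -> R) (x d : R) :
  a < x < b -> is_deriv_within a b h x d -> is_derive h x d.
Proof.
  intros hx hd. apply is_derive_Reals. intros eps he.
  unfold is_deriv_within in hd.
  apply (proj1 (filterlim_locally _ _)) with (eps := mkposreal eps he) in hd.
  destruct hd as [dl hdl].
  assert (hp : 0 < Rmin dl (Rmin (x - a) (b - x))).
  { repeat apply Rmin_glb_lt; try lra. apply cond_pos. }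
  exists (mkposreal _ hp). intros k hk0 hk. simpl in hk.
  assert (h1 : Rabs k < dl) by (eapply Rlt_le_trans; [exact hk|apply Rmin_l]).
  assert (h2 : Rabs k < x - a).
  { eapply Rlt_le_trans; [exact hk|]. eapply Rle_trans; [apply Rmin_r|apply Rmin_l]. }
  assert (h3 : Rabs k < b - x).
  { eapply Rlt_le_trans; [exact hk|]. eapply Rle_trans; [apply Rmin_r|apply Rmin_r]. }
  specialize (hdl (x + k)).
  unfold ball in hdl; simpl in hdl; unfold AbsRing_ball, abs, minus, plus, opp in hdl; simpl in hdl.
  replace (x + k + - x) with k in hdl by ring. specialize (hdl h1).
  replace (x + k - x) with k in hdl by ring.
  apply hdl. apply Rabs_def2 in h2, h3. split; lra.
Qed.

Lemma continuous_clamp (a b : R) (h : R -> R) (x : R) : a <= b ->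
  continuous_on_within a b h -> continuous (fun y => h (clamp a b y)) x.
Proof.
  intros hab hc. apply filterlim_locally. intros eps.
  pose proof (proj1 (filterlim_locally _ _) (hc _ (clamp_in a b x hab)) eps) as [dl hdl].
  exists dl. intros y hy. apply hdl; [|now apply clamp_in].
  unfold ball in *; simpl in *; unfold AbsRing_ball, abs, minus, plus, opp in *; simpl in *.
  eapply Rle_lt_trans; [apply (clamp_lip a b x y hab)|exact hy].
Qed.

(** [Df] is frozen at its end values outside the fundamental domain and integrated. The difference
    [F - E] has zero derivative in the interior and is continuous up to the ends, hence vanishes on
    the whole domain. *)
Lemma smooth_model_exists (F Df : R -> R) (xi0 : R) : break_diffeo F Df xi0 ->
  exists E D m M, smooth_model F Df xi0 E D m M.
Proof.
  intros [hF [hd [hc [[m0 [hm0 hm]] [hl [hr _]]]]]].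
  set (D := fun y => Df (clamp xi0 (xi0 + 1) y)).
  assert (hD : forall x, continuous D x) by (intros x; apply continuous_clamp; [lra|assumption]).
  set (E := fun x => F xi0 + RInt D xi0 x).
  assert (hE : forall x, is_derive E x (D x)).
  { intros x. unfold E. replace (D x) with (0 + D x) by ring.
    apply (is_derive_plus (fun _ => F xi0) (fun x => RInt D xi0 x)).
    - exact (@is_derive_const R_AbsRing R_NormedModule (F xi0) x).
    - apply is_derive_RInt with xi0; [|apply hD].
      exists (mkposreal 1 Rlt_0_1). intros y _. apply (@RInt_correct R_CompleteNormedModule), ex_RInt_continuous.
      intros; apply hD. }
  assert (hDf : forall x, xi0 <= x <= xi0 + 1 -> D x = Df x)
    by (intros x hx; unfold D; now rewrite clamp_id).
  destruct (continuity_ab_maj D xi0 (xi0 + 1)) as [xM [hM _]]; [lra| |].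
  { intros c _. apply continuity_pt_filterlim, hD. }
  exists E, D, (Rmin m0 (Rmin (Df xi0) (Df (xi0 + 1)))), (D xM). constructor; auto.
  - intros x hx.
    destruct (Req_dec x xi0) as [->|hne].
    { unfold E. rewrite RInt_point. unfold zero; simpl. ring. }
    destruct (MVT_gen (fun y => F y - E y) xi0 x (fun y => 0)) as [c [_ e]].
    + rewrite Rmin_left, Rmax_right by lra. intros y hy.
      replace 0 with (Df y - D y) by (rewrite hDf; lra).
      apply (is_derive_minus F E y); [|apply hE].
      apply is_deriv_within_interior with xi0 (xi0 + 1); [lra|]. apply hd; lra.
    + intros y _. apply (continuity_pt_minus F E y); [apply hF|].
      apply continuity_pt_filterlim. apply (ex_derive_continuous E). eexists; apply hE.
    + assert (e0 : E xi0 = F xi0) by (unfold E; rewrite RInt_point; unfold zero; simpl; ring).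
      lra.
  - repeat apply Rmin_glb_lt; assumption.
  - intros x. pose proof (clamp_in xi0 (xi0 + 1) x ltac:(lra)) as hx. split.
    + unfold D. set (y := clamp xi0 (xi0 + 1) x) in *.
      destruct (Req_dec y xi0) as [->|h1].
      { eapply Rle_trans; [apply Rmin_r|apply Rmin_l]. }
      destruct (Req_dec y (xi0 + 1)) as [->|h2].
      { eapply Rle_trans; [apply Rmin_r|apply Rmin_r]. }
      eapply Rle_trans; [apply Rmin_l|]. apply hm; lra.
    + eapply Rle_trans; [|apply (hM (clamp xi0 (xi0 + 1) x) hx)].
      unfold D. rewrite (clamp_id _ _ (clamp _ _ _)) by assumption. lra.
Qed.

Definition slope (F : R -> R) (u u' : R) : R := (F u' - F u) / (u' - u).

Lemma slope_MVT (F Df : R -> R) (xi0 : R) (E D : R -> R) (m M : R) (u u' : R) (r : Z) :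
  smooth_model F Df xi0 E D m M -> circle_homeo_lift F ->
  u < u' -> xi0 <= u - IZR r -> u' - IZR r <= xi0 + 1 ->
  exists c, u - IZR r <= c <= u' - IZR r /\ slope F u u' = D c.
Proof.
  intros sm hF h1 h2 h3.
  destruct (MVT_gen E (u - IZR r) (u' - IZR r) D) as [c [hc e]].
  - intros; apply (sm_derive _ _ _ _ _ _ _ sm).
  - intros y _. apply continuity_pt_filterlim, (ex_derive_continuous E).
    eexists; apply (sm_derive _ _ _ _ _ _ _ sm).
  - rewrite Rmin_left, Rmax_right in hc by lra. exists c; split; [assumption|].
    rewrite !(sm_E _ _ _ _ _ _ _ sm) in e by lra.
    unfold slope.
    replace (F u') with (F (u' - IZR r) + IZR r)
      by (rewrite <- lift_IZR by assumption; f_equal; ring).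
    replace (F u) with (F (u - IZR r) + IZR r)
      by (rewrite <- lift_IZR by assumption; f_equal; ring).
    replace (F (u' - IZR r) + IZR r - (F (u - IZR r) + IZR r)) with (D c * (u' - u)) by lra.
    field. lra.
Qed.

Lemma slope_bounds (F Df : R -> R) (xi0 : R) (E D : R -> R) (m M : R) (u u' : R) :
  smooth_model F Df xi0 E D m M -> circle_homeo_lift F ->
  u < u' <= u + 1 -> m <= slope F u u' <= M.
Proof.
  intros sm hF h.
  assert (H : forall u u' r, u < u' -> xi0 <= u - IZR r -> u' - IZR r <= xi0 + 1 ->
            m * (u' - u) <= F u' - F u <= M * (u' - u)).
  { clear u u' h. intros u u' r h1 h2 h3.
    destruct (slope_MVT F Df xi0 E D m M u u' r sm hF h1 h2 h3) as [c [_ e]].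
    pose proof (sm_bd _ _ _ _ _ _ _ sm c).
    replace (F u' - F u) with (D c * (u' - u)) by (rewrite <- e; unfold slope; field; lra).
    split; apply Rmult_le_compat_r; lra. }
  assert (H' : m * (u' - u) <= F u' - F u <= M * (u' - u)).
  { destruct (base_Int_part (u - xi0)) as [b1 b2]. set (r := Int_part (u - xi0)) in *.
    destruct (Rle_dec (u' - IZR r) (xi0 + 1)) as [hs|hs].
    - apply (H u u' r); lra.
    (* The chord crosses one translate of the break point and is cut there; its length, at most 1,
       excludes a second one. *)
    - set (z := xi0 + 1 + IZR r).
      generalize (H u z r) (H z u' (r + 1)%Z). rewrite plus_IZR. unfold z.
      intros h1 h2. specialize (h1 ltac:(lra) ltac:(lra) ltac:(lra)).
      specialize (h2 ltac:(lra) ltac:(lra) ltac:(lra)). lra. }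
  unfold slope. split.
  - apply Rmult_le_reg_r with (u' - u); [lra|]. unfold Rdiv.
    rewrite Rmult_assoc, Rinv_l by lra. lra.
  - apply Rmult_le_reg_r with (u' - u); [lra|]. unfold Rdiv.
    rewrite Rmult_assoc, Rinv_l by lra. lra.
Qed.

Lemma ln_lipschitz (m a b : R) : 0 < m -> m <= a -> m <= b ->
  Rabs (ln a - ln b) <= Rabs (a - b) / m.
Proof.
  assert (H : forall a b, 0 < m -> m <= a -> m <= b -> a <= b -> ln b - ln a <= (b - a) / m).
  { clear a b. intros a b hm ha hb hab.
    rewrite <- ln_div by lra.
    assert (h : ln (b / a) <= b / a - 1).
    { pose proof (exp_ineq1_le (ln (b / a))) as h. rewrite exp_ln in h; [lra|].
      apply Rdiv_lt_0_compat; lra. }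
    eapply Rle_trans; [exact h|]. replace (b / a - 1) with ((b - a) / a) by (field; lra).
    apply Rmult_le_compat_l; [lra|]. apply Rinv_le_contravar; lra. }
  intros hm ha hb. destruct (Rle_dec a b) as [h|h].
  - rewrite (Rabs_left1 (a - b)) by lra. rewrite Rabs_left1.
    + specialize (H a b hm ha hb h). replace (- (a - b)) with (b - a) by ring. lra.
    + destruct h as [h|h]; [|subst; lra]. left. apply Rlt_minus, ln_increasing; lra.
  - rewrite (Rabs_pos_eq (a - b)) by lra. rewrite Rabs_pos_eq.
    + apply H; lra.
    + left. apply Rlt_0_minus, ln_increasing; lra.
Qed.

Lemma finite_choice {T : Type} (d : T) (N : nat) (P : nat -> T -> Prop) :
  (forall i, (i < N)%nat -> exists x, P i x) ->
  exists f : nat -> T, forall i, (i < N)%nat -> P i (f i).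
Proof.
  induction N as [|N IH]; intros h.
  - exists (fun _ => d). intros; lia.
  - destruct IH as [f hf]; [intros; apply h; lia|].
    destruct (h N) as [x hx]; [lia|].
    exists (fun i => if Nat.eq_dec i N then x else f i). intros i hi.
    destruct (Nat.eq_dec i N); [subst; assumption|apply hf; lia].
Qed.

Lemma sum_lt_single (N : nat) (K : R) (f : nat -> R) : 0 <= K ->
  (forall i, (i < N)%nat -> 0 <= f i <= K) ->
  (forall i j, (i < j < N)%nat -> f i = 0 \/ f j = 0) -> sum_lt N f <= K.
Proof.
  intros hK. induction N as [|N IH]; intros h1 h2; simpl; [assumption|].
  destruct (Req_dec (f N) 0) as [e|e].
  - rewrite e, Rplus_0_r. apply IH; intros; [apply h1|apply h2]; lia.
  - assert (e0 : sum_lt N f = 0).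
    { rewrite (sum_lt_ext N f (fun _ => 0 * 0)).
      - rewrite sum_lt_scal; ring.
      - intros i hi. destruct (h2 i N ltac:(lia)); [lra|contradiction]. }
    rewrite e0. generalize (h1 N ltac:(lia)); lra.
Qed.

Definition disjoint_mod1 (N : nat) (lo hi : nat -> R) : Prop :=
  forall i j, (i < N)%nat -> (j < N)%nat -> i <> j -> forall r : Z,
    hi i <= lo j + IZR r \/ hi j + IZR r <= lo i.

(** Plays the role of the total variation of log f' in Denjoy's theory. Comparing slopes of chords
    rather than derivatives keeps it meaningful on an arc that contains the break point. *)
Definition slope_variation (F : R -> R) (v : R) : Prop :=
  forall (N : nat) (lo hi u u' w w' : nat -> R),
    (forall i, (i < N)%nat -> hi i <= lo i + 1) ->
    disjoint_mod1 N lo hi ->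
    (forall i, (i < N)%nat -> (lo i <= u i < u' i /\ u' i <= hi i) /\ (lo i <= w i < w' i /\ w' i <= hi i)) ->
    sum_lt N (fun i => Rabs (ln (slope F (u i) (u' i)) - ln (slope F (w i) (w' i)))) <= v.

(* The arcs being disjoint modulo 1, at most one of them has the break point in its interior. *)
Lemma slope_variation_break (F Df : R -> R) (xi0 : R) (E D : R -> R) (m M V : R) :
  smooth_model F Df xi0 E D m M -> circle_homeo_lift F ->
  variation_le xi0 (xi0 + 1) Df V ->
  slope_variation F (V / m + (M - m) / m).
Proof.
  intros sm hF hV N lo hi u u' w w' h1 hd huw.
  pose proof (sm_m _ _ _ _ _ _ _ sm) as hm.
  assert (hmM : m <= M) by (generalize (sm_bd _ _ _ _ _ _ _ sm xi0); lra).
  set (r := fun i => Int_part (lo i - xi0)).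
  assert (hr : forall i, xi0 <= lo i - IZR (r i) < xi0 + 1).
  { intros i. unfold r. destruct (base_Int_part (lo i - xi0)). lra. }
  (* [st] marks an arc with the break point in its interior. Such an arc is collapsed to [xi0],
     where it adds nothing to the variation of [Df], and is charged the crude bound [K] given by the
     range [m, M] of slopes. *)
  set (st := fun i => if Rle_dec (hi i - IZR (r i)) (xi0 + 1) then false else true).
  set (K := (M - m) / m).
  assert (hK : 0 <= K) by (apply Rdiv_le_0_compat; lra).
  set (lo' := fun i => if st i then xi0 else lo i - IZR (r i)).
  set (hi' := fun i => if st i then xi0 else hi i - IZR (r i)).
  destruct (finite_choice (0, 0) N (fun i p => (lo' i <= fst p <= hi' i /\ lo' i <= snd p <= hi' i) /\
    Rabs (ln (slope F (u i) (u' i)) - ln (slope F (w i) (w' i)))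
    <= / m * Rabs (Df (fst p) - Df (snd p)) + (if st i then K else 0))) as [p hp].
  { intros i hi0. destruct (huw i hi0) as [[a1 a2] [a3 a4]].
    specialize (h1 i hi0). specialize (hr i). unfold lo', hi', st.
    destruct (Rle_dec (hi i - IZR (r i)) (xi0 + 1)) as [hs|hs].
    - destruct (slope_MVT F Df xi0 E D m M (u i) (u' i) (r i) sm hF) as [c [hc ec]]; try lra.
      destruct (slope_MVT F Df xi0 E D m M (w i) (w' i) (r i) sm hF) as [c' [hc' ec']]; try lra.
      exists (c, c'); simpl. split; [lra|].
      rewrite ec, ec', Rplus_0_r.
      rewrite <- !(sm_D _ _ _ _ _ _ _ sm) by lra.
      rewrite Rmult_comm. apply ln_lipschitz; [lra| |]; apply (sm_bd _ _ _ _ _ _ _ sm).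
    - exists (xi0, xi0); simpl. split; [lra|].
      rewrite Rminus_diag, Rabs_R0, Rmult_0_r, Rplus_0_l.
      assert (b1 : m <= slope F (u i) (u' i) <= M) by (apply (slope_bounds F Df xi0 E D m M); auto; lra).
      assert (b2 : m <= slope F (w i) (w' i) <= M) by (apply (slope_bounds F Df xi0 E D m M); auto; lra).
      eapply Rle_trans; [apply (ln_lipschitz m); lra|].
      unfold K. apply Rmult_le_compat_r; [left; now apply Rinv_0_lt_compat|].
      apply Rabs_le; lra. }
  eapply Rle_trans; [apply sum_lt_le; intros i hi0; apply (proj2 (hp i hi0))|].
  rewrite sum_lt_plus, sum_lt_scal. apply Rplus_le_compat.
  - unfold Rdiv. rewrite Rmult_comm. apply Rmult_le_compat_r; [left; now apply Rinv_0_lt_compat|].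
    apply (disjoint_sum Df xi0 (xi0 + 1) V N lo' hi'); [assumption|lra| | |].
    + intros i hi0. specialize (hr i). unfold lo', hi', st.
      destruct (Rle_dec (hi i - IZR (r i)) (xi0 + 1)); lra.
    + intros i j hij. generalize (hd i j ltac:(lia) ltac:(lia) ltac:(lia) (r i - r j)%Z).
      rewrite minus_IZR. generalize (hr i) (hr j). unfold lo', hi', st.
      destruct (Rle_dec (hi i - IZR (r i)) (xi0 + 1)), (Rle_dec (hi j - IZR (r j)) (xi0 + 1)); lra.
    + intros i hi0. apply (proj1 (hp i hi0)).
  - apply sum_lt_single; [assumption| |].
    + intros i _. destruct (st i); lra.
    + intros i j hij. generalize (hd i j ltac:(lia) ltac:(lia) ltac:(lia) (r i - r j)%Z).
      rewrite minus_IZR. generalize (hr i) (hr j). unfold st.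
      destruct (Rle_dec (hi i - IZR (r i)) (xi0 + 1)), (Rle_dec (hi j - IZR (r j)) (xi0 + 1)); lra.
Qed.

(** * Denjoy distortion *)

Lemma slope_pos (F : R -> R) (u u' : R) : u < u' -> F u < F u' -> 0 < slope F u u'.
Proof. intros h1 h2. unfold slope. apply Rdiv_lt_0_compat; lra. Qed.

Lemma ln_slope_iter (F : R -> R) (N : nat) (u u' : R) : circle_homeo_lift F -> u < u' ->
  ln (slope (Nat.iter N F) u u') =
  sum_lt N (fun i => ln (slope F (Nat.iter i F u) (Nat.iter i F u'))).
Proof.
  intros hF h. induction N as [|N IH].
  - simpl. unfold slope. simpl. replace ((u' - u) / (u' - u)) with 1 by (field; lra). apply ln_1.
  - cbn [sum_lt]. rewrite <- IH.
    assert (h1 := iter_lt F hF N u u' h).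
    assert (h2 := proj1 (proj2 hF) _ _ h1).
    rewrite <- ln_mult.
    + f_equal. unfold slope. simpl. field. split; lra.
    + apply slope_pos; assumption.
    + apply slope_pos; assumption.
Qed.

(** The chain rule for chords turns the logarithm of the slope of an iterate into a sum over the
    images of the arc. These are disjoint, so the constant does not depend on [N]. *)
Lemma distortion (F : R -> R) (v : R) (N : nat) (lo hi u u' w w' : R) :
  circle_homeo_lift F -> slope_variation F v -> lo < hi <= lo + 1 ->
  disjoint_mod1 N (fun i => Nat.iter i F lo) (fun i => Nat.iter i F hi) ->
  lo <= u < u' -> u' <= hi -> lo <= w < w' -> w' <= hi ->
  slope (Nat.iter N F) u u' <= exp v * slope (Nat.iter N F) w w'.
Proof.
  intros hF hv hl hd hu hu' hw hw'.
  assert (H : sum_lt N (fun i => Rabs (ln (slope F (Nat.iter i F u) (Nat.iter i F u'))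
     - ln (slope F (Nat.iter i F w) (Nat.iter i F w')))) <= v).
  { apply (hv N (fun i => Nat.iter i F lo) (fun i => Nat.iter i F hi)); [|assumption|].
    - intros i _. change 1 with (IZR 1). rewrite <- iter_IZR by assumption.
      now apply iter_le.
    - intros i _. repeat split; try (apply iter_le; auto; lra); apply iter_lt; auto; lra. }
  assert (p1 : 0 < slope (Nat.iter N F) u u').
  { apply slope_pos; [lra|]. apply iter_lt; auto; lra. }
  assert (p2 : 0 < slope (Nat.iter N F) w w').
  { apply slope_pos; [lra|]. apply iter_lt; auto; lra. }
  rewrite <- (exp_ln _ p1), <- (exp_ln _ p2), <- exp_plus.
  assert (hle : ln (slope (Nat.iter N F) u u') <= v + ln (slope (Nat.iter N F) w w')).
  { rewrite !ln_slope_iter by (auto; lra).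
    set (a := fun i => ln (slope F (Nat.iter i F u) (Nat.iter i F u'))) in *.
    set (b := fun i => ln (slope F (Nat.iter i F w) (Nat.iter i F w'))) in *.
    assert (sum_lt N a <= sum_lt N (fun i => Rabs (a i - b i) + b i)).
    { apply sum_lt_le. intros i _. generalize (Rle_abs (a i - b i)). lra. }
    rewrite sum_lt_plus in H0. unfold a, b in *. lra. }
  destruct hle as [hle|hle]; [left; now apply exp_increasing | rewrite hle; lra].
Qed.

Lemma finite_argmax (c : nat -> R) (N : nat) : exists i, (i <= N)%nat /\ forall j, (j <= N)%nat -> c j <= c i.
Proof.
  induction N as [|N [i [h1 h2]]].
  - exists 0%nat; split; [lia|]. intros j hj. replace j with 0%nat by lia. lra.
  - destruct (Rle_dec (c i) (c (S N))) as [h|h].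
    + exists (S N); split; [lia|]. intros j hj. destruct (Nat.eq_dec j (S N)); [subst; lra|].
      specialize (h2 j ltac:(lia)). lra.
    + exists i; split; [lia|]. intros j hj. destruct (Nat.eq_dec j (S N)); [subst; lra|].
      apply h2; lia.
Qed.

Definition shift_iter (F : R -> R) (n : nat) (p : Z) (x : R) : R := Nat.iter n F x + IZR p.

Lemma shift_iter_comm (F : R -> R) (n i : nat) (p r : Z) (x : R) : circle_homeo_lift F ->
  shift_iter F n p (shift_iter F i r x) = shift_iter F i r (shift_iter F n p x).
Proof.
  intros hF. unfold shift_iter. rewrite !iter_IZR by assumption. rewrite iter_comm. ring.
Qed.

Lemma shift_iter_lt (F : R -> R) (n : nat) (p : Z) (x y : R) : circle_homeo_lift F ->
  x < y -> shift_iter F n p x < shift_iter F n p y.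
Proof. intros hF h. unfold shift_iter. generalize (iter_lt F hF n x y h). lra. Qed.

Lemma shift_iter_le (F : R -> R) (n : nat) (p : Z) (x y : R) : circle_homeo_lift F ->
  x <= y -> shift_iter F n p x <= shift_iter F n p y.
Proof. intros hF h. unfold shift_iter. generalize (iter_le F hF n x y h). lra. Qed.

Lemma slope_shift_iter (F : R -> R) (n : nat) (p : Z) (x y : R) :
  slope (Nat.iter n F) x y = (shift_iter F n p y - shift_iter F n p x) / (y - x).
Proof. unfold slope, shift_iter. f_equal. ring. Qed.

(* The orbit point nearest to [z] on its left, among the first [n1 + n2] iterates of [y], has a
   neighbour on the right obtained by either [n1] more or [n2] fewer iterations. *)
Lemma orbit_cover (F : R -> R) (n1 n2 : nat) (p1 p2 : Z) (y z : R) :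
  circle_homeo_lift F -> (1 <= n1 <= n2)%nat ->
  (forall x, x < shift_iter F n1 p1 x) ->
  (forall x, shift_iter F n2 p2 x < x) ->
  (forall x, x < shift_iter F n2 p2 (shift_iter F n1 p1 x)) ->
  exists i r, (i < n2)%nat /\
    let w := shift_iter F i r y in
    w <= z < shift_iter F n1 p1 (shift_iter F n1 p1 w).
Proof.
  intros hF hn h1 h2 h3.
  set (T := shift_iter F n1 p1) in *.
  (* Starting from [T y] instead of [y] leaves room for one step back by [T] when the nearest point
     has index at least [n2]. *)
  set (y1 := T y).
  set (P := fun i => Int_part (z - Nat.iter i F y1)).
  set (c := fun i => Nat.iter i F y1 + IZR (P i)).
  assert (hc : forall i, c i <= z < c i + 1).
  { intros i. unfold c, P. destruct (base_Int_part (z - Nat.iter i F y1)). lra. }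
  destruct (finite_argmax c (n1 + n2 - 1)) as [i [hi hm]].
  assert (hbig : forall j r, (j <= n1 + n2 - 1)%nat -> c i < shift_iter F j r y1 -> z < shift_iter F j r y1).
  { intros j r hj hlt. apply Rnot_le_lt. intros hle.
    apply (Rlt_not_le _ _ hlt). apply Rle_trans with (c j); [|now apply hm].
    unfold c, shift_iter in *. apply Rplus_le_compat_l, IZR_le.
    destruct (hc j) as [_ hcj]. unfold c in hcj.
    assert (IZR r < IZR (P j + 1)) by (rewrite plus_IZR; lra).
    apply lt_IZR in H. lia. }
  destruct (Nat.lt_ge_cases i n2) as [hlt|hge].
  - exists i, (P i). split; [assumption|]. cbv zeta.
    assert (e : T (shift_iter F i (P i) y) = c i).
    { unfold T. rewrite shift_iter_comm by assumption. reflexivity. }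
    rewrite e. split.
    + generalize (h1 (shift_iter F i (P i) y)) (hc i). fold T. lra.
    + assert (e2 : T (c i) = shift_iter F (n1 + i) (p1 + P i)%Z y1).
      { unfold T, c, shift_iter. rewrite iter_IZR, iter_plus, plus_IZR by assumption. ring. }
      assert (hcc := h1 (c i)). fold T in hcc. rewrite e2 in *.
      apply hbig; [lia|assumption].
  - set (j := (i - n2)%nat). assert (ei : i = (n2 + j)%nat) by (unfold j; lia).
    exists j, (P i - p2)%Z. split; [unfold j; lia|]. cbv zeta.
    set (w := shift_iter F j (P i - p2) y).
    assert (e1 : T w = shift_iter F j (P i - p2) y1).
    { unfold T, w. rewrite shift_iter_comm by assumption. reflexivity. }
    assert (e2 : shift_iter F n2 p2 (T w) = c i).
    { rewrite e1. unfold c, shift_iter.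
      replace (Nat.iter i F y1) with (Nat.iter n2 F (Nat.iter j F y1))
        by (rewrite <- iter_plus, <- ei; reflexivity).
      rewrite iter_IZR, minus_IZR by assumption. ring. }
    split.
    + generalize (h3 w) (hc i). rewrite e2. lra.
    + assert (hz : z < T w).
      { rewrite e1. apply hbig; [unfold j; lia|]. rewrite <- e1, <- e2. apply h2. }
      generalize (h1 (T w)). fold T. lra.
Qed.

Lemma displacement_max (F : R -> R) (n : nat) (p : Z) : circle_homeo_lift F ->
  exists z, forall x, shift_iter F n p x - x <= shift_iter F n p z - z.
Proof.
  intros hF.
  destruct (continuity_ab_maj (fun x => Nat.iter n F x - x) 0 1) as [z [hz _]]; [lra| |].
  - intros c _. apply (continuity_pt_minus (Nat.iter n F) (fun x => x)).
    + now apply iter_continuous.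
    + apply derivable_continuous_pt, derivable_pt_id.
  - exists z. intros x. destruct (base_Int_part x) as [b1 b2].
    specialize (hz (x + IZR (- Int_part x))).
    rewrite iter_IZR, opp_IZR in hz by assumption. unfold shift_iter.
    specialize (hz ltac:(lra)). lra.
Qed.

Lemma slope_variation_nonneg (F : R -> R) (v : R) : slope_variation F v -> 0 <= v.
Proof.
  intros h. set (z := fun _ : nat => 0).
  apply (h 0%nat z z z z z z); unfold disjoint_mod1; intros; lia.
Qed.

Lemma disjoint_mod1_le (N N' : nat) (lo hi : nat -> R) :
  (N <= N')%nat -> disjoint_mod1 N' lo hi -> disjoint_mod1 N lo hi.
Proof. intros h hd i j hi' hj hij r. apply hd; lia. Qed.

(** Disjointness of the images is known for one arc [x, T x], not for two consecutive ones. The arc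
    [c, T c] based at the midpoint overlaps both, so the comparison is made in three steps, each at
    the price of [exp v]. *)
Lemma adjacent_distortion (F : R -> R) (v : R) (n1 n2 N : nat) (p1 : Z) (u : R) :
  circle_homeo_lift F -> slope_variation F v -> (N <= n2)%nat ->
  (forall x, x < shift_iter F n1 p1 x <= x + 1) ->
  (forall x, disjoint_mod1 n2 (fun i => Nat.iter i F x) (fun i => Nat.iter i F (shift_iter F n1 p1 x))) ->
  let T := shift_iter F n1 p1 in
  slope (Nat.iter N F) u (T u) <= exp (3 * v) * slope (Nat.iter N F) (T u) (T (T u)).
Proof.
  intros hF hv hN h1 hd T.
  assert (D : forall x a a' b b', x <= a < a' -> a' <= T x -> x <= b < b' -> b' <= T x ->
    slope (Nat.iter N F) a a' <= exp v * slope (Nat.iter N F) b b').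
  { intros x a a' b b' ha ha' hb hb'. apply (distortion F v N x (T x)); try assumption;
      [apply h1 | apply (disjoint_mod1_le N n2); [lia|apply hd]]. }
  set (c := (u + T u) / 2).
  assert (i1 := h1 u). assert (i2 := h1 (T u)). assert (i3 := h1 c). fold T in i1, i2, i3.
  assert (hc : u < c < T u) by (unfold c; lra).
  assert (j1 : T u < T c) by (apply shift_iter_lt; auto; lra).
  assert (j2 : T c < T (T u)) by (apply shift_iter_lt; auto; lra).
  assert (e3 : exp (3 * v) = exp v * (exp v * exp v)) by (rewrite <- !exp_plus; f_equal; ring).
  assert (ep := exp_pos v). rewrite e3.
  eapply Rle_trans; [apply (D u u (T u) c (T u)); lra|]. rewrite !Rmult_assoc.
  apply Rmult_le_compat_l; [lra|].
  eapply Rle_trans; [apply (D c c (T u) (T u) (T c)); lra|].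
  apply Rmult_le_compat_l; [lra|]. apply (D (T u)); lra.
Qed.

(** Where the displacement is maximal, the chord [z, T z] cannot grow, so its slope under [T] is at
    most 1. An image [w] of [y] has [z] in [w, T (T w)), and distortion carries the bound from [z]
    to [w, T w] at cost 5 v: two overlaps, plus 3 v if [z] lies in the second arc. Going back from
    [w] to [y] costs another 3 v, by [adjacent_distortion] for the iterate that maps [y] to [w]. *)
Lemma denjoy_right (F : R -> R) (v : R) (n1 n2 : nat) (p1 p2 : Z) (y : R) :
  circle_homeo_lift F -> slope_variation F v -> (1 <= n1 <= n2)%nat ->
  (forall x, x < shift_iter F n1 p1 x <= x + 1) ->
  (forall x, shift_iter F n2 p2 x < x) ->
  (forall x, x < shift_iter F n2 p2 (shift_iter F n1 p1 x)) ->
  (forall x, disjoint_mod1 n2 (fun i => Nat.iter i F x) (fun i => Nat.iter i F (shift_iter F n1 p1 x))) ->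
  let T := shift_iter F n1 p1 in
  T (T y) - T y <= exp (8 * v) * (T y - y).
Proof.
  intros hF hv hn h1 h2 h3 hd T.
  pose proof (slope_variation_nonneg F v hv) as hv0.
  destruct (displacement_max F n1 p1 hF) as [z hz]. fold T in hz.
  destruct (orbit_cover F n1 n2 p1 p2 y z) as [i [r [hi hw]]]; auto; [intros; apply h1|].
  cbv zeta in hw. set (w := shift_iter F i r y) in *. change (w <= z < T (T w)) in hw.
  assert (AD : forall N u, (N <= n2)%nat ->
    slope (Nat.iter N F) u (T u) <= exp (3 * v) * slope (Nat.iter N F) (T u) (T (T u)))
    by (intros N u hN; apply (adjacent_distortion F v n1 n2 N p1 u hF hv hN h1 hd)).
  assert (D : forall x a a' b b', x <= a < a' -> a' <= T x -> x <= b < b' -> b' <= T x ->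
    slope (Nat.iter n1 F) a a' <= exp v * slope (Nat.iter n1 F) b b').
  { intros x a a' b b' ha ha' hb hb'. apply (distortion F v n1 x (T x)); try assumption;
      [apply h1 | apply (disjoint_mod1_le n1 n2); [lia|apply hd]]. }
  assert (ep := exp_pos v).
  assert (E1 : 1 <= exp v) by (generalize (exp_ineq1_le v); lra).
  assert (hT : forall x, x < T x) by (intros; apply h1).
  (* maximality of the displacement at [z] *)
  assert (hTz : slope (Nat.iter n1 F) z (T z) <= 1).
  { rewrite (slope_shift_iter F n1 p1). fold T. generalize (hz (T z)) (hT z). intros a b.
    apply Rmult_le_reg_r with (T z - z); [lra|]. unfold Rdiv. rewrite Rmult_assoc, Rinv_l by lra. lra. }
  assert (hww : slope (Nat.iter n1 F) w (T w) <= exp (5 * v)).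
  { assert (e5 : exp (5 * v) = exp (3 * v) * (exp v * exp v)) by (rewrite <- !exp_plus; f_equal; ring).
    assert (E3 : 1 <= exp (3 * v)) by (generalize (exp_ineq1_le (3 * v)); lra).
    destruct (Rlt_le_dec z (T w)) as [hz1|hz1].
    - assert (a1 : slope (Nat.iter n1 F) w (T w) <= exp v * slope (Nat.iter n1 F) z (T w))
        by (apply (D w); lra).
      assert (a2 : slope (Nat.iter n1 F) z (T w) <= exp v * slope (Nat.iter n1 F) z (T z)).
      { generalize (hT z). intros. apply (D z); try lra; apply shift_iter_le; auto; lra. }
      rewrite e5. apply Rle_trans with (exp v * (exp v * 1)).
      + eapply Rle_trans; [exact a1|]. apply Rmult_le_compat_l; [lra|].
        eapply Rle_trans; [exact a2|]. apply Rmult_le_compat_l; lra.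
      + assert (1 <= exp v * exp v) by nra. nra.
    - assert (a0 := AD n1 w ltac:(lia)).
      assert (a1 : slope (Nat.iter n1 F) (T w) (T (T w)) <= exp v * slope (Nat.iter n1 F) z (T (T w)))

        by (assert (k := hT (T w)); apply (D (T w)); lra).
      assert (a2 : slope (Nat.iter n1 F) z (T (T w)) <= exp v * slope (Nat.iter n1 F) z (T z)).
      { generalize (hT z). intros. apply (D z); try lra; apply shift_iter_le; auto; lra. }
      rewrite e5. eapply Rle_trans; [exact a0|]. apply Rmult_le_compat_l; [lra|].
      eapply Rle_trans; [exact a1|]. apply Rmult_le_compat_l; [lra|].
      eapply Rle_trans; [exact a2|]. rewrite <- (Rmult_1_r (exp v)) at 2. apply Rmult_le_compat_l; lra. }
  assert (b := AD i y ltac:(lia)).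
  rewrite !(slope_shift_iter F i r) in b.
  rewrite (slope_shift_iter F n1 p1) in hww. fold T in hww.
  assert (c1 : shift_iter F i r (T y) = T w) by (unfold T, w; now rewrite shift_iter_comm).
  assert (c2 : shift_iter F i r (T (T y)) = T (T w)).
  { rewrite <- c1. unfold T. now rewrite shift_iter_comm. }
  rewrite c2, c1 in b. fold w in b.
  assert (k1 := hT y). assert (k2 := hT (T y)). assert (k3 := hT w). assert (k4 := hT (T w)).
  set (A := T y - y) in *. set (A' := T (T y) - T y) in *.
  set (B := T w - w) in *. set (B' := T (T w) - T w) in *.
  assert (0 < A /\ 0 < A' /\ 0 < B /\ 0 < B') by (unfold A, A', B, B'; lra).
  assert (m1 : B' <= exp (5 * v) * B).
  { apply Rmult_le_reg_r with (/ B); [apply Rinv_0_lt_compat; lra|].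
    rewrite Rmult_assoc, Rinv_r, Rmult_1_r by lra. exact hww. }
  assert (m2 : A' * B <= exp (3 * v) * B' * A).
  { apply Rmult_le_reg_r with (/ A * / A').
    { apply Rmult_lt_0_compat; apply Rinv_0_lt_compat; lra. }
    replace (A' * B * (/ A * / A')) with (B / A) by (field; lra).
    replace (exp (3 * v) * B' * A * (/ A * / A')) with (exp (3 * v) * (B' / A')) by (field; lra).
    exact b. }
  replace (8 * v) with (3 * v + 5 * v) by ring. rewrite exp_plus.
  apply Rmult_le_reg_r with B; [lra|].
  eapply Rle_trans; [exact m2|].
  replace (exp (3 * v) * exp (5 * v) * A * B) with (exp (3 * v) * (exp (5 * v) * B) * A) by ring.
  apply Rmult_le_compat_r; [lra|]. apply Rmult_le_compat_l; [left; apply exp_pos|exact m1].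
Qed.

(** * Reflection of the line, which exchanges returns to the right and to the left *)

Definition reflect (F : R -> R) (x : R) : R := - F (- x).

Lemma reflect_iter (F : R -> R) (n : nat) (x : R) :
  Nat.iter n (reflect F) x = - Nat.iter n F (- x).
Proof.
  induction n as [|n IH]; simpl; [ring|]. rewrite IH. unfold reflect. now rewrite Ropp_involutive.
Qed.

Lemma reflect_lift (F : R -> R) : circle_homeo_lift F -> circle_homeo_lift (reflect F).
Proof.
  intros hF. repeat split.
  - intros x. apply (continuity_pt_opp (fun x => F (- x))).
    apply (continuity_pt_comp (fun x => - x) F); [|apply hF].
    apply (continuity_pt_opp (fun x => x)), derivable_continuous_pt, derivable_pt_id.
  - intros x y h. unfold reflect. apply Ropp_lt_contravar. apply hF. lra.
  - intros x. unfold reflect. replace (- (x + 1)) with (- x + IZR (-1)) by (simpl; ring).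
    rewrite lift_IZR by assumption. ring.
Qed.

Lemma reflect_slope (F : R -> R) (u u' : R) : u < u' -> slope (reflect F) u u' = slope F (- u') (- u).
Proof. intros h. unfold slope, reflect. field. lra. Qed.

Lemma reflect_variation (F : R -> R) (v : R) : slope_variation F v -> slope_variation (reflect F) v.
Proof.
  intros hv N lo hi u u' w w' h1 hd huw.
  rewrite (sum_lt_ext N _ (fun i => Rabs (ln (slope F (- u' i) (- u i)) - ln (slope F (- w' i) (- w i))))).
  - apply (hv N (fun i => - hi i) (fun i => - lo i)).
    + intros i hi0. generalize (h1 i hi0). lra.
    + intros i j a b c r. generalize (hd j i b a (not_eq_sym c) r). lra.
    + intros i hi0. generalize (huw i hi0). lra.
  - intros i hi0. generalize (huw i hi0). intros. rewrite !reflect_slope by lra. reflexivity.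
Qed.

Lemma reflect_shift_iter (F : R -> R) (n : nat) (p : Z) (x : R) :
  shift_iter (reflect F) n p x = - shift_iter F n (- p) (- x).
Proof. unfold shift_iter. rewrite reflect_iter, opp_IZR. ring. Qed.

Lemma denjoy_left (F : R -> R) (v : R) (n1 n2 : nat) (p1 p2 : Z) (y : R) :
  circle_homeo_lift F -> slope_variation F v -> (1 <= n1 <= n2)%nat ->
  (forall x, x - 1 <= shift_iter F n1 p1 x < x) ->
  (forall x, x < shift_iter F n2 p2 x) ->
  (forall x, shift_iter F n2 p2 (shift_iter F n1 p1 x) < x) ->
  (forall x, disjoint_mod1 n2 (fun i => Nat.iter i F (shift_iter F n1 p1 x)) (fun i => Nat.iter i F x)) ->
  let T := shift_iter F n1 p1 in
  T y - T (T y) <= exp (8 * v) * (y - T y).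
Proof.
  intros hF hv hn h1 h2 h3 hd T.
  generalize (denjoy_right (reflect F) v n1 n2 (- p1) (- p2) (- y) (reflect_lift F hF) (reflect_variation F v hv) hn).
  cbv zeta. rewrite !reflect_shift_iter, !Z.opp_involutive, !Ropp_involutive. fold T.
  intros H. unfold T in *.
  replace (shift_iter F n1 p1 y - shift_iter F n1 p1 (shift_iter F n1 p1 y)) with
    (- shift_iter F n1 p1 (shift_iter F n1 p1 y) - - shift_iter F n1 p1 y) by ring.
  replace (y - shift_iter F n1 p1 y) with (- shift_iter F n1 p1 y - - y) by ring.
  apply H.
  - intros x. rewrite reflect_shift_iter, Z.opp_involutive. generalize (h1 (- x)). lra.
  - intros x. rewrite reflect_shift_iter, Z.opp_involutive. generalize (h2 (- x)). lra.
  - intros x. rewrite !reflect_shift_iter, !Z.opp_involutive, Ropp_involutive. generalize (h3 (- x)). lra.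
  - intros x i j hi hj hij r. rewrite !reflect_shift_iter, !Z.opp_involutive, !reflect_iter, !Ropp_involutive.
    generalize (hd (- x) j i hj hi (not_eq_sym hij) r). lra.
Qed.

(** * First returns *)

Record irrational_lift (F : R -> R) (rho : R) : Prop := {
  il_lift : circle_homeo_lift F;
  il_rho : 0 <= rho < 1;
  il_irr : irrational rho;
  il_tr : translation_number F rho }.

(** Subtracting p_n selects the lift of f^{q_n} that moves every point by less than 1, to the right
    for even n and to the left for odd n. Arcs of the circle thereby become intervals of the line,
    and order relations become inequalities. *)
Definition first_return (F : R -> R) (rho : R) (n : nat) : R -> R :=
  shift_iter F (q rho n) (- pnum rho n).

Lemma shift_iter_add (F : R -> R) (i j : nat) (a b : Z) (x : R) : circle_homeo_lift F ->
  shift_iter F i a (shift_iter F j b x) = shift_iter F (i + j) (a + b) x.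
Proof.
  intros hF. unfold shift_iter. rewrite iter_IZR, iter_plus, plus_IZR by assumption. ring.
Qed.

Lemma shift_iter_0 (F : R -> R) (x : R) : shift_iter F 0 0 x = x.
Proof. unfold shift_iter; simpl; ring. Qed.

Lemma iter_shift (F : R -> R) (i : nat) (x : R) : Nat.iter i F x = shift_iter F i 0 x.
Proof. unfold shift_iter; ring. Qed.

Lemma shift_order_lt (F : R -> R) (rho : R) (i j : nat) (a b : Z) (x : R) : irrational_lift F rho ->
  INR i * rho + IZR a < INR j * rho + IZR b -> shift_iter F i a x < shift_iter F j b x.
Proof. intros [h1 h2 h3 h4] h. now apply (orbit_lt F rho). Qed.

Lemma shift_order_le (F : R -> R) (rho : R) (i j : nat) (a b : Z) (x : R) : irrational_lift F rho ->
  INR i * rho + IZR a <= INR j * rho + IZR b -> shift_iter F i a x <= shift_iter F j b x.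
Proof. intros [h1 h2 h3 h4] h. now apply (orbit_le F rho). Qed.

Lemma first_return_even (F : R -> R) (rho : R) (n : nat) (x : R) : irrational_lift F rho ->
  Nat.even n = true -> x < first_return F rho n x < x + 1.
Proof.
  intros hF hn. assert (hF' := hF). destruct hF' as [h1 h2 h3 h4].
  pose proof (proj1 (delta_sign rho n h2 h3) hn) as hd.
  pose proof (delta_abs_lt_1 rho n h2 h3) as ha. rewrite Rabs_pos_eq in ha by lra.
  unfold delta in hd, ha. unfold first_return. split.
  - rewrite <- (shift_iter_0 F x) at 1. apply (shift_order_lt F rho); [assumption|].
    rewrite opp_IZR; simpl; lra.
  - replace (x + 1) with (shift_iter F 0 1 x) by reflexivity.
    apply (shift_order_lt F rho); [assumption|]. rewrite opp_IZR; simpl; lra.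
Qed.

Lemma first_return_odd (F : R -> R) (rho : R) (n : nat) (x : R) : irrational_lift F rho ->
  Nat.even n = false -> x - 1 < first_return F rho n x < x.
Proof.
  intros hF hn. assert (hF' := hF). destruct hF' as [h1 h2 h3 h4].
  pose proof (proj2 (delta_sign rho n h2 h3) hn) as hd.
  pose proof (delta_abs_lt_1 rho n h2 h3) as ha. rewrite Rabs_left in ha by lra.
  unfold delta in hd, ha. unfold first_return. split.
  - replace (x - 1) with (shift_iter F 0 (-1) x) by reflexivity.
    apply (shift_order_lt F rho); [assumption|]. rewrite opp_IZR; simpl; lra.
  - rewrite <- (shift_iter_0 F x) at 2. apply (shift_order_lt F rho); [assumption|].
    rewrite opp_IZR; simpl; lra.
Qed.

Lemma first_return_twice_even (F : R -> R) (rho : R) (n : nat) (x : R) : irrational_lift F rho ->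
  Nat.even n = true -> x < first_return F rho (S n) (first_return F rho n x).
Proof.
  intros hF hn. assert (hF' := hF). destruct hF' as [h1 h2 h3 h4].
  pose proof (proj1 (delta_sign rho n h2 h3) hn) as hd.
  assert (hn' : Nat.even (S n) = false) by (rewrite Nat.even_succ, <- Nat.negb_even, hn; reflexivity).
  pose proof (proj2 (delta_sign rho (S n) h2 h3) hn') as hd'.
  pose proof (delta_abs_decr rho n h2 h3) as ha. rewrite Rabs_left, Rabs_pos_eq in ha by lra.
  unfold delta in *. unfold first_return. rewrite shift_iter_add by assumption.
  rewrite <- (shift_iter_0 F x) at 1. apply (shift_order_lt F rho); [assumption|].
  rewrite plus_IZR, !opp_IZR, plus_INR; simpl; lra.
Qed.

Lemma first_return_twice_odd (F : R -> R) (rho : R) (n : nat) (x : R) : irrational_lift F rho ->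
  Nat.even n = false -> first_return F rho (S n) (first_return F rho n x) < x.
Proof.
  intros hF hn. assert (hF' := hF). destruct hF' as [h1 h2 h3 h4].
  pose proof (proj2 (delta_sign rho n h2 h3) hn) as hd.
  assert (hn' : Nat.even (S n) = true) by (rewrite Nat.even_succ, <- Nat.negb_even, hn; reflexivity).
  pose proof (proj1 (delta_sign rho (S n) h2 h3) hn') as hd'.
  pose proof (delta_abs_decr rho n h2 h3) as ha. rewrite Rabs_pos_eq, Rabs_left in ha by lra.
  unfold delta in *. unfold first_return. rewrite shift_iter_add by assumption.
  rewrite <- (shift_iter_0 F x) at 2. apply (shift_order_lt F rho); [assumption|].
  rewrite plus_IZR, !opp_IZR, plus_INR; simpl; lra.
Qed.

Lemma first_return_comm (F : R -> R) (rho : R) (n m : nat) (x : R) : irrational_lift F rho ->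
  first_return F rho n (first_return F rho m x) = first_return F rho m (first_return F rho n x).
Proof. intros hF. apply shift_iter_comm, hF. Qed.

Lemma best_approximation_diff (rho : R) (n i j : nat) (r : Z) : 0 <= rho < 1 -> irrational rho ->
  (i < q rho (S n))%nat -> (j < q rho (S n))%nat -> i <> j ->
  Rabs (delta rho n) <= Rabs (INR i * rho - INR j * rho - IZR r).
Proof.
  intros h1 h2 hi hj hij. destruct (Nat.lt_ge_cases i j) as [h|h].
  - pose proof (best_approximation rho n (j - i) (- r) h1 h2 ltac:(lia)) as H.
    rewrite minus_INR, opp_IZR in H by lia.
    replace (INR i * rho - INR j * rho - IZR r) with (- ((INR j - INR i) * rho - - IZR r)) by ring.
    now rewrite Rabs_Ropp.
  - pose proof (best_approximation rho n (i - j) r h1 h2 ltac:(lia)) as H.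
    rewrite minus_INR in H by lia. eapply Rle_trans; [exact H|]. right; f_equal; ring.
Qed.

Lemma Rabs_ge_cases (a b : R) : a <= Rabs b -> b <= - a \/ a <= b.
Proof. unfold Rabs. destruct (Rcase_abs b); lra. Qed.

(** Two images overlapping modulo 1 would give, after fewer than q_{n+1} steps, a return closer than
    [delta rho n], against best approximation; [shift_order_le] transfers this from the rotation to
    [F]. *)
Lemma first_return_disjoint_even (F : R -> R) (rho : R) (n : nat) (x : R) : irrational_lift F rho ->
  Nat.even n = true ->
  disjoint_mod1 (q rho (S n)) (fun i => Nat.iter i F x) (fun i => Nat.iter i F (first_return F rho n x)).
Proof.
  intros hF hn i j hi hj hij r. assert (hF' := hF). destruct hF' as [h1 h2 h3 h4].
  pose proof (best_approximation_diff rho n i j r h2 h3 hi hj hij) as H.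
  rewrite (Rabs_pos_eq (delta rho n)) in H by (left; now apply delta_sign).
  rewrite !iter_shift. unfold first_return. rewrite !shift_iter_add by assumption.
  replace (shift_iter F j 0 x + IZR r) with (shift_iter F j r x) by (unfold shift_iter; ring).
  replace (shift_iter F (j + q rho n) (0 + - pnum rho n) x + IZR r)
    with (shift_iter F (j + q rho n) (- pnum rho n + r) x)
    by (unfold shift_iter; rewrite !plus_IZR; ring).
  unfold delta in H.
  apply Rabs_ge_cases in H as [H|H]; [left|right]; apply (shift_order_le F rho); auto;
    rewrite plus_INR, plus_IZR, opp_IZR; simpl; lra.
Qed.

Lemma first_return_disjoint_odd (F : R -> R) (rho : R) (n : nat) (x : R) : irrational_lift F rho ->
  Nat.even n = false ->
  disjoint_mod1 (q rho (S n)) (fun i => Nat.iter i F (first_return F rho n x)) (fun i => Nat.iter i F x).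
Proof.
  intros hF hn i j hi hj hij r. assert (hF' := hF). destruct hF' as [h1 h2 h3 h4].
  pose proof (best_approximation_diff rho n i j r h2 h3 hi hj hij) as H.
  rewrite (Rabs_left (delta rho n)) in H by (now apply delta_sign).
  rewrite !iter_shift. unfold first_return. rewrite !shift_iter_add by assumption.
  replace (shift_iter F j 0 x + IZR r) with (shift_iter F j r x) by (unfold shift_iter; ring).
  replace (shift_iter F (j + q rho n) (0 + - pnum rho n) x + IZR r)
    with (shift_iter F (j + q rho n) (- pnum rho n + r) x)
    by (unfold shift_iter; rewrite !plus_IZR; ring).
  unfold delta in H.
  apply Rabs_ge_cases in H as [H|H]; [left|right]; apply (shift_order_le F rho); auto;
    rewrite plus_INR, plus_IZR, opp_IZR; simpl; lra.
Qed.

(** Applied at the break point, this allows every image of a fundamental arc to be lifted into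
    [xi0, xi0 + 1]. Time 0 follows from the arc being shorter than 1, later times from disjointness
    with the arc itself. *)
Lemma first_return_avoids_even (F : R -> R) (rho : R) (n i : nat) (x : R) (r : Z) : irrational_lift F rho ->
  Nat.even n = true -> (i < q rho (S n))%nat ->
  Nat.iter i F (first_return F rho n x) <= x + IZR r \/ x + IZR r <= Nat.iter i F x.
Proof.
  intros hF hn hi. pose proof (first_return_even F rho n x hF hn) as h.
  assert (hF' := hF). destruct hF' as [h1 h2 h3 h4].
  destruct i as [|i].
  - simpl. destruct (Z_le_gt_dec r 0) as [hr|hr].
    + right. apply IZR_le in hr. lra.
    + left. assert (1 <= IZR r) by (apply IZR_le; lia). lra.
  - destruct (first_return_disjoint_even F rho n x hF hn (S i) 0%nat hi ltac:(lia) ltac:(lia) r)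
      as [H|H]; [left; exact H | right; change (Nat.iter 0 F (first_return F rho n x)) with (first_return F rho n x) in H; lra].
Qed.

Lemma first_return_avoids_odd (F : R -> R) (rho : R) (n i : nat) (x : R) (r : Z) : irrational_lift F rho ->
  Nat.even n = false -> (i < q rho (S n))%nat ->
  Nat.iter i F x <= x + IZR r \/ x + IZR r <= Nat.iter i F (first_return F rho n x).
Proof.
  intros hF hn hi. pose proof (first_return_odd F rho n x hF hn) as h.
  assert (hF' := hF). destruct hF' as [h1 h2 h3 h4].
  destruct i as [|i].
  - simpl. destruct (Z_lt_le_dec r 0) as [hr|hr].
    + right. assert (IZR r <= -1) by (apply IZR_le; lia). lra.
    + left. apply IZR_le in hr. lra.
  - destruct (first_return_disjoint_odd F rho n x hF hn (S i) 0%nat hi ltac:(lia) ltac:(lia) r)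
      as [H|H]; [left; change (Nat.iter 0 F (first_return F rho n x)) with (first_return F rho n x) in H; lra | right; exact H].
Qed.

Lemma even_S_true (n : nat) : Nat.even n = true -> Nat.even (S n) = false.
Proof. intros h. now rewrite Nat.even_succ, <- Nat.negb_even, h. Qed.

Lemma even_S_false (n : nat) : Nat.even n = false -> Nat.even (S n) = true.
Proof. intros h. now rewrite Nat.even_succ, <- Nat.negb_even, h. Qed.

Lemma denjoy (F : R -> R) (rho v : R) (n : nat) (y : R) : irrational_lift F rho -> slope_variation F v ->
  let T := first_return F rho n in
  Rabs (T (T y) - T y) <= exp (8 * v) * Rabs (T y - y).
Proof.
  intros hF hv T. assert (hF' := hF). destruct hF' as [h1 h2 h3 h4].
  assert (hq : (1 <= q rho n <= q rho (S n))%nat) by (split; [apply q_pos|apply q_le_S]; assumption).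
  destruct (Nat.even n) eqn:hn.
  - assert (a1 := first_return_even F rho n y hF hn).
    assert (a2 := first_return_even F rho n (T y) hF hn). fold T in a1, a2.
    rewrite !Rabs_pos_eq by lra.
    apply (denjoy_right F v (q rho n) (q rho (S n)) (- pnum rho n) (- pnum rho (S n))); auto.
    + intros x. generalize (first_return_even F rho n x hF hn). unfold first_return. lra.
    + intros x. apply (first_return_odd F rho (S n) x hF (even_S_true n hn)).
    + intros x. now apply (first_return_twice_even F rho n x hF).
    + intros x. now apply (first_return_disjoint_even F rho n x).
  - assert (a1 := first_return_odd F rho n y hF hn).
    assert (a2 := first_return_odd F rho n (T y) hF hn). fold T in a1, a2.
    rewrite !Rabs_left by lra. rewrite !Ropp_minus_distr.
    apply (denjoy_left F v (q rho n) (q rho (S n)) (- pnum rho n) (- pnum rho (S n))); auto.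
    + intros x. generalize (first_return_odd F rho n x hF hn). unfold first_return. lra.
    + intros x. apply (first_return_even F rho (S n) x hF (even_S_false n hn)).
    + intros x. now apply (first_return_twice_odd F rho n x hF).
    + intros x. now apply (first_return_disjoint_odd F rho n x).
Qed.

(** Let [T z] be the return of level n+2. The arcs from [x] to [T z] and from [T z] to [z] are
    adjacent and lie together in the arc of level n, while [x] lies between [T z] and [T (T z)]. By
    [denjoy] the first arc is at most C times the second, and u <= C w with u + w <= l gives u <= C
    / (1 + C) * l. *)
Lemma first_return_contract (F : R -> R) (rho v : R) (n : nat) (x : R) :
  irrational_lift F rho -> slope_variation F v ->
  let C := exp (8 * v) in
  Rabs (first_return F rho (S (S n)) x - x) <= C / (1 + C) * Rabs (first_return F rho n x - x).
Proof.
  intros hF hv C. assert (hF' := hF). destruct hF' as [h1 h2 h3 h4].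
  destruct (convergents_rec rho n h2 h3) as [k [hk [eq [ep ed]]]].
  set (T := first_return F rho (S n)).
  (* The last step of level n+1 is left out: by the recursion [z] is the return of level n followed
     by k - 1 returns of level n+1, which move back towards [x]. *)
  set (z := shift_iter F (q rho (S (S n)) - q rho (S n)) (- pnum rho (S (S n)) + pnum rho (S n)) x).
  assert (hq : (q rho (S n) <= q rho (S (S n)))%nat) by (apply q_le_S; assumption).
  assert (ey : T z = first_return F rho (S (S n)) x).
  { unfold T, z, first_return. rewrite shift_iter_add by assumption. f_equal; lia. }
  assert (hC := exp_pos (8 * v)). fold C in hC.
  assert (D := denjoy F rho v (S n) z hF hv).
  change (Rabs (T (T z) - T z) <= C * Rabs (T z - z)) in D.
  assert (hd := delta_sign rho (S n) h2 h3).
  assert (hk' : 1 <= INR k) by (change 1 with (INR 1); now apply le_INR).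
  assert (main : Rabs (T z - x) <= Rabs (T (T z) - T z) /\
     Rabs (T z - z) + Rabs (T z - x) <= Rabs (first_return F rho n x - x)).
  { destruct (Nat.even n) eqn:hn.
    - assert (hn1 := even_S_true n hn). assert (hn2 := even_S_false _ hn1).
      apply (proj2 hd) in hn1 as hdn.
      assert (a1 := first_return_even F rho (S (S n)) x hF hn2). rewrite <- ey in a1.
      assert (a2 := first_return_odd F rho (S n) z hF hn1). fold T in a2.
      assert (a3 : T (T z) < x).
      { rewrite ey. unfold T. rewrite first_return_comm by assumption.
        apply (first_return_twice_odd F rho (S n) x hF hn1). }
      assert (a4 : z <= first_return F rho n x).
      { unfold z, first_return. apply (shift_order_le F rho); [assumption|].
        rewrite minus_INR, plus_IZR, !opp_IZR by lia. unfold delta in *. nra. }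
      rewrite (Rabs_pos_eq (T z - x)), (Rabs_left (T (T z) - T z)), (Rabs_left (T z - z)),
        (Rabs_pos_eq (first_return F rho n x - x)) by lra. lra.
    - assert (hn1 := even_S_false n hn). assert (hn2 := even_S_true _ hn1).
      apply (proj1 hd) in hn1 as hdn.
      assert (a1 := first_return_odd F rho (S (S n)) x hF hn2). rewrite <- ey in a1.
      assert (a2 := first_return_even F rho (S n) z hF hn1). fold T in a2.
      assert (a3 : x < T (T z)).
      { rewrite ey. unfold T. rewrite first_return_comm by assumption.
        apply (first_return_twice_even F rho (S n) x hF hn1). }
      assert (a4 : first_return F rho n x <= z).
      { unfold z, first_return. apply (shift_order_le F rho); [assumption|].
        rewrite minus_INR, plus_IZR, !opp_IZR by lia. unfold delta in *. nra. }
      rewrite (Rabs_left (T z - x)), (Rabs_pos_eq (T (T z) - T z)), (Rabs_pos_eq (T z - z)),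
        (Rabs_left (first_return F rho n x - x)) by lra. lra. }
  rewrite <- ey. destruct main as [m1 m2].
  apply Rmult_le_reg_l with (1 + C); [lra|].
  replace ((1 + C) * (C / (1 + C) * Rabs (first_return F rho n x - x)))
    with (C * Rabs (first_return F rho n x - x)) by (field; lra).
  apply Rle_trans with (C * (Rabs (T z - z) + Rabs (T z - x))).
  - rewrite Rmult_plus_distr_r, Rmult_1_l, Rmult_plus_distr_l. lra.
  - apply Rmult_le_compat_l; lra.
Qed.

Lemma first_return_decay (F : R -> R) (rho v : R) : irrational_lift F rho -> slope_variation F v ->
  exists K mu, 0 < K /\ 0 < mu < 1 /\ forall n x, Rabs (first_return F rho n x - x) <= K * mu ^ n.
Proof.
  intros hF hv. set (C := exp (8 * v)). assert (hC : 0 < C) by apply exp_pos.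
  set (la := C / (1 + C)).
  assert (hla : 0 < la < 1).
  { unfold la; split; [apply Rdiv_lt_0_compat; lra|].
    apply Rmult_lt_reg_r with (1 + C); [lra|]. unfold Rdiv. rewrite Rmult_assoc, Rinv_l by lra. lra. }
  assert (hs : 0 < sqrt la < 1).
  { split; [apply sqrt_lt_R0; lra|]. rewrite <- sqrt_1. apply sqrt_lt_1; lra. }
  assert (hle1 : forall n x, Rabs (first_return F rho n x - x) <= 1).
  { intros n x. destruct (Nat.even n) eqn:hn.
    - generalize (first_return_even F rho n x hF hn). intros. rewrite Rabs_pos_eq; lra.
    - generalize (first_return_odd F rho n x hF hn). intros. rewrite Rabs_left; lra. }
  (* The contraction by [la] acts over two levels, hence the rate [sqrt la]. The factor [/ sqrt la]
     makes the bound at least 1 at levels 0 and 1, where only the trivial estimate is available. *)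
  exists (/ sqrt la), (sqrt la). split; [apply Rinv_0_lt_compat; lra|]. split; [assumption|].
  assert (hinv : 1 <= / sqrt la) by (rewrite <- Rinv_1 at 1; apply Rinv_le_contravar; lra).
  assert (H : forall n, (forall x, Rabs (first_return F rho n x - x) <= / sqrt la * sqrt la ^ n) /\
     (forall x, Rabs (first_return F rho (S n) x - x) <= / sqrt la * sqrt la ^ (S n))).
  { induction n as [|n [IH1 IH2]].
    - split; intros x; eapply Rle_trans; [apply hle1| |apply hle1|]; simpl; [lra|].
      rewrite Rmult_1_r, Rinv_l; lra.
    - split; [assumption|]. intros x.
      eapply Rle_trans; [apply (first_return_contract F rho v n x hF hv)|].
      fold C la. replace (/ sqrt la * sqrt la ^ S (S n)) with (la * (/ sqrt la * sqrt la ^ n)).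
      + apply Rmult_le_compat_l; [lra|apply IH1].
      + simpl. rewrite <- (sqrt_sqrt la) at 1 by lra. ring. }
  intros n. apply H.
Qed.

(** * Upper bounds for the rescaling factors *)

Lemma slope_sym (F : R -> R) (u u' : R) : u <> u' -> slope F u u' = slope F u' u.
Proof. intros h. unfold slope. field. lra. Qed.

Lemma slope_le_of_denjoy (F : R -> R) (rho v : R) (n : nat) (y : R) :
  irrational_lift F rho -> slope_variation F v ->
  slope (Nat.iter (q rho n) F) y (first_return F rho n y) <= exp (8 * v).
Proof.
  intros hF hv. rewrite (slope_shift_iter F _ (- pnum rho n)). fold (first_return F rho n).
  pose proof (denjoy F rho v n y hF hv) as D. cbv zeta in D.
  assert (hne : first_return F rho n y - y <> 0).
  { destruct (Nat.even n) eqn:hn.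
    - generalize (first_return_even F rho n y hF hn). lra.
    - generalize (first_return_odd F rho n y hF hn). lra. }
  eapply Rle_trans; [apply Rle_abs|]. rewrite Rabs_div by assumption.
  apply Rabs_pos_lt in hne.
  apply Rmult_le_reg_r with (Rabs (first_return F rho n y - y)); [assumption|].
  unfold Rdiv. rewrite Rmult_assoc, Rinv_l by lra. lra.
Qed.

(** At the break point this slope is [a + b]. The return of level n+1 takes the far endpoint x' into
    the arc; on the subarc so obtained [denjoy] gives [exp (8 * v)], and distortion extends it to
    the whole arc. *)
Lemma return_slope_long (F : R -> R) (rho v : R) (n : nat) (x : R) :
  irrational_lift F rho -> slope_variation F v ->
  0 < slope (Nat.iter (q rho (S n)) F) x (first_return F rho n x) <= exp (9 * v).
Proof.
  intros hF hv. assert (hF' := hF). destruct hF' as [h1 h2 h3 h4].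
  replace (9 * v) with (v + 8 * v) by ring. rewrite exp_plus.
  assert (ep := exp_pos v).
  set (x' := first_return F rho n x).
  pose proof (slope_le_of_denjoy F rho v (S n) x' hF hv) as H.
  destruct (Nat.even n) eqn:hn.
  - assert (a := first_return_even F rho n x hF hn).
    assert (b := first_return_twice_even F rho n x hF hn).
    assert (c := first_return_odd F rho (S n) x' hF (even_S_true n hn)).
    fold x' in a, b. split; [apply slope_pos; [lra|]; apply iter_lt; auto; lra|].
    eapply Rle_trans; [apply (distortion F v (q rho (S n)) x x') with (w := first_return F rho (S n) x') (w' := x'); auto; try lra|].
    + now apply first_return_disjoint_even.
    + apply Rmult_le_compat_l; [lra|]. rewrite slope_sym by lra. exact H.
  - assert (a := first_return_odd F rho n x hF hn).
    assert (b := first_return_twice_odd F rho n x hF hn).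
    assert (c := first_return_even F rho (S n) x' hF (even_S_false n hn)).
    fold x' in a, b. rewrite slope_sym by lra.
    split; [apply slope_pos; [lra|]; apply iter_lt; auto; lra|].
    eapply Rle_trans; [apply (distortion F v (q rho (S n)) x' x) with (w := x') (w' := first_return F rho (S n) x'); auto; try lra|].
    + now apply first_return_disjoint_odd.
    + apply Rmult_le_compat_l; [lra|]. exact H.
Qed.

(** At the break point this slope is [(1 - b) / a]. Here the inclusion is reversed: the arc of level
    n+1 lies inside the arc of level n based at its far endpoint [y], and [denjoy] is used on the
    larger one. *)
Lemma return_slope_short (F : R -> R) (rho v : R) (n : nat) (x : R) :
  irrational_lift F rho -> slope_variation F v ->
  0 < slope (Nat.iter (q rho n) F) x (first_return F rho (S n) x) <= exp (9 * v).
Proof.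
  intros hF hv. assert (hF' := hF). destruct hF' as [h1 h2 h3 h4].
  replace (9 * v) with (v + 8 * v) by ring. rewrite exp_plus.
  assert (ep := exp_pos v).
  set (y := first_return F rho (S n) x).
  pose proof (slope_le_of_denjoy F rho v n y hF hv) as H.
  assert (hq : (q rho n <= q rho (S n))%nat) by (apply q_le_S; assumption).
  destruct (Nat.even n) eqn:hn.
  - assert (a := first_return_odd F rho (S n) x hF (even_S_true n hn)).
    assert (b := first_return_twice_even F rho n x hF hn).
    rewrite first_return_comm in b by assumption.
    assert (c := first_return_even F rho n y hF hn).
    fold y in a, b. rewrite slope_sym by lra.
    split; [apply slope_pos; [lra|]; apply iter_lt; auto; lra|].
    eapply Rle_trans; [apply (distortion F v (q rho n) y (first_return F rho n y)) with (w := y) (w' := first_return F rho n y); auto; try lra|].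
    + apply (disjoint_mod1_le _ (q rho (S n))); [assumption|]. now apply first_return_disjoint_even.
    + apply Rmult_le_compat_l; [lra|]. exact H.
  - assert (a := first_return_even F rho (S n) x hF (even_S_false n hn)).
    assert (b := first_return_twice_odd F rho n x hF hn).
    rewrite first_return_comm in b by assumption.
    assert (c := first_return_odd F rho n y hF hn).
    fold y in a, b.
    split; [apply slope_pos; [lra|]; apply iter_lt; auto; lra|].
    eapply Rle_trans; [apply (distortion F v (q rho n) (first_return F rho n y) y) with (w := first_return F rho n y) (w' := y); auto; try lra|].
    + apply (disjoint_mod1_le _ (q rho (S n))); [assumption|]. now apply first_return_disjoint_odd.
    + apply Rmult_le_compat_l; [lra|]. rewrite slope_sym by lra. exact H.
Qed.

(** * Zygmund estimates on one arc *)

Lemma ln_4_gt_1 : 1 < ln 4.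
Proof.
  rewrite <- (ln_exp 1). apply ln_increasing; [apply exp_pos|].
  generalize exp_le_3. lra.
Qed.

Lemma Zg_pos (g t : R) : 0 < t -> 0 < Zg g t.
Proof. intros h. unfold Zg. destruct (Rlt_dec 0 t); [apply exp_pos|contradiction]. Qed.

Lemma Zg_le (g s t : R) : 0 <= g -> 0 < s <= t -> t < 1 -> Zg g s <= Zg g t.
Proof.
  intros hg hs ht. unfold Zg. destruct (Rlt_dec 0 s); [|lra]. destruct (Rlt_dec 0 t); [|lra].
  rewrite !Rpower_Ropp. apply Rinv_le_contravar; [apply exp_pos|].
  apply Rle_Rpower_l; [assumption|]. split.
  - rewrite <- ln_1. apply ln_increasing; [lra|]. rewrite <- Rinv_1. apply Rinv_lt_contravar; lra.
  - apply ln_le; [apply Rinv_0_lt_compat; lra|]. apply Rinv_le_contravar; lra.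
Qed.

(** The range up to 1/4 makes the logarithm at least 1, since ln 4 > 1; its power with exponent -g
    is then at most 1. *)
Lemma Zg_le_1 (g t : R) : 0 <= g -> 0 < t <= 1/4 -> Zg g t <= 1.
Proof.
  intros hg ht. unfold Zg. destruct (Rlt_dec 0 t); [|lra].
  assert (h : 1 <= ln (/ t)).
  { left. eapply Rlt_le_trans; [apply ln_4_gt_1|]. apply ln_le; [lra|].
    replace 4 with (/ (1/4)) by field. apply Rinv_le_contravar; lra. }
  rewrite Rpower_Ropp, <- Rinv_1. apply Rinv_le_contravar; [lra|].
  rewrite <- (Rpower_O (ln (/ t))) by lra. apply Rle_Rpower; lra.
Qed.

Definition zygmund (xi0 C g : R) (D : R -> R) : Prop :=
  forall tau x, 0 <= tau <= 1/2 -> xi0 <= x - tau -> x + tau <= xi0 + 1 ->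
    Rabs (D (x + tau) + D (x - tau) - 2 * D x) <= C * tau * Zg g tau.

(** The power t^(3/4), written with square roots so as to be defined at 0. The exponent is above
    1/2, so that squared oscillations are of order [t * sqrt t], and below 1, so that doubling [t]
    costs a factor less than 2. *)
Definition pow34 (t : R) : R := sqrt (t * sqrt t).

Lemma pow34_le (s t : R) : 0 <= s <= t -> pow34 s <= pow34 t.
Proof.
  intros h. unfold pow34. apply sqrt_le_1_alt.
  apply Rmult_le_compat; [lra|apply sqrt_pos|lra|apply sqrt_le_1_alt; lra].
Qed.

Lemma pow34_double (t : R) : 0 <= t -> pow34 (2 * t) <= (17/10) * pow34 t.
Proof.
  intros h. unfold pow34. rewrite (sqrt_mult 2 t) by lra.
  rewrite <- (sqrt_square (17/10)) at 1 by lra.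
  rewrite <- (sqrt_mult_alt (17/10 * (17/10))) by lra. apply sqrt_le_1_alt.
  (* 2 * 1.445 = 2.89 is exactly the square of 17/10. *)
  assert (h2 : sqrt 2 <= (1445/1000)).
  { rewrite <- (sqrt_square (1445/1000)) by lra. apply sqrt_le_1_alt; lra. }
  assert (0 <= t * sqrt t) by (apply Rmult_le_pos; [lra|apply sqrt_pos]).
  replace (2 * t * (sqrt 2 * sqrt t)) with (2 * sqrt 2 * (t * sqrt t)) by ring.
  apply Rmult_le_compat_r; lra.
Qed.

Lemma le_pow34 (t : R) : 0 <= t <= 1 -> t <= pow34 t.
Proof.
  intros h. unfold pow34. rewrite <- (sqrt_square t) at 1 by lra. apply sqrt_le_1_alt.
  apply Rmult_le_compat_l; [lra|]. rewrite <- (sqrt_square t) at 1 by lra. apply sqrt_le_1_alt. nra.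
Qed.

Lemma pow34_sqr (t : R) : 0 <= t -> pow34 t * pow34 t = t * sqrt t.
Proof. intros h. apply sqrt_sqrt, Rmult_le_pos; [lra|apply sqrt_pos]. Qed.

(* The increment over an interval is half the increment over an interval twice as long, up to a
   second difference; [pow34] grows by less than a factor 2 under doubling. *)
Lemma zygmund_hoelder_step (xi0 C g M : R) (D : R -> R) : 0 <= g -> 0 < C ->
  zygmund xi0 C g D -> (forall x, 0 <= D x <= M) ->
  forall k u v, xi0 <= u < v -> v <= xi0 + 1 -> 1/4 * (1/2) ^ k <= v - u ->
    Rabs (D v - D u) <= 4 * (M + C) * pow34 (v - u).
Proof.
  intros hg hC hz hM. assert (hM0 : 0 <= M) by (generalize (hM 0); lra).
  induction k as [|k IH]; intros u v hu hv ht.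
  - simpl in ht. assert (h4 := le_pow34 (v - u) ltac:(lra)).
    apply Rle_trans with M; [apply Rabs_le; generalize (hM u) (hM v); lra|].
    assert (0 <= C * pow34 (v - u)) by (apply Rmult_le_pos; lra).
    assert (M * (1/4) <= M * pow34 (v - u)) by (apply Rmult_le_compat_l; lra). lra.
  - destruct (Rle_dec (1/4) (v - u)) as [hb|hb].
    { assert (h4 := le_pow34 (v - u) ltac:(lra)).
      apply Rle_trans with M; [apply Rabs_le; generalize (hM u) (hM v); lra|].
      assert (0 <= C * pow34 (v - u)) by (apply Rmult_le_pos; lra).
      assert (M * (1/4) <= M * pow34 (v - u)) by (apply Rmult_le_compat_l; lra). lra. }
    set (t := v - u) in *.
    assert (hZ : C * t * Zg g t <= C * pow34 t).
    { rewrite Rmult_assoc. apply Rmult_le_compat_l; [lra|].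
      apply Rle_trans with (t * 1); [|rewrite Rmult_1_r; apply le_pow34; unfold t; lra].
      apply Rmult_le_compat_l; [unfold t; lra|]. apply Zg_le_1; unfold t in *; lra. }
    assert (h2 := pow34_double t ltac:(unfold t; lra)).
    assert (hp : 0 <= pow34 t) by apply sqrt_pos.
    (* The factor 4 reproduces itself: half of 4 * 17/10 is 3.4, and half a second difference adds
       at most C / 2. At lengths from 1/4 on, 4 is what compensates [pow34] being at least 1/4. *)
    assert (hfin : forall d1 d2, Rabs d1 <= 4 * (M + C) * pow34 (2 * t) -> Rabs d2 <= C * t * Zg g t ->
      Rabs ((d1 + d2) / 2) <= 4 * (M + C) * pow34 t).
    { intros d1 d2 e1 e2. unfold Rdiv. rewrite Rabs_mult, (Rabs_pos_eq (/ 2)) by lra.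
      assert (e3 := Rabs_triang d1 d2).
      assert (4 * (M + C) * pow34 (2 * t) <= 4 * (M + C) * ((17/10) * pow34 t))
        by (apply Rmult_le_compat_l; lra).
      assert (0 <= M * pow34 t) by (apply Rmult_le_pos; lra).
      assert (0 <= C * pow34 t) by (apply Rmult_le_pos; lra). lra. }
    assert (ht' : 1 / 4 * (1 / 2) ^ k <= 2 * t) by (simpl in ht; lra).
    (* The length is below 1/4 here, so if the interval cannot be doubled to the right inside the
       fundamental domain, it can be doubled to the left. *)
    destruct (Rle_dec (v + t) (xi0 + 1)) as [hr|hr].
    + replace (D v - D u) with (((D (v + t) - D u) + - (D (v + t) + D (v - t) - 2 * D v)) / 2)
        by (unfold t; replace (v - (v - u)) with u by ring; field).
      apply hfin.
      * replace (2 * t) with (v + t - u) in ht' |- * by (unfold t; ring).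
        apply IH; unfold t in *; lra.
      * rewrite Rabs_Ropp. apply hz; unfold t in *; lra.
    + replace (D v - D u) with (((D v - D (u - t)) + (D (u + t) + D (u - t) - 2 * D u)) / 2)
        by (unfold t; replace (u + (v - u)) with v by ring; field).
      apply hfin.
      * replace (2 * t) with (v - (u - t)) in ht' |- * by (unfold t; ring).
        apply IH; unfold t in *; lra.
      * apply hz; unfold t in *; lra.
Qed.

Lemma zygmund_hoelder (xi0 C g M : R) (D : R -> R) : 0 <= g -> 0 < C ->
  zygmund xi0 C g D -> (forall x, 0 <= D x <= M) ->
  forall u v L, xi0 <= u <= xi0 + 1 -> xi0 <= v <= xi0 + 1 -> Rabs (v - u) <= L ->
    Rabs (D v - D u) <= 4 * (M + C) * pow34 L.
Proof.
  intros hg hC hz hM.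
  assert (hM0 : 0 <= M) by (generalize (hM 0); lra).
  assert (H : forall u v L, xi0 <= u < v -> v <= xi0 + 1 -> v - u <= L ->
     Rabs (D v - D u) <= 4 * (M + C) * pow34 L).
  { intros u v L h1 h2 h3.
    destruct (pow_lt_1_zero (1/2)) with (y := v - u) as [N hN];
      [rewrite Rabs_pos_eq; lra|lra|].
    specialize (hN N (Nat.le_refl _)). rewrite Rabs_pos_eq in hN by (apply pow_le; lra).
    assert (0 < (1/2)^N) by (apply pow_lt; lra).
    eapply Rle_trans; [apply (zygmund_hoelder_step xi0 C g M D hg hC hz hM N u v); lra|].
    apply Rmult_le_compat_l; [lra|]. apply pow34_le; lra. }
  intros u v L h1 h2 h3. destruct (Rtotal_order u v) as [h|[h|h]].
  - apply H; try lra. rewrite Rabs_pos_eq in h3; lra.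
  - subst. rewrite Rminus_diag, Rabs_R0. apply Rmult_le_pos; [lra|apply sqrt_pos].
  - rewrite Rabs_minus_sym. apply H; try lra. rewrite Rabs_left in h3; lra.
Qed.

(* Difference quotient of [E], extended by its derivative [D] on the diagonal. *)
Definition secant (E D : R -> R) (u v : R) : R :=
  if Req_EM_T u v then D u else (E v - E u) / (v - u).

Lemma secant_sym (E D : R -> R) (u v : R) : secant E D u v = secant E D v u.
Proof.
  unfold secant. destruct (Req_EM_T u v), (Req_EM_T v u); subst; try congruence; try lra.
  field; lra.
Qed.

Lemma secant_mul (E D : R -> R) (u v : R) : E v - E u = secant E D u v * (v - u).
Proof. unfold secant. destruct (Req_EM_T u v); [subst; ring|field; lra]. Qed.

Lemma derive_MVT (E D : R -> R) (u v : R) : (forall x, is_derive E x (D x)) -> u < v ->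
  exists c, u < c < v /\ E v - E u = D c * (v - u).
Proof.
  intros hE huv.
  destruct (MVT_cor2 E D u v huv) as [c [e hc]].
  - intros c _. apply is_derive_Reals, hE.
  - exists c; split; [assumption|exact e].
Qed.

Lemma secant_MVT (E D : R -> R) (u v : R) : (forall x, is_derive E x (D x)) ->
  exists c, Rmin u v <= c <= Rmax u v /\ secant E D u v = D c.
Proof.
  intros hE.
  assert (H : forall u v, u < v -> exists c, Rmin u v <= c <= Rmax u v /\ secant E D u v = D c).
  { clear u v. intros u v h. destruct (derive_MVT E D u v hE h) as [c [hc e]]. exists c.
    rewrite Rmin_left, Rmax_right by lra. split; [lra|].
    unfold secant. destruct (Req_EM_T u v); [lra|]. rewrite e. field; lra. }
  destruct (Rtotal_order u v) as [h|[h|h]].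
  - now apply H.
  - subst. exists v. rewrite Rmin_left, Rmax_left by lra. split; [lra|].
    unfold secant. destruct (Req_EM_T v v); congruence.
  - rewrite secant_sym, Rmin_comm, Rmax_comm. now apply H.
Qed.

(** The mean value theorem is applied to [E (c + t) - E (c - t)] around the midpoint [c]. It yields
    a symmetric sum of values of [D], which the Zygmund condition at [c] compares with the sum at
    the endpoints; a mean value over the interval itself would only give the oscillation of [D]. *)
Lemma secant_trapezoid (xi0 C g : R) (E D : R -> R) (L eta : R) (u v : R) :
  0 < C -> zygmund xi0 C g D -> (forall x, is_derive E x (D x)) ->
  xi0 <= u <= xi0 + 1 -> xi0 <= v <= xi0 + 1 -> Rabs (v - u) <= L -> 0 <= eta ->
  (forall t, 0 < t <= L -> Zg g t <= eta) ->
  Rabs (secant E D u v - (D u + D v) / 2) <= C * L * eta.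
Proof.
  intros hC hz hE hu0 hv0 hL0 heta hZ.
  assert (H : forall u v, xi0 <= u < v -> v <= xi0 + 1 -> v - u <= L ->
    Rabs (secant E D u v - (D u + D v) / 2) <= C * L * eta).
  { clear u v hu0 hv0 hL0. intros u v hu hv hL. set (c := (u + v) / 2). set (h := (v - u) / 2).
    assert (hz' : forall t, 0 < t <= h -> Rabs (D (c + t) + D (c - t) - 2 * D c) <= C * (L / 2) * eta).
    { intros t ht. eapply Rle_trans; [apply hz; unfold c, h in *; lra|].
      apply Rmult_le_compat; [apply Rmult_le_pos; lra|left; apply Zg_pos; lra| |].
      - apply Rmult_le_compat_l; unfold h in *; lra.
      - apply hZ; unfold h in *; lra. }
    destruct (derive_MVT (fun t => E (c + t) - E (c - t)) (fun t => D (c + t) + D (c - t)) 0 h) as [t [ht e]].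
    - intros t.
      replace (D (c + t) + D (c - t)) with (1 * D (c + t) - (-1) * D (c - t)) by ring.
      apply (is_derive_minus (fun t => E (c + t)) (fun t => E (c - t))).
      + apply (is_derive_comp E (fun t => c + t)); [apply hE|]. auto_derive; auto.
      + apply (is_derive_comp E (fun t => c - t)); [apply hE|]. auto_derive; auto.
    - unfold h; lra.
    - replace (c + h) with v in e by (unfold c, h; field).
      replace (c - h) with u in e by (unfold c, h; field).
      assert (es : secant E D u v = (D (c + t) + D (c - t)) / 2).
      { unfold secant. destruct (Req_EM_T u v); [lra|].
        replace (E v - E u) with ((D (c + t) + D (c - t)) * (h - 0)) by (rewrite <- e, Rplus_0_r, Rminus_0_r; ring).
        unfold h. field. lra. }
      rewrite es.
      assert (k1 := hz' t ltac:(lra)). assert (k2 := hz' h ltac:(lra)).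
      replace (c + h) with v in k2 by (unfold c, h; field).
      replace (c - h) with u in k2 by (unfold c, h; field).
      apply Rabs_le_between in k1, k2. apply Rabs_le_between. lra. }
  destruct (Rtotal_order u v) as [h|[h|h]].
  - apply H; try lra. rewrite Rabs_pos_eq in hL0; lra.
  - subst. unfold secant. destruct (Req_EM_T v v); [|congruence].
    replace (D v - (D v + D v) / 2) with 0 by field. rewrite Rabs_R0.
    assert (0 <= L) by (eapply Rle_trans; [apply Rabs_pos|exact hL0]).
    repeat apply Rmult_le_pos; lra.
  - rewrite secant_sym, (Rplus_comm (D u)). apply H; try lra. rewrite Rabs_left in hL0; lra.
Qed.

(** The inequality ln y <= y - 1, used at [a / b] and at [b / a], encloses the logarithm between two
    bounds that differ by (a - b)^2 / (a b). *)
Lemma ln_quotient_approx (m a b : R) : 0 < m -> m <= a -> m <= b ->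
  Rabs (ln a - ln b - (a - b) / b) <= (a - b) * (a - b) / (m * m).
Proof.
  intros hm ha hb.
  assert (H : forall x y, 0 < x -> 0 < y -> ln x - ln y <= (x - y) / y).
  { intros x y hx hy. rewrite <- ln_div by assumption.
    pose proof (exp_ineq1_le (ln (x / y))) as h. rewrite exp_ln in h by (apply Rdiv_lt_0_compat; lra).
    replace ((x - y) / y) with (x / y - 1) by (field; lra). lra. }
  assert (h1 := H a b ltac:(lra) ltac:(lra)). assert (h2 := H b a ltac:(lra) ltac:(lra)).
  assert (e : (a - b) / b + (b - a) / a = (a - b) * (a - b) / (a * b)) by (field; lra).
  assert (k : (a - b) * (a - b) / (a * b) <= (a - b) * (a - b) / (m * m)).
  { apply Rmult_le_compat_l; [apply Rle_0_sqr|]. apply Rinv_le_contravar; [nra|].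
    apply Rmult_le_compat; lra. }
  assert (k0 : 0 <= (a - b) * (a - b) / (m * m)).
  { apply Rdiv_le_0_compat; [apply Rle_0_sqr|nra]. }
  apply Rabs_le. lra.
Qed.

Record zygmund_model (xi0 C g m M : R) (E D : R -> R) : Prop := {
  zm_g : 0 <= g;
  zm_C : 0 < C;
  zm_z : zygmund xi0 C g D;
  zm_E : forall x, is_derive E x (D x);
  zm_m : 0 < m;
  zm_bd : forall x, m <= D x <= M }.

Lemma cross_ratio_estimates (xi0 C g m M : R) (E D : R -> R) : zygmund_model xi0 C g m M E D ->
  exists K, 0 < K /\ forall s x e eta,
    xi0 <= s <= xi0 + 1 -> xi0 <= e <= xi0 + 1 -> Rmin s e <= x <= Rmax s e ->
    (forall t, 0 < t <= Rabs (e - s) -> Zg g t <= eta) -> sqrt (Rabs (e - s)) <= eta ->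
    (forall b, b = D s \/ b = D e ->
       Rabs (ln (secant E D s x) - ln (secant E D x e) - (D s - D e) / (2 * b)) <= K * (Rabs (e - s) * eta)) /\
    Rabs (ln (D x * secant E D s e) - ln (secant E D s x * secant E D x e)) <= K * (Rabs (e - s) * eta).
Proof.
  intros [hg hC hz hE hm hbd].
  assert (hmM : m <= M) by (generalize (hbd 0); lra).
  set (A := 4 * (M + C)).
  exists (2 * (A * A) / (m * m) + 2 * C / m + (3 * M * C + A * A) / (m * m)).
  assert (hA : 0 < A) by (unfold A; lra).
  assert (k1 : 0 < 2 * (A * A) / (m * m)) by (apply Rdiv_lt_0_compat; nra).
  assert (k2 : 0 < 2 * C / m) by (apply Rdiv_lt_0_compat; lra).
  assert (k3 : 0 < (3 * M * C + A * A) / (m * m)).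
  { apply Rdiv_lt_0_compat; [|nra]. assert (0 < M * C) by (apply Rmult_lt_0_compat; lra). nra. }
  split; [lra|]. intros s x e eta hs he hx hZ hsq.
  set (L := Rabs (e - s)) in *.
  assert (hL : 0 <= L) by apply Rabs_pos.
  assert (heta : 0 <= eta) by (eapply Rle_trans; [apply sqrt_pos|exact hsq]).
  assert (hmm : xi0 <= Rmin s e /\ Rmax s e <= xi0 + 1 /\ Rmax s e - Rmin s e = L).
  { unfold L, Rmin, Rmax, Rabs. destruct (Rle_dec s e), (Rcase_abs (e - s)); lra. }
  destruct hmm as [b1 [b2 b3]].
  set (lo := Rmin s e) in *. set (hi := Rmax s e) in *.
  assert (hse : lo <= s <= hi /\ lo <= e <= hi).
  { unfold lo, hi, Rmin, Rmax; destruct (Rle_dec s e); lra. }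
  set (o := A * pow34 L).
  assert (hosc : forall u v, lo <= u <= hi -> lo <= v <= hi -> Rabs (D v - D u) <= o).
  { intros u v hu hv. apply (zygmund_hoelder xi0 C g M D hg hC hz); try lra.
    - intros y. generalize (hbd y). lra.
    - apply Rabs_le. lra. }
  assert (hmv : forall u v, lo <= u <= hi -> lo <= v <= hi ->
     exists c, lo <= c <= hi /\ secant E D u v = D c).
  { intros u v hu hv. destruct (secant_MVT E D u v hE) as [c [hc ec]].
    exists c; split; [|assumption]. revert hc. unfold Rmin, Rmax. destruct (Rle_dec u v); lra. }
  assert (htr : forall u v, lo <= u <= hi -> lo <= v <= hi ->
     Rabs (secant E D u v - (D u + D v) / 2) <= C * L * eta).
  { intros u v hu hv. apply (secant_trapezoid xi0 C g E D L eta u v); auto; try lra.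
    apply Rabs_le; lra. }
  destruct (hmv s x) as [cR [hcR eR]]; try lra.
  destruct (hmv x e) as [cS [hcS eS]]; try lra.
  destruct (hmv s e) as [cT [hcT eT]]; try lra.
  assert (tR := htr s x ltac:(lra) ltac:(lra)). assert (tS := htr x e ltac:(lra) ltac:(lra)).
  assert (tT := htr s e ltac:(lra) ltac:(lra)).
  set (Rr := secant E D s x) in *. set (Ss := secant E D x e) in *. set (Tt := secant E D s e) in *.
  assert (bR : m <= Rr <= M) by (rewrite eR; apply hbd).
  assert (bS : m <= Ss <= M) by (rewrite eS; apply hbd).
  assert (bT : m <= Tt <= M) by (rewrite eT; apply hbd).
  assert (bx := hbd x).
  assert (oo : o * o <= A * A * (L * eta)).
  { unfold o. replace (A * pow34 L * (A * pow34 L)) with (A * A * (pow34 L * pow34 L)) by ring.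
    rewrite pow34_sqr by assumption. apply Rmult_le_compat_l; [nra|]. apply Rmult_le_compat_l; lra. }
  assert (ho : 0 <= o) by (apply Rmult_le_pos; [lra|apply sqrt_pos]).
  assert (hLe : 0 <= L * eta) by (apply Rmult_le_pos; lra).
  assert (prod : forall a b, Rabs a <= o -> Rabs b <= o -> Rabs (a * b) <= A * A * (L * eta)).
  { intros a b ha hb. rewrite Rabs_mult. eapply Rle_trans; [|exact oo].
    apply Rmult_le_compat; try apply Rabs_pos; assumption. }
  assert (him : 0 < / m) by (now apply Rinv_0_lt_compat).
  assert (himm : 0 < / (m * m)) by (apply Rinv_0_lt_compat; nra).
  assert (dRS : Rabs (Rr - Ss) <= o) by (rewrite eR, eS; now apply hosc).
  split.
  - intros b hb.
    assert (bb : m <= b /\ Rabs (b - Ss) <= o).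
    { split; [destruct hb as [-> | ->]; apply hbd|]. rewrite eS. destruct hb as [-> | ->]; apply hosc; lra. }
    destruct bb as [bb1 bb2].
    assert (q1 := ln_quotient_approx m Rr Ss hm ltac:(lra) ltac:(lra)).
    assert (q2 : (Rr - Ss) * (Rr - Ss) / (m * m) <= (A * A) / (m * m) * (L * eta)).
    { unfold Rdiv. replace (A * A * / (m * m) * (L * eta)) with (A * A * (L * eta) * / (m * m)) by ring.
      apply Rmult_le_compat_r; [lra|]. eapply Rle_trans; [apply Rle_abs|]. now apply prod. }
    assert (q3 : Rabs ((Rr - Ss) / Ss - (Rr - Ss) / b) <= (A * A) / (m * m) * (L * eta)).
    { replace ((Rr - Ss) / Ss - (Rr - Ss) / b) with ((Rr - Ss) * (b - Ss) * / (Ss * b)) by (field; lra).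
      rewrite Rabs_mult. unfold Rdiv.
      replace (A * A * / (m * m) * (L * eta)) with (A * A * (L * eta) * / (m * m)) by ring.
      apply Rmult_le_compat; try apply Rabs_pos; [now apply prod|].
      assert (0 < Ss * b) by (apply Rmult_lt_0_compat; lra).
      rewrite Rabs_pos_eq by (left; now apply Rinv_0_lt_compat).
      apply Rinv_le_contravar; [nra|]. apply Rmult_le_compat; lra. }
    (* [D x] cancels between the two endpoint means, so the main term does not depend on the
       intermediate point. *)
    assert (q4 : Rabs ((Rr - Ss) / b - (D s - D e) / (2 * b)) <= 2 * C / m * (L * eta)).
    { replace ((Rr - Ss) / b - (D s - D e) / (2 * b))
        with (((Rr - (D s + D x) / 2) - (Ss - (D x + D e) / 2)) * / b) by (field; lra).
      rewrite Rabs_mult. unfold Rdiv.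
      replace (2 * C * / m * (L * eta)) with (2 * (C * L * eta) * / m) by ring.
      apply Rmult_le_compat; try apply Rabs_pos.
      - apply Rabs_le_between in tR, tS. apply Rabs_le. lra.
      - rewrite Rabs_pos_eq by (left; apply Rinv_0_lt_compat; lra). apply Rinv_le_contravar; lra. }
    assert (k3' := Rmult_le_pos _ _ (Rlt_le _ _ k3) hLe).
    apply Rabs_le_between in q1, q3, q4. apply Rabs_le.
    unfold Rdiv in *. rewrite !Rmult_plus_distr_r in *. lra.
  - eapply Rle_trans; [apply (ln_lipschitz (m * m)); [nra|apply Rmult_le_compat; lra..]|].
    (* The means over [s,x] and [x,e] minus the mean over [s,e] sum to [D x], so only trapezoid
       errors and a product of two oscillations are left. *)
    assert (q1 : Rabs (D x * Tt - Rr * Ss) <= (3 * M * C + A * A) * (L * eta)).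
    { replace (D x * Tt - Rr * Ss) with
        (D x * ((Tt - (D s + D e) / 2) - (Rr - (D s + D x) / 2) - (Ss - (D x + D e) / 2))
         - (Rr - D x) * (Ss - D x)) by field.
      eapply Rle_trans; [apply Rabs_triang|]. rewrite Rabs_Ropp, Rabs_mult.
      rewrite Rmult_plus_distr_r. apply Rplus_le_compat.
      - replace (3 * M * C * (L * eta)) with (M * (3 * (C * L * eta))) by ring.
        apply Rmult_le_compat; try apply Rabs_pos.
        + rewrite Rabs_pos_eq; lra.
        + apply Rabs_le_between in tR, tS, tT. apply Rabs_le. lra.
      - apply prod; [rewrite eR|rewrite eS]; apply hosc; lra. }
    assert (k1' := Rmult_le_pos _ _ (Rlt_le _ _ k1) hLe).
    assert (k2' := Rmult_le_pos _ _ (Rlt_le _ _ k2) hLe).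
    apply Rle_trans with ((3 * M * C + A * A) / (m * m) * (L * eta)).
    + unfold Rdiv. replace ((3 * M * C + A * A) * / (m * m) * (L * eta))
        with ((3 * M * C + A * A) * (L * eta) * / (m * m)) by ring.
      apply Rmult_le_compat_r; lra.
    + rewrite !Rmult_plus_distr_r. lra.
Qed.

(** * Composition along the arcs *)

Lemma exp_close (Y B tau t : R) : 0 <= Y <= B -> Rabs tau <= t -> t <= 4 ->
  Rabs (Y * exp tau - Y) <= B * exp 4 * t.
Proof.
  intros hY ht h4.
  assert (H : Rabs (exp tau - 1) <= exp 4 * t).
  { assert (e4 : 1 <= exp 4) by (generalize (exp_ineq1_le 4); lra).
    apply Rabs_le_between in ht as ht'.
    destruct (Rle_dec 0 tau) as [h|h].
    - assert (h1 := exp_ineq1_le (- tau)). rewrite exp_Ropp in h1.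
      assert (hp := exp_pos tau).
      assert (h2 : (1 + - tau) * exp tau <= 1).
      { apply Rmult_le_reg_r with (/ exp tau); [now apply Rinv_0_lt_compat|].
        rewrite Rmult_assoc, Rinv_r by lra. lra. }
      assert (h3 : exp tau <= exp 4).
      { destruct (Req_dec tau 4) as [->|hne]; [lra|]. left; apply exp_increasing; lra. }
      assert (h5 := exp_ineq1_le tau).
      rewrite Rabs_pos_eq by lra. rewrite Rabs_pos_eq in ht by lra.
      apply Rle_trans with (exp tau * tau); [lra|]. apply Rmult_le_compat; lra.
    - assert (h1 := exp_ineq1_le tau). assert (exp tau < 1) by (rewrite <- exp_0; apply exp_increasing; lra).
      rewrite Rabs_left by lra. nra. }
  replace (Y * exp tau - Y) with (Y * (exp tau - 1)) by ring.
  rewrite Rabs_mult, (Rabs_pos_eq Y), Rmult_assoc by lra.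
  apply Rmult_le_compat; try lra. apply Rabs_pos.
Qed.

Lemma exp_le (x y : R) : x <= y -> exp x <= exp y.
Proof. intros [h|h]; [left; now apply exp_increasing | rewrite h; lra]. Qed.

(** All errors are multiplicative. The factor [exp th1] on [mu] changes the denominator by
    [exp (- ka)] with [ka] again at most [dl] in absolute value, so the map and its derivative
    change by the exponential of a sum of at most four terms of size [dl]; this is the origin of
    both 4s. The cube of [Q] bounds mu over the squared denominator. *)
Lemma mobius_close (Q mu sg th1 th2 dl : R) :
  1 <= Q -> / Q <= mu <= Q -> 0 <= sg <= 1 -> Rabs th1 <= dl -> Rabs th2 <= dl -> dl <= 1 ->
  let M := mu * exp th1 in
  Rabs (M * sg / (M * sg + (1 - sg)) - mu * sg / (mu * sg + (1 - sg))) <= 4 * Q * Q * Q * exp 4 * dl /\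
  Rabs (exp th2 * M / ((M * sg + (1 - sg)) * (M * sg + (1 - sg)))
        - mu / ((mu * sg + (1 - sg)) * (mu * sg + (1 - sg)))) <= 4 * Q * Q * Q * exp 4 * dl.
Proof.
  intros hQ hmu hs h1 h2 hd M.
  assert (hQi : 0 < / Q) by (apply Rinv_0_lt_compat; lra).
  assert (hQ1 : / Q <= 1) by (rewrite <- Rinv_1; apply Rinv_le_contravar; lra).
  assert (hdl : 0 <= dl) by (eapply Rle_trans; [apply Rabs_pos|exact h1]).
  set (d := mu * sg + (1 - sg)). set (d' := M * sg + (1 - sg)).
  assert (hM : 0 < M) by (apply Rmult_lt_0_compat; [lra|apply exp_pos]).
  assert (hdQ : / Q <= d).
  { unfold d. assert (/ Q * sg <= mu * sg) by (apply Rmult_le_compat_r; lra).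
    assert (/ Q * (1 - sg) <= 1 * (1 - sg)) by (apply Rmult_le_compat_r; lra). lra. }
  apply Rabs_le_between in h1 as h1'.
  assert (E1 : M <= mu * exp dl) by (apply Rmult_le_compat_l; [lra|]; apply exp_le; lra).
  assert (E2 : mu <= M * exp dl).
  { unfold M. rewrite Rmult_assoc, <- exp_plus, <- (Rmult_1_r mu) at 1.
    apply Rmult_le_compat_l; [lra|]. rewrite <- exp_0 at 1. apply exp_le; lra. }
  assert (E3 : 1 <= exp dl) by (rewrite <- exp_0 at 1; apply exp_le; lra).
  assert (hd'p : 0 < d').
  { unfold d'. destruct (Req_dec sg 1) as [->|hne]; [lra|].
    assert (0 <= M * sg) by (apply Rmult_le_pos; lra). lra. }
  assert (F1 : d' <= d * exp dl).
  { unfold d, d'. rewrite Rmult_plus_distr_r. apply Rplus_le_compat; [|nra].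
    replace (mu * sg * exp dl) with (mu * exp dl * sg) by ring. apply Rmult_le_compat_r; lra. }
  assert (F2 : d <= d' * exp dl).
  { unfold d, d'. rewrite Rmult_plus_distr_r. apply Rplus_le_compat; [|nra].
    replace (M * sg * exp dl) with (M * exp dl * sg) by ring. apply Rmult_le_compat_r; lra. }
  set (ka := ln d - ln d').
  assert (hka : Rabs ka <= dl).
  { apply Rabs_le. unfold ka. split.
    - assert (h := ln_le d' (d * exp dl) hd'p F1). rewrite ln_mult, ln_exp in h by (try apply exp_pos; lra). lra.
    - assert (h := ln_le d (d' * exp dl) ltac:(lra) F2). rewrite ln_mult, ln_exp in h by (try apply exp_pos; lra). lra. }
  assert (ed : / d' = / d * exp ka).
  { unfold ka, Rminus. rewrite exp_plus, exp_Ropp, !exp_ln by lra. field; lra. }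
  apply Rabs_le_between in hka. apply Rabs_le_between in h2.
  assert (hdi : 0 < / d <= Q).
  { split; [apply Rinv_0_lt_compat; lra|]. rewrite <- (Rinv_inv Q). apply Rinv_le_contravar; lra. }
  assert (QQ : 1 <= Q * Q * Q) by nra.
  assert (e4 := exp_pos 4).
  split.
  - replace (M * sg / d') with (mu * sg / d * exp (th1 + ka))
      by (unfold Rdiv; rewrite ed, exp_plus; unfold M; ring).
    eapply Rle_trans; [apply (exp_close _ 1 _ (4 * dl))|].
    + split; [apply Rdiv_le_0_compat; [apply Rmult_le_pos|]; lra|].
      apply Rmult_le_reg_r with d; [lra|]. unfold Rdiv. rewrite Rmult_assoc, Rinv_l by lra. unfold d; lra.
    + apply Rabs_le; lra.
    + lra.
    + replace (1 * exp 4 * (4 * dl)) with (1 * (4 * exp 4 * dl)) by ring.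
      replace (4 * Q * Q * Q * exp 4 * dl) with (Q * Q * Q * (4 * exp 4 * dl)) by ring.
      apply Rmult_le_compat_r; [|assumption]. repeat apply Rmult_le_pos; lra.
  - replace (exp th2 * M / (d' * d')) with (mu / (d * d) * exp (th2 + th1 + ka + ka))
      by (unfold Rdiv; rewrite !Rinv_mult, ed, !exp_plus; unfold M; ring).
    eapply Rle_trans; [apply (exp_close _ (Q * (Q * Q)) _ (4 * dl))|].
    + unfold Rdiv. rewrite Rinv_mult. split; [repeat apply Rmult_le_pos; lra|].
      repeat apply Rmult_le_compat; try apply Rmult_le_pos; lra.
    + apply Rabs_le; lra.
    + lra.
    + right; ring.
Qed.

(** The translations [r k] are meant to bring the k-th image of one chosen arc into the fundamental
    domain. On that arc this agrees with the iterate of [F], but it is differentiable on the whole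
    line, including the ends of the arc, where the iterate itself may break. *)
Fixpoint model_iter (E : R -> R) (r : nat -> Z) (n : nat) (x : R) : R :=
  match n with O => x | S k => E (model_iter E r k x - IZR (r k)) + IZR (r k) end.

Fixpoint model_deriv (E D : R -> R) (r : nat -> Z) (n : nat) (x : R) : R :=
  match n with O => 1 | S k => D (model_iter E r k x - IZR (r k)) * model_deriv E D r k x end.

Lemma model_iter_derive (E D : R -> R) (r : nat -> Z) (n : nat) (x : R) :
  (forall x, is_derive E x (D x)) -> is_derive (model_iter E r n) x (model_deriv E D r n x).
Proof.
  intros hE. revert x. induction n as [|n IH]; intros x.
  - simpl. apply (@is_derive_id R_AbsRing).
  - simpl. rewrite <- (Rplus_0_r (_ * _)).
    apply (is_derive_plus (fun x => E (model_iter E r n x - IZR (r n))) (fun _ => IZR (r n)));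
      [|apply (@is_derive_const R_AbsRing R_NormedModule)].
    rewrite Rmult_comm.
    apply (is_derive_comp E (fun x => model_iter E r n x - IZR (r n))); [apply hE|].
    rewrite <- (Rminus_0_r (model_deriv E D r n x)).
    apply (is_derive_minus (model_iter E r n) (fun _ => IZR (r n))); [apply IH|].
    apply (@is_derive_const R_AbsRing R_NormedModule).
Qed.

Lemma model_deriv_continuous (E D : R -> R) (r : nat -> Z) (n : nat) (x : R) :
  (forall x, is_derive E x (D x)) -> (forall x, continuous D x) -> continuous (model_deriv E D r n) x.
Proof.
  intros hE hD. revert x. induction n as [|n IH]; intros x; simpl.
  - apply continuous_const.
  - apply (continuous_mult (fun x => D (model_iter E r n x - IZR (r n))) (model_deriv E D r n)); [|apply IH].
    apply (continuous_comp (fun x => model_iter E r n x - IZR (r n)) D); [|apply hD].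
    apply (continuous_minus (model_iter E r n) (fun _ => IZR (r n))); [|apply continuous_const].
    apply (ex_derive_continuous (model_iter E r n)). eexists. now apply model_iter_derive.
Qed.

(* The arcs [F^i [s0, e0]], [i < N], translated by [- r i] into the fundamental domain, have
   disjoint interiors and small length. *)
Record short_arcs (F : R -> R) (xi0 g L eta : R) (s0 e0 : R) (N : nat) (r : nat -> Z) : Prop := {
  sa_ne : s0 <> e0;
  sa_s : forall i, (i < N)%nat -> xi0 <= Nat.iter i F s0 - IZR (r i) <= xi0 + 1;
  sa_e : forall i, (i < N)%nat -> xi0 <= Nat.iter i F e0 - IZR (r i) <= xi0 + 1;
  sa_disj : forall i j, (i < j < N)%nat ->
    Rmax (Nat.iter i F s0) (Nat.iter i F e0) - IZR (r i) <= Rmin (Nat.iter j F s0) (Nat.iter j F e0) - IZR (r j) \/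
    Rmax (Nat.iter j F s0) (Nat.iter j F e0) - IZR (r j) <= Rmin (Nat.iter i F s0) (Nat.iter i F e0) - IZR (r i);
  sa_len : forall i, (i < N)%nat -> Rabs (Nat.iter i F e0 - Nat.iter i F s0) <= L;
  sa_Zg : forall t, 0 < t <= L -> Zg g t <= eta;
  sa_sqrt : sqrt L <= eta }.

Lemma iter_between (F : R -> R) (s e x : R) (i : nat) : circle_homeo_lift F ->
  Rmin s e <= x <= Rmax s e ->
  Rmin (Nat.iter i F s) (Nat.iter i F e) <= Nat.iter i F x <= Rmax (Nat.iter i F s) (Nat.iter i F e).
Proof.
  intros hF hx. unfold Rmin, Rmax in hx. destruct (Rle_dec s e) as [h|h].
  - assert (h' := iter_le F hF i s e h). rewrite Rmin_left, Rmax_right by lra.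
    split; apply iter_le; auto; lra.
  - assert (h' := iter_le F hF i e s ltac:(lra)). rewrite Rmin_right, Rmax_left by lra.
    split; apply iter_le; auto; lra.
Qed.

Lemma model_iter_eq (F Df : R -> R) (xi0 : R) (E D : R -> R) (m M g L eta s0 e0 : R) (N : nat) (r : nat -> Z) :
  smooth_model F Df xi0 E D m M -> circle_homeo_lift F -> short_arcs F xi0 g L eta s0 e0 N r ->
  forall n x, (n <= N)%nat -> Rmin s0 e0 <= x <= Rmax s0 e0 -> model_iter E r n x = Nat.iter n F x.
Proof.
  intros sm hF sa. induction n as [|n IH]; intros x hn hx; [reflexivity|].
  simpl. rewrite IH by (try lia; assumption).
  assert (b := iter_between F s0 e0 x n hF hx).
  assert (a1 := sa_s _ _ _ _ _ _ _ _ _ sa n ltac:(lia)).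
  assert (a2 := sa_e _ _ _ _ _ _ _ _ _ sa n ltac:(lia)).
  rewrite (sm_E _ _ _ _ _ _ _ sm).
  - rewrite <- lift_IZR by assumption. f_equal; ring.
  - revert b. unfold Rmin, Rmax. destruct (Rle_dec _ _); lra.
Qed.

(** A telescoping product of difference quotients. Secants, unlike slopes, cover [x = y], so the
    relative coordinates 0 and 1 need no separate treatment. *)
Lemma secant_chain (F Df : R -> R) (xi0 : R) (E D : R -> R) (m M : R) (x y : R) (N : nat) (r : nat -> Z) :
  smooth_model F Df xi0 E D m M -> circle_homeo_lift F ->
  (forall i, (i < N)%nat -> xi0 <= Nat.iter i F x - IZR (r i) <= xi0 + 1) ->
  (forall i, (i < N)%nat -> xi0 <= Nat.iter i F y - IZR (r i) <= xi0 + 1) ->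
  Nat.iter N F y - Nat.iter N F x =
  exp (sum_lt N (fun i => ln (secant E D (Nat.iter i F x - IZR (r i)) (Nat.iter i F y - IZR (r i))))) * (y - x).
Proof.
  intros sm hF hx hy. induction N as [|N IH]; [simpl; rewrite exp_0; ring|].
  cbn [sum_lt]. rewrite exp_plus.
  assert (a1 := hx N ltac:(lia)). assert (a2 := hy N ltac:(lia)).
  set (u := Nat.iter N F x) in *. set (v := Nat.iter N F y) in *.
  rewrite exp_ln.
  - transitivity (secant E D (u - IZR (r N)) (v - IZR (r N)) * (v - u)).
    + replace (v - u) with ((v - IZR (r N)) - (u - IZR (r N))) by ring.
      rewrite <- secant_mul. rewrite !(sm_E _ _ _ _ _ _ _ sm) by assumption.
      replace (Nat.iter (S N) F y) with (F ((v - IZR (r N)) + IZR (r N)))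
        by (simpl; unfold v; f_equal; ring).
      replace (Nat.iter (S N) F x) with (F ((u - IZR (r N)) + IZR (r N)))
        by (simpl; unfold u; f_equal; ring).
      rewrite !lift_IZR by assumption. ring.
    + rewrite IH by (intros; first [apply hx; lia | apply hy; lia]). ring.
  - destruct (secant_MVT E D (u - IZR (r N)) (v - IZR (r N))) as [c [_ ec]];
      [apply (sm_derive _ _ _ _ _ _ _ sm)|].
    rewrite ec. generalize (sm_bd _ _ _ _ _ _ _ sm c) (sm_m _ _ _ _ _ _ _ sm). lra.
Qed.

Lemma model_deriv_exp (F Df : R -> R) (xi0 : R) (E D : R -> R) (m M : R) (n : nat) (r : nat -> Z) (x : R) :
  smooth_model F Df xi0 E D m M ->
  model_deriv E D r n x = exp (sum_lt n (fun i => ln (D (model_iter E r i x - IZR (r i))))).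
Proof.
  intros sm. induction n as [|n IH]; simpl; [now rewrite exp_0|].
  rewrite exp_plus, IH, exp_ln; [ring|].
  generalize (sm_bd _ _ _ _ _ _ _ sm (model_iter E r n x - IZR (r n))) (sm_m _ _ _ _ _ _ _ sm). lra.
Qed.

(** For a smooth map with [b i] an endpoint derivative, this approximates -1/2 times the integral of
    f''/f' over the arcs. *)
Definition nonlinearity_sum (F D : R -> R) (s0 e0 : R) (N : nat) (r : nat -> Z) (b : nat -> R) : R :=
  sum_lt N (fun i => (D (Nat.iter i F s0 - IZR (r i)) - D (Nat.iter i F e0 - IZR (r i))) / (2 * b i)).

Lemma transfer (F Df : R -> R) (xi0 : R) (E D : R -> R) (C g m M V : R) :
  smooth_model F Df xi0 E D m M -> circle_homeo_lift F -> zygmund_model xi0 C g m M E D ->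
  variation_le xi0 (xi0 + 1) D V ->
  exists K K1, 0 < K /\ 0 < K1 /\ forall L eta s0 e0 N r b sg,
    short_arcs F xi0 g L eta s0 e0 N r -> K1 * eta <= 1 ->
    (forall i, (i < N)%nat -> b i = D (Nat.iter i F s0 - IZR (r i)) \/ b i = D (Nat.iter i F e0 - IZR (r i))) ->
    0 <= sg <= 1 ->
    let x := s0 + sg * (e0 - s0) in
    let mu := exp (nonlinearity_sum F D s0 e0 N r b) in
    let len := Nat.iter N F e0 - Nat.iter N F s0 in
    Rabs ((model_iter E r N x - Nat.iter N F s0) / len - mu * sg / (mu * sg + (1 - sg))) <= K * eta /\
    Rabs (model_deriv E D r N x * (e0 - s0) / len
          - mu / ((mu * sg + (1 - sg)) * (mu * sg + (1 - sg)))) <= K * eta.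
Proof.
  intros sm hF zm hV.
  destruct (cross_ratio_estimates xi0 C g m M E D zm) as [K1 [hK1 hcr]].
  assert (hm := sm_m _ _ _ _ _ _ _ sm). assert (hbd := sm_bd _ _ _ _ _ _ _ sm).
  (* [Q] bounds [mu] and its inverse: the translated arcs are disjoint, so the nonlinearity sum is
     at most the variation of [D] divided by 2 m. *)
  set (Q := exp (V * / (2 * m))).
  exists (4 * Q * Q * Q * exp 4 * K1), K1.
  assert (hQ0 : 0 < Q) by apply exp_pos. assert (e4 := exp_pos 4).
  split; [repeat apply Rmult_lt_0_compat; lra|]. split; [assumption|].
  intros L eta s0 e0 N r b sg sa hsm hb hsg x mu len.
  assert (sa' := sa). destruct sa' as [ne hs he hdj hlen hZ hsq].
  set (s := fun i => Nat.iter i F s0 - IZR (r i)) in *.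
  set (e := fun i => Nat.iter i F e0 - IZR (r i)) in *.
  set (y := fun i => Nat.iter i F x - IZR (r i)).
  assert (hx : Rmin s0 e0 <= x <= Rmax s0 e0).
  { unfold x, Rmin, Rmax. destruct (Rle_dec s0 e0); nra. }
  assert (hy : forall i, Rmin (s i) (e i) <= y i <= Rmax (s i) (e i)).
  { intros i. assert (hh := iter_between F s0 e0 x i hF hx). revert hh. unfold s, e, y, Rmin, Rmax.
    destruct (Rle_dec (Nat.iter i F s0) (Nat.iter i F e0)), (Rle_dec (_ - _) (_ - _)); lra. }
  assert (hyI : forall i, (i < N)%nat -> xi0 <= y i <= xi0 + 1).
  { intros i hi. generalize (hy i) (hs i hi) (he i hi). fold (s i) (e i).
    unfold Rmin, Rmax. destruct (Rle_dec (s i) (e i)); lra. }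
  assert (heta : 0 <= eta) by (eapply Rle_trans; [apply sqrt_pos|exact hsq]).
  assert (ab : forall i, Rabs (e i - s i) = Rabs (Nat.iter i F e0 - Nat.iter i F s0)).
  { intros i. f_equal. unfold e, s. ring. }
  assert (ds : forall gg V, variation_le xi0 (xi0 + 1) gg V -> sum_lt N (fun i => Rabs (gg (e i) - gg (s i))) <= V).
  { intros gg V' hV'.
    apply (disjoint_sum gg xi0 (xi0 + 1) V' N (fun i => Rmin (s i) (e i)) (fun i => Rmax (s i) (e i)));
      [assumption|lra| | |].
    - intros i hi. generalize (hs i hi) (he i hi). fold (s i) (e i).
      unfold Rmin, Rmax. destruct (Rle_dec (s i) (e i)); lra.
    - intros i j hij. generalize (hdj i j hij). unfold s, e, Rmin, Rmax.
      repeat destruct (Rle_dec _ _); lra.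
    - intros i hi. unfold Rmin, Rmax. destruct (Rle_dec (s i) (e i)); lra. }
  assert (hlen1 : sum_lt N (fun i => Rabs (e i - s i)) <= 1).
  { replace 1 with (xi0 + 1 - xi0) at 1 by ring. apply (ds (fun x => x)). apply variation_id. lra. }
  set (LR := sum_lt N (fun i => ln (secant E D (s i) (y i)))).
  set (LS := sum_lt N (fun i => ln (secant E D (y i) (e i)))).
  set (LT := sum_lt N (fun i => ln (secant E D (s i) (e i)))).
  set (LG := sum_lt N (fun i => ln (D (y i)))).
  set (lm := nonlinearity_sum F D s0 e0 N r b) in *.
  assert (sp : forall u v, 0 < secant E D u v).
  { intros u v. destruct (secant_MVT E D u v (sm_derive _ _ _ _ _ _ _ sm)) as [c [_ ec]].
    rewrite ec. generalize (hbd c). lra. }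
  assert (Dp : forall u, 0 < D u) by (intros u; generalize (hbd u); lra).
  assert (hcr' : forall i, (i < N)%nat ->
    Rabs (ln (secant E D (s i) (y i)) - ln (secant E D (y i) (e i)) - (D (s i) - D (e i)) / (2 * b i))
      <= K1 * (Rabs (e i - s i) * eta) /\
    Rabs (ln (D (y i)) + ln (secant E D (s i) (e i)) - (ln (secant E D (s i) (y i)) + ln (secant E D (y i) (e i))))
      <= K1 * (Rabs (e i - s i) * eta)).
  { intros i hi. destruct (hcr (s i) (y i) (e i) eta (hs i hi) (he i hi) (hy i)) as [c1 c2].
    - intros t ht. rewrite ab in ht. apply hZ. specialize (hlen i hi). lra.
    - rewrite ab. eapply Rle_trans; [|exact hsq]. apply sqrt_le_1_alt. now apply hlen.
    - split; [apply c1; now apply hb|]. rewrite !ln_mult in c2 by auto. exact c2. }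
  assert (sumK : sum_lt N (fun i => K1 * (Rabs (e i - s i) * eta)) <= K1 * eta).
  { rewrite (sum_lt_ext N _ (fun i => (K1 * eta) * Rabs (e i - s i))) by (intros; ring).
    rewrite sum_lt_scal. rewrite <- (Rmult_1_r (K1 * eta)) at 2.
    apply Rmult_le_compat_l; [apply Rmult_le_pos; lra|assumption]. }
  assert (sub : forall f h : nat -> R, sum_lt N f - sum_lt N h = sum_lt N (fun i => f i - h i)).
  { intros f h. rewrite (sum_lt_ext N (fun i => f i - h i) (fun i => f i + (-1) * h i)) by (intros; ring).
    rewrite sum_lt_plus, sum_lt_scal. ring. }
  assert (T1 : Rabs (LR - LS - lm) <= K1 * eta).
  { unfold LR, LS, lm, nonlinearity_sum. rewrite !sub.
    eapply Rle_trans; [apply sum_lt_abs|]. eapply Rle_trans; [|exact sumK].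
    apply sum_lt_le. intros i hi. apply (proj1 (hcr' i hi)). }
  assert (T2 : Rabs (LG + LT - (LR + LS)) <= K1 * eta).
  { unfold LG, LT, LR, LS. rewrite <- !sum_lt_plus, sub.
    eapply Rle_trans; [apply sum_lt_abs|]. eapply Rle_trans; [|exact sumK].
    apply sum_lt_le. intros i hi. apply (proj2 (hcr' i hi)). }
  assert (hlm : Rabs lm <= V * / (2 * m)).
  { unfold lm, nonlinearity_sum. eapply Rle_trans; [apply sum_lt_abs|].
    apply Rle_trans with (sum_lt N (fun i => / (2 * m) * Rabs (D (e i) - D (s i)))).
    - apply sum_lt_le. intros i hi. fold (s i) (e i).
      assert (hbm : m <= b i) by (destruct (hb i hi) as [-> | ->]; apply hbd).
      unfold Rdiv. rewrite Rabs_mult, Rmult_comm, Rabs_minus_sym. apply Rmult_le_compat_r; [apply Rabs_pos|].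
      rewrite Rabs_pos_eq by (left; apply Rinv_0_lt_compat; lra). apply Rinv_le_contravar; lra.
    - rewrite sum_lt_scal, Rmult_comm. apply Rmult_le_compat_r; [left; apply Rinv_0_lt_compat; lra|].
      now apply ds. }
  assert (hV0 : 0 <= V * / (2 * m)) by (eapply Rle_trans; [apply Rabs_pos|exact hlm]).
  apply Rabs_le_between in hlm.
  assert (hQ : 1 <= Q) by (rewrite <- exp_0 at 1; apply exp_le; lra).
  assert (hmu : / Q <= mu <= Q).
  { unfold mu, Q. rewrite <- exp_Ropp. split; apply exp_le; lra. }
  destruct (mobius_close Q mu sg (LR - LS - lm) (LG + LT - (LR + LS)) (K1 * eta)) as [m1 m2]; auto.
  set (Mm := mu * exp (LR - LS - lm)) in *.
  assert (eM : Mm = exp (LR - LS)) by (replace (LR - LS) with (lm + (LR - LS - lm)) by ring; rewrite exp_plus; reflexivity).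
  assert (c1 := secant_chain F Df xi0 E D m M s0 x N r sm hF hs hyI).
  assert (c2 := secant_chain F Df xi0 E D m M x e0 N r sm hF hyI he).
  assert (c3 := secant_chain F Df xi0 E D m M s0 e0 N r sm hF hs he).
  fold LR in c1. fold LS in c2. fold LT in c3. fold len in c3.
  change (Nat.iter N F x - Nat.iter N F s0 = exp LR * (x - s0)) in c1.
  change (Nat.iter N F e0 - Nat.iter N F x = exp LS * (e0 - x)) in c2.
  change (len = exp LT * (e0 - s0)) in c3.
  assert (ex1 : x - s0 = sg * (e0 - s0)) by (unfold x; ring).
  assert (ex2 : e0 - x = (1 - sg) * (e0 - s0)) by (unfold x; ring).
  (* The final chord is the sum of its two parts. Divided by [exp LS], this identifies the Moebius
     denominator with a quotient of chord slopes. *)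
  assert (hT : exp LT = exp LR * sg + exp LS * (1 - sg)).
  { apply Rmult_eq_reg_r with (e0 - s0); [|lra].
    rewrite <- c3. unfold len.
    replace (Nat.iter N F e0 - Nat.iter N F s0)
      with ((Nat.iter N F x - Nat.iter N F s0) + (Nat.iter N F e0 - Nat.iter N F x)) by ring.
    rewrite c1, c2, ex1, ex2. ring. }
  assert (pR := exp_pos LR). assert (pS := exp_pos LS). assert (pT := exp_pos LT).
  assert (ed : Mm * sg + (1 - sg) = exp LT / exp LS).
  { rewrite eM, hT. unfold Rminus at 1. rewrite exp_plus, exp_Ropp. field. lra. }
  assert (hne : e0 - s0 <> 0) by lra.
  split.
  - replace ((model_iter E r N x - Nat.iter N F s0) / len) with (Mm * sg / (Mm * sg + (1 - sg))).
    + eapply Rle_trans; [exact m1|]. right; ring.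
    + rewrite ed, (model_iter_eq F Df xi0 E D m M g L eta s0 e0 N r sm hF sa N x (Nat.le_refl _) hx).
      rewrite c1, c3, ex1, eM. unfold Rminus at 1. rewrite exp_plus, exp_Ropp. field. repeat split; lra.
  (* The derivative in relative coordinates is [exp (LG - LT)]. It splits into the Moebius
     derivative with multiplier [Mm] and the deviation [exp (LG + LT - (LR + LS))], which would be 1
     for a Moebius map. *)
  - replace (model_deriv E D r N x * (e0 - s0) / len) with
      (exp (LG + LT - (LR + LS)) * Mm / ((Mm * sg + (1 - sg)) * (Mm * sg + (1 - sg)))).
    + eapply Rle_trans; [exact m2|]. right; ring.
    + rewrite ed, (model_deriv_exp F Df xi0 E D m M N r x sm).
      rewrite (sum_lt_ext N (fun i => ln (D (model_iter E r i x - IZR (r i)))) (fun i => ln (D (y i)))).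
      * fold LG. rewrite c3, eM. unfold Rminus. rewrite Ropp_plus_distr, !exp_plus, !exp_Ropp. field.
        repeat split; lra.
      * intros i hi. rewrite (model_iter_eq F Df xi0 E D m M g L eta s0 e0 N r sm hF sa i x ltac:(lia) hx).
        reflexivity.
Qed.

(** * Renormalization data in terms of a normalized lift *)

(* [G] is an integer translate of [F], chosen so that its translation number is [rho] itself. *)
Record normalized (F G : R -> R) (rho : R) : Prop := {
  nm_lift : irrational_lift G rho;
  nm_iter : forall n x, exists p, Nat.iter n F x = Nat.iter n G x + IZR p }.

Lemma normalize_break_diffeo (F Df : R -> R) (xi0 : R) (k : Z) :
  break_diffeo F Df xi0 -> break_diffeo (fun x => F x + IZR k) Df xi0.
Proof.
  intros [[h1 [h2 h3]] [hd hrest]]. split; [|split; [|exact hrest]].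
  - repeat split.
    + intros x. apply (continuity_pt_plus F (fun _ => IZR k)); [apply h1|].
      apply continuity_pt_const. intros a b; reflexivity.
    + intros x y h. specialize (h2 x y h). lra.
    + intros x. rewrite h3. ring.
  - intros x hx. specialize (hd x hx). unfold is_deriv_within in *.
    eapply filterlim_ext; [|exact hd]. intros y. simpl. f_equal. ring.
Qed.

Lemma normalize_iter (F : R -> R) (k : Z) (n : nat) (x : R) : circle_homeo_lift F ->
  Nat.iter n (fun x => F x + IZR k) x = Nat.iter n F x + IZR (k * Z.of_nat n).
Proof.
  intros hF. induction n as [|n IH].
  - simpl. rewrite Z.mul_0_r. ring.
  - simpl Nat.iter. rewrite IH, lift_IZR by assumption.
    rewrite Nat2Z.inj_succ, Z.mul_succ_r, plus_IZR. ring.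
Qed.

Lemma normalization_exists (F Df : R -> R) (xi0 rho : R) :
  break_diffeo F Df xi0 -> rotation_number F rho -> irrational rho ->
  exists G, normalized F G rho /\ break_diffeo G Df xi0.
Proof.
  intros hb [hr [k hk]] hi. assert (hF : circle_homeo_lift F) by apply hb.
  exists (fun x => F x + IZR (- k)).
  assert (hb' := normalize_break_diffeo F Df xi0 (- k) hb).
  split; [|assumption]. constructor; [constructor; auto; [apply hb'|]|].
  - unfold translation_number.
    replace rho with ((rho + IZR k) + - IZR k) by ring.
    apply is_lim_seq_ext_loc with (fun n => Nat.iter n F 0 / INR n + - IZR k).
    + exists 1%nat. intros n hn. rewrite normalize_iter, mult_IZR, opp_IZR, <- INR_IZR_INZ by assumption.
      field. apply not_0_INR. lia.
    + apply is_lim_seq_plus'; [exact hk|apply is_lim_seq_const].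
  - intros n x. exists (k * Z.of_nat n)%Z.
    rewrite normalize_iter, !mult_IZR, opp_IZR by assumption. ring.
Qed.

Lemma Int_part_unique (x : R) (p : Z) : IZR p <= x < IZR p + 1 -> Int_part x = p.
Proof. intros h. symmetry. apply Int_part_spec. lra. Qed.

Lemma frac_part_shift (x : R) (p : Z) : 0 <= x < 1 -> Defs.frac_part (x + IZR p) = x.
Proof. intros h. unfold Defs.frac_part. rewrite (Int_part_unique _ p) by lra. ring. Qed.

Lemma arclen_shift (a b : R) (p r : Z) : 0 <= b - a < 1 -> arclen (a + IZR p) (b + IZR r) = b - a.
Proof.
  intros h. unfold arclen. replace (b + IZR r - (a + IZR p)) with ((b - a) + IZR (r - p))
    by (rewrite minus_IZR; ring). now apply frac_part_shift.
Qed.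

Lemma lpos_shift (xi0 a : R) (p : Z) : lpos xi0 (a + IZR p) = a - IZR (Int_part (a - xi0)).
Proof.
  unfold lpos, arclen. destruct (base_Int_part (a - xi0)) as [b1 b2].
  set (r := Int_part (a - xi0)) in *.
  replace (a + IZR p - xi0) with ((a - xi0 - IZR r) + IZR (r + p)) by (rewrite plus_IZR; ring).
  rewrite frac_part_shift by lra. ring.
Qed.

Definition return_point (G : R -> R) (rho xi0 : R) (n : nat) : R := first_return G rho n xi0.

(** The translation is fixed by the left end of the arc, which lands in [xi0, xi0 + 1); a right end
    on a translate of [xi0] can then land on xi0 + 1. The values of [Df] at both ends are thus
    derivatives from inside the arc. *)
Definition arc_shift (G : R -> R) (rho xi0 : R) (n i : nat) : Z :=
  Int_part (Rmin (Nat.iter i G xi0) (Nat.iter i G (return_point G rho xi0 n)) - xi0).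

Lemma iter_first_return (G : R -> R) (rho x : R) (n i : nat) : irrational_lift G rho ->
  Nat.iter i G (first_return G rho n x) = first_return G rho n (Nat.iter i G x).
Proof.
  intros hG. unfold first_return, shift_iter. rewrite iter_IZR by apply hG.
  now rewrite iter_comm.
Qed.

Lemma arc_even (G : R -> R) (rho xi0 : R) (n i : nat) : irrational_lift G rho -> Nat.even n = true ->
  Nat.iter i G xi0 < Nat.iter i G (return_point G rho xi0 n) < Nat.iter i G xi0 + 1.
Proof.
  intros hG hn. unfold return_point. rewrite iter_first_return by assumption.
  now apply first_return_even.
Qed.

Lemma arc_odd (G : R -> R) (rho xi0 : R) (n i : nat) : irrational_lift G rho -> Nat.even n = false ->
  Nat.iter i G xi0 - 1 < Nat.iter i G (return_point G rho xi0 n) < Nat.iter i G xi0.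
Proof.
  intros hG hn. unfold return_point. rewrite iter_first_return by assumption.
  now apply first_return_odd.
Qed.

Lemma orb_shift (F G : R -> R) (rho xi0 : R) (n i : nat) : normalized F G rho ->
  (exists p, orb F xi0 i = Nat.iter i G xi0 + IZR p) /\
  (exists p, orb F xi0 (i + q rho n) = Nat.iter i G (return_point G rho xi0 n) + IZR p).
Proof.
  intros [hG hit]. split; [apply hit|].
  destruct (hit (i + q rho n)%nat xi0) as [p hp]. exists (pnum rho n + p)%Z.
  unfold orb. rewrite hp. unfold return_point, first_return, shift_iter.
  rewrite iter_IZR by apply hG. rewrite iter_plus, opp_IZR, plus_IZR. ring.
Qed.

Lemma seglen_eq (F G : R -> R) (rho xi0 : R) (n i : nat) : normalized F G rho ->
  seglen F xi0 rho n i = Rabs (Nat.iter i G (return_point G rho xi0 n) - Nat.iter i G xi0).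
Proof.
  intros nm. destruct (orb_shift F G rho xi0 n i nm) as [[p hp] [r hr]].
  unfold seglen, seg_left, seg_right. rewrite hp, hr. assert (hG := nm_lift _ _ _ nm).
  destruct (Nat.even n) eqn:hn.
  - assert (h := arc_even G rho xi0 n i hG hn). rewrite Rabs_pos_eq by lra. apply arclen_shift. lra.
  - assert (h := arc_odd G rho xi0 n i hG hn). rewrite Rabs_left by lra. rewrite arclen_shift; lra.
Qed.

Lemma Dstart_eq (F G Df : R -> R) (rho xi0 : R) (n i : nat) : normalized F G rho ->
  Dstart F Df xi0 rho n i = Df (Nat.iter i G xi0 - IZR (arc_shift G rho xi0 n i)).
Proof.
  intros nm. destruct (orb_shift F G rho xi0 n i nm) as [[p hp] [r hr]].
  unfold Dstart, rpos, arc_shift. rewrite hp, hr. assert (hG := nm_lift _ _ _ nm).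
  destruct (Nat.even n) eqn:hn; f_equal.
  - assert (h := arc_even G rho xi0 n i hG hn). rewrite Rmin_left by lra. apply lpos_shift.
  - assert (h := arc_odd G rho xi0 n i hG hn). rewrite Rmin_right by lra.
    rewrite lpos_shift, arclen_shift; lra.
Qed.

Lemma Dend_eq (F G Df : R -> R) (rho xi0 : R) (n i : nat) : normalized F G rho ->
  Dend F Df xi0 rho n i = Df (Nat.iter i G (return_point G rho xi0 n) - IZR (arc_shift G rho xi0 n i)).
Proof.
  intros nm. destruct (orb_shift F G rho xi0 n i nm) as [[p hp] [r hr]].
  unfold Dend, rpos, arc_shift. rewrite hp, hr. assert (hG := nm_lift _ _ _ nm).
  destruct (Nat.even n) eqn:hn; f_equal.
  - assert (h := arc_even G rho xi0 n i hG hn). rewrite Rmin_left by lra.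
    rewrite lpos_shift, arclen_shift; lra.
  - assert (h := arc_odd G rho xi0 n i hG hn). rewrite Rmin_right by lra. apply lpos_shift.
Qed.

(** No image of the arc has a translate of [xi0] in its interior, so once the left end is in the
    fundamental domain the right end is at most xi0 + 1. The map f_n needs the arc of level n-1 up
    to time q_n; g_n needs the arc of level n, but only up to time q_{n-1}. *)
Lemma fundamental_short_arcs (G : R -> R) (rho xi0 g L eta : R) (n N : nat) :
  irrational_lift G rho -> (N <= q rho (S n))%nat ->
  (forall x, Rabs (first_return G rho n x - x) <= L) ->
  (forall t, 0 < t <= L -> Zg g t <= eta) -> sqrt L <= eta ->
  short_arcs G xi0 g L eta xi0 (return_point G rho xi0 n) N (arc_shift G rho xi0 n).
Proof.
  intros hG hN hL hZ hs.
  assert (hI : forall i, (i < N)%nat ->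
    xi0 <= Rmin (Nat.iter i G xi0) (Nat.iter i G (return_point G rho xi0 n)) - IZR (arc_shift G rho xi0 n i) /\
    Rmax (Nat.iter i G xi0) (Nat.iter i G (return_point G rho xi0 n)) - IZR (arc_shift G rho xi0 n i) <= xi0 + 1).
  { intros i hi. unfold arc_shift.
    set (z := Rmin (Nat.iter i G xi0) (Nat.iter i G (return_point G rho xi0 n))).
    destruct (base_Int_part (z - xi0)) as [b1 b2]. set (r := Int_part (z - xi0)) in *.
    split; [lra|]. destruct (Nat.even n) eqn:hn.
    - assert (h := arc_even G rho xi0 n i hG hn). unfold z in *. rewrite Rmin_left in b1, b2 by lra.
      rewrite Rmax_right by lra.
      destruct (first_return_avoids_even G rho n i xi0 (r + 1)%Z hG hn ltac:(lia)) as [k|k];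
        rewrite plus_IZR in k; unfold return_point in *; lra.
    - assert (h := arc_odd G rho xi0 n i hG hn). unfold z in *. rewrite Rmin_right in b1, b2 by lra.
      rewrite Rmax_left by lra.
      destruct (first_return_avoids_odd G rho n i xi0 (r + 1)%Z hG hn ltac:(lia)) as [k|k];
        rewrite plus_IZR in k; unfold return_point in *; lra. }
  constructor; try assumption.
  - destruct (Nat.even n) eqn:hn.
    + generalize (first_return_even G rho n xi0 hG hn). unfold return_point. lra.
    + generalize (first_return_odd G rho n xi0 hG hn). unfold return_point. lra.
  - intros i hi. destruct (hI i hi) as [k1 k2]. revert k1 k2. unfold Rmin, Rmax.
    destruct (Rle_dec _ _); lra.
  - intros i hi. destruct (hI i hi) as [k1 k2]. revert k1 k2. unfold Rmin, Rmax.
    destruct (Rle_dec _ _); lra.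
  - intros i j hij. set (ri := arc_shift G rho xi0 n i). set (rj := arc_shift G rho xi0 n j).
    destruct (Nat.even n) eqn:hn.
    + assert (h := arc_even G rho xi0 n i hG hn). assert (h' := arc_even G rho xi0 n j hG hn).
      rewrite !Rmin_left, !Rmax_right by lra.
      destruct (first_return_disjoint_even G rho n xi0 hG hn i j ltac:(lia) ltac:(lia) ltac:(lia) (ri - rj)%Z) as [k|k];
        rewrite minus_IZR in k; unfold return_point in *; [left|right]; lra.
    + assert (h := arc_odd G rho xi0 n i hG hn). assert (h' := arc_odd G rho xi0 n j hG hn).
      rewrite !Rmin_right, !Rmax_left by lra.
      destruct (first_return_disjoint_odd G rho n xi0 hG hn i j ltac:(lia) ltac:(lia) ltac:(lia) (ri - rj)%Z) as [k|k];
        rewrite minus_IZR in k; unfold return_point in *; [left|right]; lra.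
  - intros i _. unfold return_point. rewrite iter_first_return by assumption. apply hL.
Qed.

(** Consecutive returns lie on opposite sides of [xi0]. Writing quotients of lengths as signed
    quotients gives the parameters a_n and b_n one formula for both parities. *)
Lemma opposite_returns (G : R -> R) (rho xi0 : R) (l : nat) : irrational_lift G rho ->
  let d := return_point G rho xi0 l - xi0 in
  let d' := return_point G rho xi0 (S l) - xi0 in
  d <> 0 /\ d' <> 0 /\ Rabs d' / Rabs d = - d' / d /\ 0 < - d' / d /\
  let w := first_return G rho (S l) (return_point G rho xi0 l) in
  Rabs (w - return_point G rho xi0 l) / Rabs d = - (w - return_point G rho xi0 l) / d /\
  0 < (w - xi0) / d < 1.
Proof.
  intros hG d d'.
  assert (key : forall a b, (0 < a /\ b < 0) \/ (a < 0 /\ 0 < b) -> Rabs b / Rabs a = - b / a /\ 0 < - b / a).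
  { intros a b [[h1 h2]|[h1 h2]].
    - rewrite (Rabs_left b), (Rabs_pos_eq a) by lra. split; [reflexivity|]. apply Rdiv_lt_0_compat; lra.
    - rewrite (Rabs_left a), (Rabs_pos_eq b) by lra. split; [field; lra|].
      replace (- b / a) with (b / - a) by (field; lra). apply Rdiv_lt_0_compat; lra. }
  destruct (Nat.even l) eqn:hl.
  - assert (a1 := first_return_even G rho l xi0 hG hl).
    assert (a2 := first_return_odd G rho (S l) xi0 hG (even_S_true l hl)).
    assert (a3 := first_return_odd G rho (S l) (first_return G rho l xi0) hG (even_S_true l hl)).
    assert (a4 := first_return_twice_even G rho l xi0 hG hl).
    unfold return_point in *.
    destruct (key d d') as [k1 k2]; [left; unfold d, d', return_point; lra|].
    repeat split; try assumption; try (unfold d, d', return_point; lra).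
    + apply key. left. unfold d, return_point. lra.
    + apply Rdiv_lt_0_compat; unfold d, return_point; lra.
    + apply Rmult_lt_reg_r with d; [unfold d, return_point; lra|].
      unfold Rdiv. rewrite Rmult_assoc, Rinv_l by (unfold d, return_point; lra). unfold d, return_point; lra.
  - assert (a1 := first_return_odd G rho l xi0 hG hl).
    assert (a2 := first_return_even G rho (S l) xi0 hG (even_S_false l hl)).
    assert (a3 := first_return_even G rho (S l) (first_return G rho l xi0) hG (even_S_false l hl)).
    assert (a4 := first_return_twice_odd G rho l xi0 hG hl).
    unfold return_point in *.
    destruct (key d d') as [k1 k2]; [right; unfold d, d', return_point; lra|].
    repeat split; try assumption; try (unfold d, d', return_point; lra).
    + apply key. right. unfold d, return_point. lra.
    + match goal with |- 0 < ?w / _ => replace (w / d) with ((- w) / (- d)) by (field; unfold d, return_point; lra) end.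
      apply Rdiv_lt_0_compat; unfold d, return_point; lra.
    + match goal with |- ?w / _ < 1 => replace (w / d) with ((- w) / (- d)) by (field; unfold d, return_point; lra) end.
      apply Rmult_lt_reg_r with (- d); [unfold d, return_point; lra|].
      unfold Rdiv. rewrite Rmult_assoc, Rinv_l by (unfold d, return_point; lra). unfold d, return_point; lra.
Qed.

Lemma sgn_seglen (F G : R -> R) (rho xi0 : R) (l : nat) : normalized F G rho ->
  sgn l * seglen F xi0 rho l 0 = - (return_point G rho xi0 l - xi0).
Proof.
  intros nm. rewrite (seglen_eq F G) by assumption. simpl Nat.iter. assert (hG := nm_lift _ _ _ nm).
  unfold sgn. destruct (Nat.even l) eqn:hl.
  - assert (h := arc_even G rho xi0 l 0 hG hl). simpl in h. rewrite Rabs_pos_eq by lra. ring.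
  - assert (h := arc_odd G rho xi0 l 0 hG hl). simpl in h. rewrite Rabs_left by lra. ring.
Qed.

Lemma Ainv_eq (F G : R -> R) (rho xi0 w : R) (l : nat) (p : Z) : normalized F G rho ->
  let e := return_point G rho xi0 l in
  let e' := return_point G rho xi0 (S l) in
  Rmin e e' <= w < Rmin e e' + 1 ->
  Ainv F xi0 rho (S l) (w + IZR p) = - (w - xi0) / (e - xi0).
Proof.
  intros nm e e' hw. unfold Ainv. replace (S l - 1)%nat with l by lia.
  rewrite (sgn_seglen F G) by assumption. fold e.
  rewrite !(seglen_eq F G) by assumption. simpl Nat.iter. fold e e'. assert (hG := nm_lift _ _ _ nm).
  assert (hne : e - xi0 <> 0) by apply (opposite_returns G rho xi0 l hG).
  destruct (Nat.even l) eqn:hl.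
  - assert (h := arc_even G rho xi0 l 0 hG hl).
    assert (h' := arc_odd G rho xi0 (S l) 0 hG (even_S_true l hl)). simpl in h, h'. fold e in h. fold e' in h'.
    rewrite Rmin_right in hw by lra. rewrite Rabs_left by lra.
    replace (xi0 + - - (e' - xi0)) with (e' + IZR 0) by (simpl; ring).
    rewrite arclen_shift by lra. field. lra.
  - assert (h := arc_odd G rho xi0 l 0 hG hl).
    assert (h' := arc_even G rho xi0 (S l) 0 hG (even_S_false l hl)). simpl in h, h'. fold e in h. fold e' in h'.
    rewrite Rmin_left in hw by lra. rewrite Rabs_left by lra.
    replace (xi0 + - - (e - xi0)) with (e + IZR 0) by (simpl; ring).
    rewrite arclen_shift by lra. field. lra.
Qed.

(** The one-sided derivatives at the ends come from a function [Phi] with ordinary derivatives that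
    agrees with [h] on the interval, such as an expression in [model_iter]. *)
Lemma C1_norm_le_intro (a b : R) (h Phi Phi' : R -> R) (M : R) :
  (forall t, a <= t <= b -> h t = Phi t) ->
  (forall t, a <= t <= b -> is_derive Phi t (Phi' t)) ->
  (forall t, a <= t <= b -> continuous Phi' t) ->
  (forall t, a <= t <= b -> Rabs (Phi t) <= M /\ Rabs (Phi' t) <= M) ->
  C1_norm_le a b h M.
Proof.
  intros he hd hc hb. exists Phi'. split; [|split].
  - intros t ht. apply filterlim_locally. intros eps.
    destruct (proj1 (is_derive_Reals Phi t (Phi' t)) (hd t ht) eps (cond_pos eps)) as [dl hdl].
    exists dl. intros y hy [hy1 hy2].
    unfold ball in *; simpl in *; unfold AbsRing_ball, abs, minus, plus, opp in *; simpl in *.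
    rewrite !he by assumption. specialize (hdl (y - t)).
    replace (t + (y - t)) with y in hdl by ring. apply hdl; [lra|exact hy].
  - intros t ht P hP. destruct (hc t ht P hP) as [dl hdl]. exists dl.
    intros y hy _. now apply hdl.
  - intros t ht. rewrite he by assumption. now apply hb.
Qed.

Lemma scale_choice (K mu g K1 : R) : 0 < K -> 0 < mu < 1 -> 0 < g <= 1 -> 0 < K1 ->
  exists A N0, 0 < A /\ forall n, (N0 <= n)%nat ->
    let L := K * mu ^ n in
    let eta := A / Rpower (INR n) g in
    (1 <= n)%nat /\ L < 1/2 /\ (forall t, 0 < t <= L -> Zg g t <= eta) /\ sqrt L <= eta /\ K1 * eta <= 1.
Proof.
  intros hK hmu hg hK1.
  set (c := - ln mu). assert (hc : 0 < c).
  { unfold c. assert (ln mu < ln 1) by (apply ln_increasing; lra). rewrite ln_1 in H. lra. }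
  (* For large n, L is at most e^(-cn/2). The first summand serves Z at that length, which is
     (cn/2)^(-g); the second serves sqrt L <= e^(-cn/4) <= (4/c)/n, and 1/n <= n^(-g) because g <=
     1. *)
  set (A := Rpower (c / 2) (- g) + 4 / c).
  assert (hA1 : 0 < Rpower (c / 2) (- g)) by apply exp_pos.
  assert (hA2 : 0 < 4 / c) by (apply Rdiv_lt_0_compat; lra).
  (* The summands ensure, in order: n > 1; the constant [K] absorbed by half of the exponential
     rate; cn/2 > 2, hence L < 1/2; and n^g >= K1 * A. *)
  set (X := 1 + Rmax 0 (2 * ln K / c) + 4 / c + exp (K1 * A / g)).
  destruct (INR_unbounded X) as [N0 hN0].
  exists A, N0. split; [unfold A; lra|]. intros n hn L eta.
  assert (hnX : X < INR n) by (apply le_INR in hn; lra).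
  assert (m1 := Rmax_l 0 (2 * ln K / c)). assert (m2 := Rmax_r 0 (2 * ln K / c)).
  assert (he := exp_pos (K1 * A / g)).
  unfold X in hnX.
  assert (hn1 : 1 < INR n) by lra.
  assert (hnN : (1 <= n)%nat) by (apply INR_le; simpl; lra).
  assert (hmn : 0 < mu ^ n) by (apply pow_lt; lra).
  assert (hL : 0 < L) by (apply Rmult_lt_0_compat; lra).
  assert (hlnL : ln L <= - (INR n * (c / 2))).
  { unfold L. rewrite ln_mult, ln_pow by lra. replace (ln mu) with (- c) by (unfold c; ring).
    assert (2 * ln K / c < INR n) by lra.
    assert (2 * ln K / c * (c / 2) < INR n * (c / 2)) by (apply Rmult_lt_compat_r; lra).
    replace (2 * ln K / c * (c / 2)) with (ln K) in H0 by (field; lra). lra. }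
  assert (hnc : 2 < INR n * (c / 2)).
  { assert (4 / c * (c / 2) < INR n * (c / 2)) by (apply Rmult_lt_compat_r; lra).
    replace (4 / c * (c / 2)) with 2 in H by (field; lra). lra. }
  assert (hL2 : L < 1 / 2).
  { rewrite <- (exp_ln L) by assumption.
    assert (e1 : 2 < exp 1) by (generalize (exp_ineq1 1); lra).
    apply Rlt_le_trans with (exp (- (1))).
    - apply exp_increasing. lra.
    - rewrite exp_Ropp. unfold Rdiv. rewrite Rmult_1_l. apply Rinv_le_contravar; lra. }
  assert (hRp : 0 < Rpower (INR n) g) by apply exp_pos.
  assert (hRn : Rpower (INR n) g <= INR n).
  { rewrite <- (Rpower_1 (INR n)) at 2 by lra. apply Rle_Rpower; lra. }
  assert (hRi : / INR n <= / Rpower (INR n) g) by (apply Rinv_le_contravar; lra).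
  assert (hRi0 : 0 < / Rpower (INR n) g) by now apply Rinv_0_lt_compat.
  assert (hin0 : 0 < / INR n) by (apply Rinv_0_lt_compat; lra).
  repeat split; try assumption.
  - intros t ht. apply Rle_trans with (Zg g L); [apply Zg_le; lra|].
    unfold Zg. destruct (Rlt_dec 0 L); [|contradiction].
    apply Rle_trans with (Rpower (INR n * (c / 2)) (- g)).
    + rewrite !Rpower_Ropp. apply Rinv_le_contravar; [apply exp_pos|].
      apply Rle_Rpower_l; [lra|]. split; [lra|]. rewrite ln_Rinv by assumption. lra.
    + rewrite <- Rpower_mult_distr by lra. rewrite (Rpower_Ropp (INR n)).
      rewrite Rmult_comm. unfold eta. apply Rmult_le_compat_r; [lra|]. unfold A; lra.
  - assert (es : sqrt L = exp (ln L / 2)).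
    { rewrite <- (exp_ln L) at 1 by assumption.
      replace (ln L) with (ln L / 2 + ln L / 2) at 1 by field.
      rewrite exp_plus. apply sqrt_square. left; apply exp_pos. }
    rewrite es.
    apply Rle_trans with (exp (- (INR n * (c / 4)))); [apply exp_le; lra|].
    rewrite exp_Ropp.
    assert (h1 := exp_ineq1_le (INR n * (c / 4))).
    apply Rle_trans with (/ (INR n * (c / 4))); [apply Rinv_le_contravar; lra|].
    replace (/ (INR n * (c / 4))) with (4 / c * / INR n) by (field; lra).
    unfold eta, Rdiv at 2. apply Rmult_le_compat; [lra|lra| |assumption]. unfold A; lra.
  - assert (hb : K1 * A <= Rpower (INR n) g).
    { unfold Rpower. apply Rle_trans with (exp (g * ln (exp (K1 * A / g)))).
      - rewrite ln_exp. replace (g * (K1 * A / g)) with (K1 * A) by (field; lra).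
        generalize (exp_ineq1_le (K1 * A)). lra.
      - apply exp_le. apply Rmult_le_compat_l; [lra|]. apply ln_le; lra. }
    unfold eta. apply Rmult_le_reg_r with (Rpower (INR n) g); [assumption|].
    replace (K1 * (A / Rpower (INR n) g) * Rpower (INR n) g) with (K1 * A) by (field; lra). lra.
Qed.

(** * Parameters and renormalized maps as signed quotients on the line *)

Lemma a_par_eq (F G : R -> R) (rho xi0 : R) (l : nat) : normalized F G rho ->
  a_par F xi0 rho (S l) = - (return_point G rho xi0 (S l) - xi0) / (return_point G rho xi0 l - xi0).
Proof.
  intros nm. unfold a_par. replace (S l - 1)%nat with l by lia.
  rewrite !(seglen_eq F G) by assumption. simpl Nat.iter.
  apply (opposite_returns G rho xi0 l (nm_lift _ _ _ nm)).
Qed.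

Lemma b_par_eq (F G : R -> R) (rho xi0 : R) (l : nat) : normalized F G rho ->
  b_par F xi0 rho (S l) = (first_return G rho (S l) (return_point G rho xi0 l) - xi0) / (return_point G rho xi0 l - xi0).
Proof.
  intros nm. assert (hG := nm_lift _ _ _ nm). unfold b_par. replace (S l - 1)%nat with l by lia.
  rewrite !(seglen_eq F G) by assumption. simpl Nat.iter.
  destruct (opposite_returns G rho xi0 l hG) as [h1 [_ [_ [_ [h2 _]]]]].
  set (e := return_point G rho xi0 l) in *. set (w := first_return G rho (S l) e) in *.
  replace (Nat.iter (q rho l) G (return_point G rho xi0 (S l)) - Nat.iter (q rho l) G xi0) with (w - e).
  - replace ((Rabs (e - xi0) - Rabs (w - e)) / Rabs (e - xi0)) with (1 - Rabs (w - e) / Rabs (e - xi0))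
      by (field; now apply Rabs_no_R0).
    rewrite h2. field. assumption.
  - unfold w, e, return_point. rewrite first_return_comm by assumption.
    unfold first_return at 1 3. unfold shift_iter. ring.
Qed.

Lemma Amap_eq (F G : R -> R) (rho xi0 t : R) (l : nat) : normalized F G rho ->
  Amap F xi0 rho (S l - 1) t = xi0 + (- t) * (return_point G rho xi0 l - xi0).
Proof.
  intros nm. replace (S l - 1)%nat with l by lia. unfold Amap.
  rewrite (sgn_seglen F G) by assumption. ring.
Qed.

Lemma first_return_le (G : R -> R) (rho x y : R) (n : nat) : irrational_lift G rho ->
  x <= y -> first_return G rho n x <= first_return G rho n y.
Proof. intros hG. apply shift_iter_le, hG. Qed.

(** Displacements below 1/2 make V_n shorter than 1. The image point then lies in the unit window
    that starts at the left end of V_n, and the inverse branch [Ainv] is given by an affine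
    formula. *)
Lemma f_ren_eq (F G : R -> R) (rho xi0 t : R) (l : nat) : normalized F G rho ->
  (forall n, (l <= n)%nat -> Rabs (return_point G rho xi0 n - xi0) < 1/2) -> -1 <= t <= 0 ->
  let e := return_point G rho xi0 l in
  f_ren F xi0 rho (S l) t = - (first_return G rho (S l) (xi0 + (- t) * (e - xi0)) - xi0) / (e - xi0).
Proof.
  intros nm hs ht e. assert (hG := nm_lift _ _ _ nm). unfold f_ren. rewrite (Amap_eq F G) by assumption. fold e.
  set (x := xi0 + - t * (e - xi0)).
  destruct (nm_iter _ _ _ nm (q rho (S l)) x) as [p hp]. rewrite hp.
  replace (Nat.iter (q rho (S l)) G x + IZR p)
    with (first_return G rho (S l) x + IZR (pnum rho (S l) + p))
    by (unfold first_return, shift_iter; rewrite opp_IZR, plus_IZR; ring).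
  apply (Ainv_eq F G); [assumption|].
  set (e' := return_point G rho xi0 (S l)).
  assert (s1 := hs l ltac:(lia)). assert (s2 := hs (S l) ltac:(lia)). fold e in s1. fold e' in s2.
  apply Rabs_def2 in s1, s2. fold e.
  destruct (Nat.even l) eqn:hl.
  - assert (a1 := first_return_even G rho l xi0 hG hl).
    assert (a2 := first_return_odd G rho (S l) e hG (even_S_true l hl)).
    change (first_return G rho l xi0) with e in a1.
    assert (xi0 <= x <= e) by (unfold x; split; nra).
    assert (k1 := first_return_le G rho xi0 x (S l) hG ltac:(lra)).
    assert (k2 := first_return_le G rho x e (S l) hG ltac:(lra)).
    change (first_return G rho (S l) xi0) with e' in k1.
    unfold Rmin; destruct (Rle_dec e e'); lra.
  - assert (a1 := first_return_odd G rho l xi0 hG hl).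
    assert (a2 := first_return_even G rho (S l) e hG (even_S_false l hl)).
    change (first_return G rho l xi0) with e in a1.
    assert (e <= x <= xi0) by (unfold x; split; nra).
    assert (k1 := first_return_le G rho x xi0 (S l) hG ltac:(lra)).
    assert (k2 := first_return_le G rho e x (S l) hG ltac:(lra)).
    change (first_return G rho (S l) xi0) with e' in k1.
    assert (a3 := first_return_even G rho (S l) xi0 hG (even_S_false l hl)).
    change (first_return G rho (S l) xi0) with e' in a3.
    rewrite Rmin_left by lra. lra.
Qed.

Lemma g_ren_eq (F G : R -> R) (rho xi0 sg : R) (l : nat) : normalized F G rho ->
  (forall n, (l <= n)%nat -> Rabs (return_point G rho xi0 n - xi0) < 1/2) -> 0 <= sg <= 1 ->
  let e := return_point G rho xi0 l in
  let e' := return_point G rho xi0 (S l) in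
  g_ren F xi0 rho (S l) (sg * a_par F xi0 rho (S l)) = - (first_return G rho l (xi0 + sg * (e' - xi0)) - xi0) / (e - xi0).
Proof.
  intros nm hs ht e e'. assert (hG := nm_lift _ _ _ nm). unfold g_ren. rewrite (Amap_eq F G) by assumption.
  rewrite (a_par_eq F G) by assumption. fold e e'.
  destruct (opposite_returns G rho xi0 l hG) as [hne _]. fold e in hne.
  replace (xi0 + - (sg * (- (e' - xi0) / (e - xi0))) * (e - xi0)) with (xi0 + sg * (e' - xi0)) by (field; assumption).
  set (x := xi0 + sg * (e' - xi0)). replace (S l - 1)%nat with l by lia.
  destruct (nm_iter _ _ _ nm (q rho l) x) as [p hp]. rewrite hp.
  replace (Nat.iter (q rho l) G x + IZR p)
    with (first_return G rho l x + IZR (pnum rho l + p))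
    by (unfold first_return, shift_iter; rewrite opp_IZR, plus_IZR; ring).
  apply (Ainv_eq F G); [assumption|]. fold e e'.
  assert (s1 := hs l ltac:(lia)). assert (s2 := hs (S l) ltac:(lia)). fold e in s1. fold e' in s2.
  apply Rabs_def2 in s1, s2.
  destruct (Nat.even l) eqn:hl.
  - assert (a1 := first_return_even G rho l xi0 hG hl).
    assert (a2 := first_return_odd G rho (S l) xi0 hG (even_S_true l hl)).
    assert (a3 := first_return_twice_even G rho l xi0 hG hl).
    rewrite first_return_comm in a3 by assumption.
    change (first_return G rho l xi0) with e in a1.
    change (first_return G rho (S l) xi0) with e' in a2, a3.
    assert (e' <= x <= xi0) by (unfold x; split; nra).
    assert (k1 := first_return_le G rho e' x l hG ltac:(lra)).
    assert (k2 := first_return_le G rho x xi0 l hG ltac:(lra)).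
    change (first_return G rho l xi0) with e in k2.
    rewrite Rmin_right by lra. lra.
  - assert (a1 := first_return_odd G rho l xi0 hG hl).
    assert (a2 := first_return_even G rho (S l) xi0 hG (even_S_false l hl)).
    assert (a3 := first_return_twice_odd G rho l xi0 hG hl).
    rewrite first_return_comm in a3 by assumption.
    change (first_return G rho l xi0) with e in a1.
    change (first_return G rho (S l) xi0) with e' in a2, a3.
    assert (xi0 <= x <= e') by (unfold x; split; nra).
    assert (k1 := first_return_le G rho xi0 x l hG ltac:(lra)).
    assert (k2 := first_return_le G rho x e' l hG ltac:(lra)).
    change (first_return G rho l xi0) with e in k1.
    rewrite Rmin_left by lra. lra.
Qed.

(** * Closeness to the Moebius maps *)

Lemma mtilde_eq (F G Df D : R -> R) (rho xi0 g L eta : R) (l : nat) : normalized F G rho ->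
  (forall x, xi0 <= x <= xi0 + 1 -> D x = Df x) ->
  short_arcs G xi0 g L eta xi0 (return_point G rho xi0 l) (q rho (S l)) (arc_shift G rho xi0 l) ->
  mtilde F Df xi0 rho (S l) =
  exp (nonlinearity_sum G D xi0 (return_point G rho xi0 l) (q rho (S l)) (arc_shift G rho xi0 l)
    (fun i => D (Nat.iter i G xi0 - IZR (arc_shift G rho xi0 l i)))).
Proof.
  intros nm hD sa. unfold mtilde, nonlinearity_sum. replace (S l - 1)%nat with l by lia.
  f_equal. apply sum_lt_ext. intros i hi.
  rewrite (Dstart_eq F G), (Dend_eq F G) by assumption.
  rewrite !hD; [reflexivity| |]; [now apply (sa_e _ _ _ _ _ _ _ _ _ sa)|now apply (sa_s _ _ _ _ _ _ _ _ _ sa)].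
Qed.

(** [mhat] sums end minus start, the opposite orientation to [nonlinearity_sum]; in the coordinate
    measured from [xi0] the multiplier of g_n is therefore [/ mhat]. *)
Lemma mhat_eq (F G Df D : R -> R) (rho xi0 g L eta : R) (l : nat) : normalized F G rho ->
  (forall x, xi0 <= x <= xi0 + 1 -> D x = Df x) ->
  short_arcs G xi0 g L eta xi0 (return_point G rho xi0 (S l)) (q rho l) (arc_shift G rho xi0 (S l)) ->
  mhat F Df xi0 rho (S l) =
  exp (- nonlinearity_sum G D xi0 (return_point G rho xi0 (S l)) (q rho l) (arc_shift G rho xi0 (S l))
    (fun i => D (Nat.iter i G (return_point G rho xi0 (S l)) - IZR (arc_shift G rho xi0 (S l) i)))).
Proof.
  intros nm hD sa. unfold mhat, nonlinearity_sum. replace (S l - 1)%nat with l by lia.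
  f_equal. rewrite <- sum_lt_opp. apply sum_lt_ext. intros i hi.
  rewrite (Dstart_eq F G), (Dend_eq F G) by assumption.
  rewrite !hD; [|now apply (sa_e _ _ _ _ _ _ _ _ _ sa)|now apply (sa_s _ _ _ _ _ _ _ _ _ sa)].
  unfold Rdiv. ring.
Qed.

Lemma scaled_abs_le (k x B e : R) : 0 < k <= B -> Rabs x <= e -> Rabs (k * x) <= B * e.
Proof.
  intros hk hx. rewrite Rabs_mult, (Rabs_pos_eq k) by lra.
  apply Rmult_le_compat; try lra. apply Rabs_pos.
Qed.

Lemma model_iter_affine_derive (E D : R -> R) (r : nat -> Z) (N : nat) (xi0 d p t : R) :
  (forall x, is_derive E x (D x)) -> d <> 0 ->
  is_derive (fun t => - (model_iter E r N (xi0 + - t * d) + p - xi0) / d) t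
    (model_deriv E D r N (xi0 + - t * d)).
Proof.
  intros hE hd.
  assert (H : is_derive (fun t => model_iter E r N (xi0 + - t * d)) t (- d * model_deriv E D r N (xi0 + - t * d))).
  { apply (is_derive_comp (model_iter E r N) (fun t => xi0 + - t * d)); [now apply model_iter_derive|].
    auto_derive; auto. ring. }
  apply (is_derive_ext (fun t => (- / d) * model_iter E r N (xi0 + - t * d) + (- (p - xi0) / d))).
  { intros s. match goal with |- ?a = ?b => change (@eq R a b) end. field. assumption. }
  replace (model_deriv E D r N (xi0 + - t * d))
    with ((- / d) * (- d * model_deriv E D r N (xi0 + - t * d)) + 0) by (field; assumption).
  apply (is_derive_plus (fun t => (- / d) * model_iter E r N (xi0 + - t * d)) (fun _ => - (p - xi0) / d));
    [|apply (@is_derive_const R_AbsRing R_NormedModule)].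
  apply (is_derive_scal (fun t => model_iter E r N (xi0 + - t * d))). exact H.
Qed.

Lemma model_deriv_affine_continuous (E D : R -> R) (r : nat -> Z) (N : nat) (xi0 d t : R) :
  (forall x, is_derive E x (D x)) -> (forall x, continuous D x) ->
  continuous (fun t => model_deriv E D r N (xi0 + - t * d)) t.
Proof.
  intros hE hD. apply (continuous_comp (fun t => xi0 + - t * d) (model_deriv E D r N)).
  - apply (ex_derive_continuous (fun t => xi0 + - t * d)). auto_derive; auto.
  - now apply model_deriv_continuous.
Qed.

(** Both maps send 0 to [a] and -1 to [- b]. In the relative coordinate sg = -t they are the images,
    under one affine map of ratio -(a + b), of the two maps compared in the hypothesis, so the
    errors are multiplied by [a + b], which [return_slope_long] bounds. *)
Lemma f_ren_close (F G Df E D : R -> R) (rho xi0 g m M v L eta K : R) (l : nat) :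
  normalized F G rho -> smooth_model G Df xi0 E D m M -> slope_variation G v ->
  (forall n, (l <= n)%nat -> Rabs (return_point G rho xi0 n - xi0) < 1/2) ->
  short_arcs G xi0 g L eta xi0 (return_point G rho xi0 l) (q rho (S l)) (arc_shift G rho xi0 l) ->
  (forall sg, 0 <= sg <= 1 ->
    let N := q rho (S l) in
    let r := arc_shift G rho xi0 l in
    let e0 := return_point G rho xi0 l in
    let x := xi0 + sg * (e0 - xi0) in
    let mu := mtilde F Df xi0 rho (S l) in
    let len := Nat.iter N G e0 - Nat.iter N G xi0 in
    Rabs ((model_iter E r N x - Nat.iter N G xi0) / len - mu * sg / (mu * sg + (1 - sg))) <= K * eta /\
    Rabs (model_deriv E D r N x * (e0 - xi0) / len
          - mu / ((mu * sg + (1 - sg)) * (mu * sg + (1 - sg)))) <= K * eta) ->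
  C1_norm_le (-1) 0 (fun t => f_ren F xi0 rho (S l) t - Ftilde F Df xi0 rho (S l) t) (exp (9 * v) * (K * eta)).
Proof.
  intros nm sm hv hs sa htr. assert (hG := nm_lift _ _ _ nm).
  assert (hk := return_slope_long G rho v l xi0 hG hv).
  assert (ha := a_par_eq F G rho xi0 l nm). assert (hb := b_par_eq F G rho xi0 l nm).
  destruct (opposite_returns G rho xi0 l hG) as [hne _]. unfold Ftilde. cbv zeta in htr.
  set (mu := mtilde F Df xi0 rho (S l)) in *.
  assert (hmu : 0 < mu) by apply exp_pos.
  set (a := a_par F xi0 rho (S l)) in *. set (b := b_par F xi0 rho (S l)) in *.
  change (first_return G rho l xi0) with (return_point G rho xi0 l) in hk.
  set (e := return_point G rho xi0 l) in *.
  set (N := q rho (S l)) in *. set (r := arc_shift G rho xi0 l) in *.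
  set (d := e - xi0) in *.
  set (len := Nat.iter N G e - Nat.iter N G xi0) in *.
  set (P := IZR (- pnum rho (S l))).
  assert (hk' : slope (Nat.iter N G) xi0 e = len / d) by reflexivity. rewrite hk' in hk.
  assert (hab : a + b = len / d).
  { rewrite ha, hb. unfold len, return_point, first_return, shift_iter. fold N. fold P. fold d.
    fold (return_point G rho xi0 l). change (shift_iter G (q rho l) (- pnum rho l) xi0) with e.
    change (return_point G rho xi0 l) with e. field. assumption. }
  assert (hlen : len <> 0).
  { intros e0. rewrite e0 in hk. unfold Rdiv in hk. rewrite Rmult_0_l in hk. lra. }
  assert (hea : Nat.iter N G xi0 + P - xi0 = - a * d).
  { rewrite ha. unfold return_point, first_return, shift_iter. fold N P d. field. assumption. }
  assert (hden : forall t, -1 <= t <= 0 -> 0 < 1 + (1 - mu) * t) by (intros; nra).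
  apply (C1_norm_le_intro (-1) 0 _
    (fun t => - (model_iter E r N (xi0 + - t * d) + P - xi0) / d - (a + (a + b * mu) * t) / (1 + (1 - mu) * t))
    (fun t => model_deriv E D r N (xi0 + - t * d) - (a + b) * mu / ((1 + (1 - mu) * t) * (1 + (1 - mu) * t)))).
  - intros t ht. rewrite (f_ren_eq F G rho xi0 t l nm hs ht). f_equal. fold e d. f_equal. f_equal.
    rewrite (model_iter_eq G Df xi0 E D m M g L eta xi0 e N r sm (il_lift _ _ hG) sa N _ (Nat.le_refl _)).
    + reflexivity.
    + unfold Rmin, Rmax. unfold d. destruct (Rle_dec xi0 e); nra.
  - intros t ht. specialize (hden t ht).
    apply (is_derive_minus (fun t => - (model_iter E r N (xi0 + - t * d) + P - xi0) / d)
      (fun t => (a + (a + b * mu) * t) / (1 + (1 - mu) * t))).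
    + apply model_iter_affine_derive; [apply (sm_derive _ _ _ _ _ _ _ sm)|assumption].
    + auto_derive; [lra|]. field. lra.
  - intros t ht. specialize (hden t ht).
    apply (continuous_minus (fun t => model_deriv E D r N (xi0 + - t * d))
      (fun t => (a + b) * mu / ((1 + (1 - mu) * t) * (1 + (1 - mu) * t)))).
    + apply model_deriv_affine_continuous; [apply (sm_derive _ _ _ _ _ _ _ sm)|apply (sm_cont _ _ _ _ _ _ _ sm)].
    + apply (ex_derive_continuous (fun t => (a + b) * mu / ((1 + (1 - mu) * t) * (1 + (1 - mu) * t)))).
      auto_derive. nra.
  - intros t ht. specialize (hden t ht).
    destruct (htr (- t) ltac:(lra)) as [k1 k2]. fold d in k1, k2.
    replace (mu * - t + (1 - - t)) with (1 + (1 - mu) * t) in k1, k2 by ring.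
    split.
    + replace (- (model_iter E r N (xi0 + - t * d) + P - xi0) / d - (a + (a + b * mu) * t) / (1 + (1 - mu) * t))
        with (len / d * - ((model_iter E r N (xi0 + - t * d) - Nat.iter N G xi0) / len - mu * - t / (1 + (1 - mu) * t))).
      * apply scaled_abs_le; [assumption|]. now rewrite Rabs_Ropp.
      * replace (model_iter E r N (xi0 + - t * d) + P - xi0)
          with (model_iter E r N (xi0 + - t * d) - Nat.iter N G xi0 + (- a * d)) by (rewrite <- hea; ring).
        replace b with (len / d - a) by lra. field. repeat split; lra.
    + rewrite hab.
      replace (model_deriv E D r N (xi0 + - t * d) - len / d * mu / ((1 + (1 - mu) * t) * (1 + (1 - mu) * t)))
        with (len / d * (model_deriv E D r N (xi0 + - t * d) * d / len - mu / ((1 + (1 - mu) * t) * (1 + (1 - mu) * t))))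
        by (field; repeat split; lra).
      now apply scaled_abs_le.
Qed.

(** The domain has length [a], so with t = sg * a the errors of the values are multiplied by [1 - b]
    and those of the derivatives by [(1 - b) / a]. The first factor is below 1; the second is the
    slope bounded by [return_slope_short]. *)
Lemma g_ren_close (F G Df E D : R -> R) (rho xi0 g m M v L eta K : R) (l : nat) :
  normalized F G rho -> smooth_model G Df xi0 E D m M -> slope_variation G v ->
  (forall n, (l <= n)%nat -> Rabs (return_point G rho xi0 n - xi0) < 1/2) ->
  short_arcs G xi0 g L eta xi0 (return_point G rho xi0 (S l)) (q rho l) (arc_shift G rho xi0 (S l)) ->
  (forall sg, 0 <= sg <= 1 ->
    let N := q rho l in
    let r := arc_shift G rho xi0 (S l) in
    let e0 := return_point G rho xi0 (S l) in
    let x := xi0 + sg * (e0 - xi0) in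
    let mu := / mhat F Df xi0 rho (S l) in
    let len := Nat.iter N G e0 - Nat.iter N G xi0 in
    Rabs ((model_iter E r N x - Nat.iter N G xi0) / len - mu * sg / (mu * sg + (1 - sg))) <= K * eta /\
    Rabs (model_deriv E D r N x * (e0 - xi0) / len
          - mu / ((mu * sg + (1 - sg)) * (mu * sg + (1 - sg)))) <= K * eta) ->
  C1_norm_le 0 (a_par F xi0 rho (S l)) (fun t => g_ren F xi0 rho (S l) t - Ghat F Df xi0 rho (S l) t)
    (exp (9 * v) * (K * eta)).
Proof.
  intros nm sm hv hs sa htr. assert (hG := nm_lift _ _ _ nm).
  assert (hk := return_slope_short G rho v l xi0 hG hv).
  assert (hv0 := slope_variation_nonneg G v hv).
  assert (hE1 : 1 <= exp (9 * v)) by (rewrite <- exp_0 at 1; apply exp_le; lra).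
  assert (ha := a_par_eq F G rho xi0 l nm). assert (hb := b_par_eq F G rho xi0 l nm).
  destruct (opposite_returns G rho xi0 l hG) as [hne [hne' [_ [ha0 [_ hb0]]]]].
  rewrite <- hb in hb0. rewrite <- ha in ha0. unfold Ghat. cbv zeta in htr.
  set (mh := mhat F Df xi0 rho (S l)) in *.
  assert (hmh : 0 < mh) by apply exp_pos.
  set (a := a_par F xi0 rho (S l)) in *. set (b := b_par F xi0 rho (S l)) in *.
  change (first_return G rho (S l) xi0) with (return_point G rho xi0 (S l)) in hk.
  set (e := return_point G rho xi0 l) in *. set (e' := return_point G rho xi0 (S l)) in *.
  set (N := q rho l) in *. set (r := arc_shift G rho xi0 (S l)) in *.
  set (d := e - xi0) in *. set (d' := e' - xi0) in *.
  set (len := Nat.iter N G e' - Nat.iter N G xi0) in *.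
  set (P := IZR (- pnum rho l)).
  assert (hk' : slope (Nat.iter N G) xi0 e' = len / d') by reflexivity. rewrite hk' in hk.
  assert (hd' : d' = - a * d) by (rewrite ha; field; assumption).
  assert (hlen : len <> 0).
  { intros e0. rewrite e0 in hk. unfold Rdiv in hk. rewrite Rmult_0_l in hk. lra. }
  assert (hea : Nat.iter N G xi0 + P - xi0 = d) by reflexivity.
  assert (hlb : len = (b - 1) * d).
  { rewrite hb. replace ((first_return G rho (S l) e - xi0) / d - 1) with ((first_return G rho (S l) e - e) / d)
      by (unfold d; field; assumption).
    unfold e at 1. unfold return_point. rewrite first_return_comm by assumption.
    change (first_return G rho (S l) xi0) with e'.
    replace (first_return G rho l e' - e) with len; [field; assumption|].
    unfold len, e, return_point, first_return, shift_iter. fold N. ring. }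
  assert (hden : forall t, 0 <= t <= a -> 0 < a * mh + (1 - mh) * t).
  { intros t ht. assert (0 <= mh * (a - t)) by (apply Rmult_le_pos; lra).
    destruct (Req_dec t 0) as [->|h]; [rewrite Rmult_0_r, Rplus_0_r; now apply Rmult_lt_0_compat|].
    replace (a * mh + (1 - mh) * t) with (mh * (a - t) + t) by ring. lra. }
  assert (hsg : forall t, 0 <= t <= a -> 0 <= t / a <= 1).
  { intros t ht. split; [apply Rdiv_le_0_compat; lra|].
    apply Rmult_le_reg_r with a; [assumption|]. unfold Rdiv. rewrite Rmult_assoc, Rinv_l by lra. lra. }
  assert (hx : forall t, xi0 + - t * d = xi0 + t / a * d').
  { intros t. rewrite hd'. field. lra. }
  apply (C1_norm_le_intro 0 a _
    (fun t => - (model_iter E r N (xi0 + - t * d) + P - xi0) / d - (- a * mh + (mh - b) * t) / (a * mh + (1 - mh) * t))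
    (fun t => model_deriv E D r N (xi0 + - t * d)
       - (1 - b) * a * mh / ((a * mh + (1 - mh) * t) * (a * mh + (1 - mh) * t)))).
  - intros t ht. f_equal.
    assert (hg := g_ren_eq F G rho xi0 (t / a) l nm hs (hsg t ht)). fold a e e' d d' in hg.
    replace (t / a * a) with t in hg by (field; lra). rewrite hg, hx. f_equal. f_equal.
    rewrite (model_iter_eq G Df xi0 E D m M g L eta xi0 e' N r sm (il_lift _ _ hG) sa N _ (Nat.le_refl _)).
    + reflexivity.
    + specialize (hsg t ht). unfold Rmin, Rmax. unfold d'. destruct (Rle_dec xi0 e'); nra.
  - intros t ht. specialize (hden t ht).
    apply (is_derive_minus (fun t => - (model_iter E r N (xi0 + - t * d) + P - xi0) / d)
      (fun t => (- a * mh + (mh - b) * t) / (a * mh + (1 - mh) * t))).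
    + apply model_iter_affine_derive; [apply (sm_derive _ _ _ _ _ _ _ sm)|assumption].
    + auto_derive; [lra|]. field. lra.
  - intros t ht. specialize (hden t ht).
    apply (continuous_minus (fun t => model_deriv E D r N (xi0 + - t * d))
      (fun t => (1 - b) * a * mh / ((a * mh + (1 - mh) * t) * (a * mh + (1 - mh) * t)))).
    + apply model_deriv_affine_continuous; [apply (sm_derive _ _ _ _ _ _ _ sm)|apply (sm_cont _ _ _ _ _ _ _ sm)].
    + apply (ex_derive_continuous (fun t => (1 - b) * a * mh / ((a * mh + (1 - mh) * t) * (a * mh + (1 - mh) * t)))).
      auto_derive. nra.
  - intros t ht. specialize (hden t ht).
    destruct (htr (t / a) (hsg t ht)) as [k1 k2]. fold d' in k1, k2. rewrite <- hx in k1, k2.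
    replace (/ mh * (t / a) + (1 - t / a)) with ((a * mh + (1 - mh) * t) / (a * mh)) in k1, k2 by (field; lra).
    split.
    + replace (- (model_iter E r N (xi0 + - t * d) + P - xi0) / d - (- a * mh + (mh - b) * t) / (a * mh + (1 - mh) * t))
        with ((1 - b) * ((model_iter E r N (xi0 + - t * d) - Nat.iter N G xi0) / len
           - / mh * (t / a) / ((a * mh + (1 - mh) * t) / (a * mh)))).
      * apply scaled_abs_le; [lra|assumption].
      * replace (model_iter E r N (xi0 + - t * d) + P - xi0)
          with (model_iter E r N (xi0 + - t * d) - Nat.iter N G xi0 + d) by (rewrite <- hea; ring).
        rewrite hlb. field. repeat split; lra.
    + replace (model_deriv E D r N (xi0 + - t * d) - (1 - b) * a * mh / ((a * mh + (1 - mh) * t) * (a * mh + (1 - mh) * t)))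
        with (len / d' * (model_deriv E D r N (xi0 + - t * d) * d' / len
           - / mh / ((a * mh + (1 - mh) * t) / (a * mh) * ((a * mh + (1 - mh) * t) / (a * mh))))).
      * now apply scaled_abs_le.
      * assert (e1 : len / d' = (1 - b) / a) by (rewrite hlb, hd'; field; lra).
        replace (len / d' * (model_deriv E D r N (xi0 + - t * d) * d' / len
           - / mh / ((a * mh + (1 - mh) * t) / (a * mh) * ((a * mh + (1 - mh) * t) / (a * mh)))))
        with (model_deriv E D r N (xi0 + - t * d) - len / d' *
           (/ mh / ((a * mh + (1 - mh) * t) / (a * mh) * ((a * mh + (1 - mh) * t) / (a * mh))))) by (field; repeat split; lra).
        rewrite e1. field. repeat split; lra.
Qed.

Theorem theorem1p2 :
  forall (gamma : R) (F Df : R -> R) (xi0 rho : R),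
    0 < gamma <= 1 ->
    break_diffeo F Df xi0 ->
    class_DZ gamma Df xi0 ->
    rotation_number F rho ->
    irrational rho ->
    exists C : R, 0 < C /\
    exists N0 : nat, forall n : nat, (N0 <= n)%nat ->
      C1_norm_le (-1) 0
        (fun t => f_ren F xi0 rho n t - Ftilde F Df xi0 rho n t)
        (C / Rpower (INR n) gamma) /\
      C1_norm_le 0 (a_par F xi0 rho n)
        (fun t => g_ren F xi0 rho n t - Ghat F Df xi0 rho n t)
        (C / Rpower (INR n) gamma).
Proof.
  intros gamma F Df xi0 rho hg hb [[V hV] [Cz [hCz hz]]] hr hi.
  destruct (normalization_exists F Df xi0 rho hb hr hi) as [G [nm hbG]].
  assert (hG := nm_lift _ _ _ nm).
  destruct (smooth_model_exists G Df xi0 hbG) as [E [D [m [M sm]]]].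
  assert (hv := slope_variation_break G Df xi0 E D m M V sm (il_lift _ _ hG) hV).
  set (v := V / m + (M - m) / m) in *.
  assert (hDf := sm_D _ _ _ _ _ _ _ sm).
  assert (zm : zygmund_model xi0 Cz gamma m M E D).
  { constructor; try lra; [|apply sm|apply sm|apply sm].
    intros tau x h1 h2 h3. rewrite !hDf by lra. now apply hz. }
  assert (hVD : variation_le xi0 (xi0 + 1) D V).
  { intros n x h1 h2. eapply Rle_trans; [|apply (hV n x h1 h2)]. right.
    apply sum_lt_ext. intros k hk. rewrite !hDf by (apply h1; lia). reflexivity. }
  destruct (transfer G Df xi0 E D Cz gamma m M V sm (il_lift _ _ hG) zm hVD) as [K [K1 [hK [hK1 htr]]]].
  destruct (first_return_decay G rho v hG hv) as [K2 [mu [hK2 [hmu hdec]]]].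
  (* The maps of index n involve arcs of levels n-1 and n, so the decay is used from level n-1 on;
     dividing [K2] by [mu] makes up for the shift. *)
  destruct (scale_choice (K2 / mu) mu gamma K1) as [A [N0 [hA hsc]]]; try assumption.
  { apply Rdiv_lt_0_compat; lra. }
  exists (exp (9 * v) * (K * A)). split.
  { apply Rmult_lt_0_compat; [apply exp_pos|]. now apply Rmult_lt_0_compat. }
  exists N0. intros n hn. destruct (hsc n hn) as [hn1 [hL [hZ [hsq hsm]]]].
  destruct n as [|l]; [lia|]. set (L := K2 / mu * mu ^ S l) in *.
  set (eta := A / Rpower (INR (S l)) gamma) in *.
  replace (exp (9 * v) * (K * A) / Rpower (INR (S l)) gamma) with (exp (9 * v) * (K * eta))
    by (unfold eta, Rdiv; ring).
  assert (hpl : forall k, (l <= k)%nat -> K2 * mu ^ k <= L).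
  { intros k hk. replace L with (K2 * mu ^ l) by (unfold L; simpl; field; lra).
    apply Rmult_le_compat_l; [lra|]. replace k with (l + (k - l))%nat by lia.
    rewrite pow_add. rewrite <- (Rmult_1_r (mu ^ l)) at 2.
    apply Rmult_le_compat_l; [apply pow_le; lra|]. rewrite <- (pow1 (k - l)). apply pow_incr; lra. }
  assert (hd : forall k x, (l <= k)%nat -> Rabs (first_return G rho k x - x) <= L).
  { intros k x hk. eapply Rle_trans; [apply hdec|now apply hpl]. }
  assert (hsmall : forall k, (l <= k)%nat -> Rabs (return_point G rho xi0 k - xi0) < 1/2).
  { intros k hk. eapply Rle_lt_trans; [apply (hd k xi0 hk)|assumption]. }
  assert (hq1 := q_le_S rho l (il_rho _ _ hG) hi). assert (hq2 := q_le_S rho (S l) (il_rho _ _ hG) hi).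
  assert (sa1 := fundamental_short_arcs G rho xi0 gamma L eta l (q rho (S l)) hG (Nat.le_refl _)
    (fun x => hd l x (Nat.le_refl _)) hZ hsq).
  assert (sa2 := fundamental_short_arcs G rho xi0 gamma L eta (S l) (q rho l) hG ltac:(lia)
    (fun x => hd (S l) x ltac:(lia)) hZ hsq).
  split.
  - apply (f_ren_close F G Df E D rho xi0 gamma m M v L eta K l nm sm hv hsmall sa1).
    intros sg hsg. cbv zeta. rewrite (mtilde_eq F G Df D rho xi0 gamma L eta l nm hDf sa1).
    apply (htr L eta); auto.
  - apply (g_ren_close F G Df E D rho xi0 gamma m M v L eta K l nm sm hv hsmall sa2).
    intros sg hsg. cbv zeta. rewrite (mhat_eq F G Df D rho xi0 gamma L eta l nm hDf sa2).
    rewrite <- exp_Ropp, Ropp_involutive.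
    apply (htr L eta); auto.
Qed.
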